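(* Let $p\in[2,3)$, $T>0$, $y,\tilde y\in\mathbb{R}^n$, $U\subseteq\mathbb{R}^m$, $u,\tilde u\in L^\infty([0,T],U)$. Let $b:[0,T]\times\mathbb{R}^n\times U\to\mathbb{R}^n$ be such that: $b(\cdot,x,u)$ is measurable for all $(x,u)$; $b(t,\cdot,\cdot)$ is continuous for a.e. $t$; and for some $C_b\ge0$, for a.e. $t$, all $x,\tilde x\in\mathbb{R}^n$ and all $v,\tilde v\in U$: $\|b(t,x,v)\|\le C_b$, $\|b(t,x,v)-b(t,\tilde x,v)\|\le C_b\|x-\tilde x\|$ and $\|b(t,x,v)-b(t,x,\tilde v)\|\le C_b\|v-\tilde v\|$. Let $\sigma\in C^3_b([0,T]\times\mathbb{R}^n,\mathbb{R}^{n\times d})$, let $\mathbf X=(X,\mathbb X),\widetilde{\mathbf X}=(\widetilde X,\widetilde{\mathbb X})\in\mathscr C^p([0,T],\mathbb{R}^d)$ be two rough paths, and let $(Y,Y')\in\mathscr D^p_X$ and $(\widetilde Y,\widetilde Y')\in\mathscr D^p_{\widetilde X}$, with $Y'=\sigma(\cdot,Y)$ and $\widetilde Y'=\sigma(\cdot,\widetilde Y)$, be the solutions on $[0,T]$ to $$Y_t=y+\int_0^tb(s,Y_s,u_s)ds+\int_0^t\sigma(s,Y_s)d\mathbf X_s,\qquad \widetilde Y_t=\tilde y+\int_0^tb(s,\widetilde Y_s,\tilde u_s)ds+\int_0^t\sigma(s,\widetilde Y_s)d\widetilde{\mathbf X}_s.$$ Then there exist constants $C_{p,b,\sigma}\ge1$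 and $0<\alpha_{p,b,\sigma}<1$, depending only on $(p,b,\sigma)$, such that for any interval $I=[t_0,t_1]\subseteq[0,T]$, $$\|Y'-\widetilde Y'\|_{p,I}+\|R^Y-R^{\widetilde Y}\|_{\frac p2,I}\le C_{p,b,\sigma}\exp\big(C_{p,b,\sigma}N_{\alpha_{p,b,\sigma},I}(w)\big)\big(\|Y_{t_0}-\widetilde Y_{t_0}\|+\|\Delta\mathbf X\|_{p,I}+|I|\,\|u-\tilde u\|_{L^\infty(I,U)}\big),$$ $$\|Y-\widetilde Y\|_{\infty,I}\le C_{p,b,\sigma}\exp\big(C_{p,b,\sigma}N_{\alpha_{p,b,\sigma},I}(w)\big)\big(\|Y_{t_0}-\widetilde Y_{t_0}\|+\|\Delta\mathbf X\|_{p,I}+|I|\,\|u-\tilde u\|_{L^\infty(I,U)}\big).$$ Moreover, if $u_t=\tilde u_t$ for almost all $t\in I\setminus J$, where $J\subseteq I$ is a subinterval, then $$\|Y'-\widetilde Y'\|_{p,I}+\|R^Y-R^{\widetilde Y}\|_{\frac p2,I}\le C_{p,b,\sigma}\exp\big(C_{p,b,\sigma}N_{\alpha_{p,b,\sigma},I}(w)\big)\big(\|Y_{t_0}-\widetilde Y_{t_0}\|+\|\Delta\mathbf X\|_{p,I}+|J|\,\|u-\tilde u\|_{L^\infty(I,U)}\big),$$ $$\|Y-\widetilde Y\|_{\infty,I}\le C_{p,b,\sigma}\exp\big(C_{p,b,\sigma}N_{\alpha_{p,b,\sigma},I}(w)\big)\big(\|Y_{t_0}-\widetilde Y_{t_0}\|+\|\Delta\mathbf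 X\|_{p,I}+|J|\,\|u-\tilde u\|_{L^\infty(I,U)}\big)$$ for some constants $C_{p,b,\sigma}\ge1$ and $0<\alpha_{p,b,\sigma}<1$.
   Context: $L^\infty([0,T],U)$: measurable essentially bounded maps $[0,T]\to U$. $C^k_b$: bounded $k$-times continuously differentiable functions with bounded derivatives up to order $k$. $|I|$ is the length of $I$; $\|Y\|_{\infty,I}=\sup_{t\in I}\|Y_t\|$. For $X:[0,T]\to E$, $X_{s,t}:=X_t-X_s$, and $\|X\|_{q,[s,t]}:=\big(\sup_\pi\sum_{[u,v]\in\pi}\|X_{u,v}\|^q\big)^{1/q}$ (sup over partitions $\pi$ of $[s,t]$); the same formula defines $\|R\|_{q,[s,t]}$ for two-parameter maps $R:[0,T]^2\to E$. $\mathcal C^p$: continuous paths with finite $p$-variation on $[0,T]$. A rough path $\mathbf X=(X,\mathbb X)\in\mathscr C^p([0,T],\mathbb{R}^d)$ consists of $X\in\mathcal C^p([0,T],\mathbb{R}^d)$ and a continuous $\mathbb X:[0,T]^2\to\mathbb{R}^{d\times d}$ of finite $\frac p2$-variation with $\mathbb X^{ij}_{s,t}=\mathbb X^{ij}_{s,r}+\mathbb X^{ij}_{r,t}+X^i_{s,r}X^j_{r,t}$. $\|\Delta\mathbf X\|_{p,I}:=\|X-\widetilde X\|_{p,I}+\|\mathbb X-\widetilde{\mathbb X}\|_{\frac p2,I}$. A controlled path $(Y,Y')\in\mathscr D^p_X([0,T],\mathbb{R}^k)$ is a pair $Y\in\mathcal C^p([0,T],\mathbb{R}^k)$, $Y'\in\mathcal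 C^p([0,T],\mathbb{R}^{k\times d})$ such that $R^Y_{s,t}:=Y_{s,t}-Y'_sX_{s,t}$ has finite $\frac p2$-variation (and $R^{\widetilde Y}_{s,t}:=\widetilde Y_{s,t}-\widetilde Y'_s\widetilde X_{s,t}$). For $(Y,Y')\in\mathscr D^p_X([0,T],\mathbb{R}^{k\times d})$, the rough integral is $\int_s^tY_r\,d\mathbf X_r:=\lim_{|\pi|\to0}\sum_{[u,v]\in\pi}(Y_uX_{u,v}+Y'_u\mathbb X_{u,v})$; in the equations it is applied to $(\sigma(\cdot,Y),\nabla_x\sigma(\cdot,Y)Y')$ (resp. with tildes). Solutions exist and are unique under these hypotheses. For $0\le s\le t\le T$, $w_{\mathbf X}(s,t):=\|X\|^p_{p,[s,t]}+\|\mathbb X\|_{\frac p2,[s,t]}^{p/2}$ and $w(s,t):=6^p\big(w_{\mathbf X}(s,t)+w_{\widetilde{\mathbf X}}(s,t)+|t-s|\big)$. For $\alpha>0$ and $[s,t]\subseteq[0,T]$: $\tau_0=s$, $\tau_{i+1}=\inf\{r:w(\tau_i,r)\ge\alpha,\ \tau_i<r\le t\}\wedge t$ ($\inf\emptyset=+\infty$), $N_{\alpha,[s,t]}(w):=\sup\{k\in\mathbb N\cup\{0\}:\tau_k<t\}$. *)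

(* Defs.v *)
From HB Require Import structures.
From mathcomp Require Import all_boot all_order all_algebra.
From mathcomp Require Import all_classical all_reals all_analysis.

Set Implicit Arguments.
Unset Strict Implicit.
Unset Printing Implicit Defensive.

Import Order.TTheory GRing.Theory Num.Theory.
Import numFieldNormedType.Exports.

Local Open Scope classical_set_scope.
Local Open Scope ring_scope.

(* Conventions.  R^k is 'cV[R]_k and every vector or matrix norm is the norm
   `|.| of the library (maximum of the absolute values of the entries); all
   norms being equivalent, this only affects the values of the constants.
   A map on [0, T] (resp. [0, T]^2) is a function on R (resp. on R and R) of
   which only the values on [0, T] (resp. [0, T]^2) are ever used. *)

(* "Measurable" and "almost every" refer to the Lebesgue sigma-algebra, i.e. to
   the completion of the Borel one. *)
Notation leb := (@completed_lebesgue_measure _).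

Section Partitions.
Context {R : realType}.

(* With the library's [itv_partition], a partition s = t_0 < ... < t_k = t of
   [s, t] is represented by the list [t_1; ...; t_k]. *)
Definition subintervals (s : R) (pi : seq R) : seq (R * R) := zip (s :: pi) pi.

Definition mesh (s : R) (pi : seq R) : R :=
  \big[Num.max/0]_(I <- subintervals s pi) (I.2 - I.1).

Definition mesh_to0 (s t : R) : set_system (seq R) :=
  filter_from [set e : R | 0 < e]
    (fun e => [set pi | itv_partition s t pi /\ mesh s pi < e]).

End Partitions.

Section Variation.
Context {R : realType} {E : normedModType R}.
Local Open Scope ereal_scope.

Definition pvar2 (q : R) (A : R -> R -> E) (s t : R) : \bar R :=
  ereal_sup [set (\sum_(I <- subintervals s pi) `|A I.1 I.2| `^ q)%:E
            | pi in itv_partition s t] `^ q^-1.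

Definition pvar (q : R) (X : R -> E) : R -> R -> \bar R :=
  pvar2 q (fun s t => X t - X s)%R.

Definition sup_norm (X : R -> E) (s t : R) : \bar R :=
  ereal_sup [set `|X r|%:E | r in `[s, t]].

Definition Cvar (p T : R) (X : R -> E) : Prop :=
  {within `[0%R, T], continuous X} /\ pvar p X 0%R T < +oo.

End Variation.

Section Cb.
Context {R : realType} {V W : normedModType R}.

(* C^k_b on a set D such as [0, T] x R^n: the derivative at z is the Frechet
   derivative relative to D (hence one-sided in time at the end points).  Since
   it is used with V of finite dimension, continuity and boundedness of Df and
   of its own derivatives are expressed in each fixed direction v. *)
Fixpoint Cb (k : nat) (D : set V) (f : V -> W) {struct k} : Prop :=
  [/\ {within D, continuous f},
      exists M : R, forall z, D z -> `|f z| <= M &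
      if k is j.+1 then
        exists Df : V -> {linear V -> W},
          (forall z, D z ->
             `|z' - z|^-1 *: (f z' - f z - Df z (z' - z))
               @[z' --> within D (nbhs z)] --> (0 : W)) /\
          (forall v, Cb j D (fun z => Df z v))
      else True].

End Cb.

Section RoughPaths.
Context {R : realType} {n d : nat}.
Implicit Types (p T : R) (X : R -> 'cV[R]_d) (XX : R -> R -> 'M[R]_d).

Definition rough_path p T X XX : Prop :=
  [/\ Cvar p T X,
      {within `[0, T] `*` `[0, T], continuous (fun z : R * R => XX z.1 z.2)},
      (pvar2 (p / 2) XX 0 T < +oo)%E &
      forall s r t, s \in `[0, T] -> r \in `[0, T] -> t \in `[0, T] ->
        XX s t = XX s r + XX r t + (X r - X s) *m (X t - X r)^T].

Definition remainder X (Y : R -> 'cV[R]_n) (Y' : R -> 'M[R]_(n, d)) (s t : R) :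
    'cV[R]_n :=
  Y t - Y s - Y' s *m (X t - X s).

Definition controlled_path p T X (Y : R -> 'cV[R]_n) (Y' : R -> 'M[R]_(n, d)) :
    Prop :=
  [/\ Cvar p T Y, Cvar p T Y' & (pvar2 (p / 2) (remainder X Y Y') 0 T < +oo)%E].

(* The integrand Z is matrix-valued, so its Gubinelli derivative at time u is a
   linear map R^d -> R^(n x d), given by its values Z' u l on the basis vectors:
   Z_{u,v} ~ \sum_l X^l_{u,v} Z' u l.  The term Z'_u XX_{u,v} is thus the vector
   with i-th entry \sum_(l, j) (Z' u l)_{ij} XX^{lj}_{u,v}; as the additivity
   relation in [rough_path] shows, l is the inner integration index of XX. *)
Definition rough_sum X XX (Z : R -> 'M[R]_(n, d)) (Z' : R -> 'I_d -> 'M[R]_(n, d))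
    (s : R) (pi : seq R) : 'cV[R]_n :=
  \sum_(I <- subintervals s pi)
     (Z I.1 *m (X I.2 - X I.1) + \sum_(l < d) Z' I.1 l *m (row l (XX I.1 I.2))^T).

Definition is_rough_integral X XX (Z : R -> 'M[R]_(n, d))
    (Z' : R -> 'I_d -> 'M[R]_(n, d)) (s t : R) (v : 'cV[R]_n) : Prop :=
  rough_sum X XX Z Z' s pi @[pi --> mesh_to0 s t] --> v.

Definition drift {m} (b : R -> 'cV[R]_n -> 'cV[R]_m -> 'cV[R]_n)
    (Y : R -> 'cV[R]_n) (u : R -> 'cV[R]_m) (t : R) : 'cV[R]_n :=
  \col_i (\int[leb]_(s in `[0, t]) b s (Y s) (u s) i 0).

Definition RDE_solution {m} p T (b : R -> 'cV[R]_n -> 'cV[R]_m -> 'cV[R]_n)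
    (sigma : R -> 'cV[R]_n -> 'M[R]_(n, d)) (y : 'cV[R]_n) (u : R -> 'cV[R]_m)
    X XX (Y : R -> 'cV[R]_n) (Y' : R -> 'M[R]_(n, d)) : Prop :=
  [/\ controlled_path p T X Y Y',
      forall t, t \in `[0, T] -> Y' t = sigma t (Y t) &
      forall t, t \in `[0, T] ->
        is_rough_integral X XX (fun s => sigma s (Y s))
          (fun s l => 'd (sigma s) (Y s) (col l (Y' s)))
          0 t (Y t - y - drift b Y u t)].

End RoughPaths.

Section Controls.
Context {R : realType} {n m : nat}.
Local Open Scope ereal_scope.

Definition mx_measurable {k l} (D : set R) (f : R -> 'M[R]_(k, l)) : Prop :=
  forall i j, @measurable_fun _ _
    (caratheodory_type (@wlength R idfun)^*%mu) (measurableTypeR R)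
    D (fun t => f t i j).

(* Essential supremum of |u| over I; equal to 0 when I is a null set. *)
Definition Linf_norm (I : set R) (u : R -> 'cV[R]_m) : \bar R :=
  'N[leb]_+oo[(fun t => `|u t|%:E) \_ I].

Definition Linf (T : R) (U : set 'cV[R]_m) (u : R -> 'cV[R]_m) : Prop :=
  [/\ forall t, t \in `[0%R, T] -> U (u t),
      mx_measurable `[0%R, T] u &
      Linf_norm `[0%R, T] u < +oo].

Local Open Scope ring_scope.

Definition drift_assumption (T : R) (U : set 'cV[R]_m)
    (b : R -> 'cV[R]_n -> 'cV[R]_m -> 'cV[R]_n) : Prop :=
  [/\ forall x v, U v -> mx_measurable `[0, T] (fun t => b t x v),
      {ae leb, forall t, t \in `[0, T] ->
        {within setT `*` U, continuous (fun z => b t z.1 z.2)}} &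
      exists2 K : R, 0 <= K &
        {ae leb, forall t, t \in `[0, T] ->
          forall x x' v v', U v -> U v' ->
          [/\ `|b t x v| <= K,
              `|b t x v - b t x' v| <= K * `|x - x'| &
              `|b t x v - b t x v'| <= K * `|v - v'|]}].

End Controls.

Section Greedy.
Context {R : realType}.
Local Open Scope ereal_scope.

Definition w_rough {d} (p : R) (X : R -> 'cV[R]_d) (XX : R -> R -> 'M[R]_d)
    (s t : R) : \bar R :=
  pvar p X s t `^ p + pvar2 (p / 2)%R XX s t `^ (p / 2)%R.

Definition w_control {d} (p : R) (X Xt : R -> 'cV[R]_d)
    (XX XXt : R -> R -> 'M[R]_d) (s t : R) : \bar R :=
  (6 `^ p)%R%:E * (w_rough p X XX s t + w_rough p Xt XXt s t + `|t - s|%R%:E).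

Variables (w : R -> R -> \bar R) (alpha s t : R).

Fixpoint greedy_time (i : nat) : R :=
  if i is j.+1 then
    let tau := greedy_time j in
    fine (mine (ereal_inf [set r%:E | r in
                 [set r : R | alpha%:E <= w tau r /\ (tau < r <= t)%R]]) t%:E)
  else s.

(* The supremum is taken in N u {0, +oo}, hence is 0 over the empty set (which
   happens when s = t). *)
Definition greedy_number : \bar R :=
  maxe 0 (ereal_sup [set k%:R%:E | k in [set k | (greedy_time k < t)%R]]).

End Greedy.

Section Estimate.
Context {R : realType} {n m d : nat}.
Local Open Scope ereal_scope.

(* [len] stands for |I| in the first pair of estimates, |J| in the second. *)
Definition stability_rhs (p C alpha : R) (X Xt : R -> 'cV[R]_d)
    (XX XXt : R -> R -> 'M[R]_d) (Y Yt : R -> 'cV[R]_n) (u ut : R -> 'cV[R]_m)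
    (t0 t1 : R) (len : \bar R) : \bar R :=
  C%:E * expeR (C%:E * greedy_number (w_control p X Xt XX XXt) alpha t0 t1) *
  (`|Y t0 - Yt t0|%R%:E
   + (pvar p (fun r => X r - Xt r)%R t0 t1
      + pvar2 (p / 2)%R (fun r s => XX r s - XXt r s)%R t0 t1)
   + len * Linf_norm `[t0, t1] (fun t => u t - ut t)%R).

End Estimate.

(* Main.v *)
Require Import Defs.
From HB Require Import structures.
From mathcomp Require Import all_boot all_order all_algebra.
From mathcomp Require Import all_classical all_reals all_analysis.
From mathcomp Require Import measurable_realfun ess_sup_inf.
From mathcomp Require Import ring lra.

(** The estimate is first proved on intervals where the drivers are small, then
    propagated along the greedy partition.

    A two-parameter map A that vanishes on the diagonal has q-variation at most a if and
    only if |A u v| <= a * w u v ^ (1/q) for a superadditive w of mass at most one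
    ([pvar2_control], [pvar2_le]). On a given interval, the finitely many controls of the
    drivers, of the remainders, of their differences and of the drifts are averaged into
    a single w; with h = w ^ (1/p) in place of |t - s| ^ (1/p), one then argues as for
    Hoelder paths.

    The increments of a solution differ from those of its drift by the sewing of the
    germ sigma(u, Y_u) X_{u,v} + (D_x sigma sigma)(u, Y_u) XX_{u,v}. By Chen's relation
    the defect of additivity of the germ is a sum of products of increments
    ([germ_defect]), of order h ^ 3 = w ^ (3/p); as 3/p > 1, sewing ([sewing_sum])
    bounds the remainder of the solution by a small multiple of itself plus a constant
    ([a_priori]). The same scheme applied to the difference of two germs bounds the
    difference of the remainders by a small multiple of itself, plus the distances of
    the initial values, of the drivers and of the controls ([diff_rem_le]); it is here
    that sigma needs a derivative with second-order Lipschitz bounds, hence three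
    derivatives. The remainders having finite variation, the small multiples can be
    absorbed ([local_estimate]). Drifts enter through two facts: they are Lipschitz in
    time, and the difference of two of them on [s, t] is controlled by the distance of
    the solutions times t - s, plus that of the controls times the length of the part of
    J in [s, t] ([drift_bounds]).

    The greedy times at level a ^ p cut I into at most N + 1 intervals on which all the
    drivers have norm at most a ([greedy_drivers]). Passing from one to the next
    multiplies the error by a constant g ([stable_step]): the variation over a union of
    two intervals is bounded by those over the two parts and the error of additivity at
    the common point, which for remainders is the increment of Y' - Yt' times that of
    X, up to the distance of the drivers ([pvar2_concat]). The final factor g ^ (N + 1)
    is absorbed in C exp(C N). *)

Set Implicit Arguments.
Unset Strict Implicit.
Unset Printing Implicit Defensive.

Import Order.TTheory GRing.Theory Num.Theory.
Import numFieldNormedType.Exports.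

Local Open Scope classical_set_scope.
Local Open Scope ring_scope.

(** * Linear identities in an abelian group, by reflection *)

Inductive zexp := ZVar of nat | ZZero | ZAdd of zexp & zexp | ZOpp of zexp.

Fixpoint zeval (V : zmodType) (env : seq V) e : V :=
  match e with
  | ZVar i => env`_i
  | ZZero => 0
  | ZAdd e1 e2 => zeval env e1 + zeval env e2
  | ZOpp e1 => - zeval env e1
  end.

Fixpoint zcoef e (i : nat) : int :=
  match e with
  | ZVar j => if i == j then 1 else 0
  | ZZero => 0
  | ZAdd e1 e2 => zcoef e1 i + zcoef e2 i
  | ZOpp e1 => - zcoef e1 i
  end.

Lemma zevalE (V : zmodType) (env : seq V) e :
  zeval env e = \sum_(i < size env) env`_i *~ zcoef e i.
Proof.
elim: e => [j||e1 IH1 e2 IH2|e1 IH1] /=.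
- have [jl|jl] := ltnP j (size env); last first.
    rewrite nth_default // big1 // => i _.
    by rewrite ifN ?mulr0z // ltn_eqF // (leq_trans (ltn_ord i)).
  rewrite (bigD1 (Ordinal jl)) //= eqxx mulr1z big1 ?addr0 // => i ij.
  by rewrite ifN ?mulr0z //; apply: contraNneq ij => ij; apply/eqP/val_inj.
- by rewrite big1 // => i _; rewrite mulr0z.
- by rewrite IH1 IH2 -big_split; apply: eq_bigr => i _; rewrite mulrzDr.
- by rewrite IH1 -sumrN; apply: eq_bigr => i _; rewrite mulrNz.
Qed.

(** Two formal sums with the same integer coefficients have the same value; the
    coefficients are compared by computation. *)
Lemma zeval_eq (V : zmodType) (env : seq V) e1 e2 :
  all (fun i => zcoef e1 i == zcoef e2 i) (iota 0 (size env)) ->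
  zeval env e1 = zeval env e2.
Proof.
move=> /allP h; rewrite !zevalE; apply: eq_bigr => i _.
by rewrite (eqP (h i _)) // mem_iota /= add0n ltn_ord.
Qed.

Ltac zmem x l :=
  lazymatch l with
  | nil => constr:(false)
  | cons ?y ?l' => match goal with
      | _ => let _ := constr:(erefl x : x = y) in constr:(true)
      | _ => zmem x l' end
  end.
Ltac zenv e l :=
  lazymatch e with
  | ?a + ?b => let l1 := zenv a l in zenv b l1
  | - ?a => zenv a l
  | 0 => l
  | _ => match goal with
         | _ => let t := zmem e l in lazymatch t with true => l | false => constr:(cons e l) end
         end
  end.
Ltac zidx x l :=
  lazymatch l with
  | cons ?y ?l' => match goal with
      | _ => let _ := constr:(erefl x : x = y) in constr:(0%N)
      | _ => let n := zidx x l' in constr:(S n) end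
  end.
Ltac zreify e l :=
  lazymatch e with
  | ?a + ?b => let x := zreify a l in let y := zreify b l in constr:(ZAdd x y)
  | - ?a => let x := zreify a l in constr:(ZOpp x)
  | 0 => constr:(ZZero)
  | _ => let i := zidx e l in constr:(ZVar i)
  end.
(** Reifies both sides over their common list of atoms. *)
Ltac zmod :=
  lazymatch goal with
  | |- @eq ?V ?a ?b =>
    let l0 := constr:(@nil V) in
    let l1 := zenv a l0 in let l := zenv b l1 in
    let x := zreify a l in let y := zreify b l in
    exact: (@zeval_eq _ l x y isT)
  end.

(** * Partitions, controls and q-variation *)

Section Controls.
Context {R : realType}.
Implicit Types (s t u v r : R) (w : R -> R -> R) (pi : seq R).

Lemma subintervals_cat s pi1 pi2 :
  subintervals s (pi1 ++ pi2) =
  subintervals s pi1 ++ subintervals (last s pi1) pi2.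
Proof.
rewrite /subintervals; elim: pi1 s => [|x pi1 IH] s //=.
by congr cons; exact: IH.
Qed.

Lemma sum_subintervals_cons (V : nmodType) (F : R * R -> V) s x pi :
  \sum_(I <- subintervals s (x :: pi)) F I =
  F (s, x) + \sum_(I <- subintervals x pi) F I.
Proof. by rewrite [subintervals _ _]/= big_cons. Qed.

Lemma sum_subintervals_rcons (V : nmodType) (F : R * R -> V) s x pi :
  \sum_(I <- subintervals s (rcons pi x)) F I =
  \sum_(I <- subintervals s pi) F I + F (last s pi, x).
Proof. by rewrite -cats1 subintervals_cat big_cat /= big_seq1. Qed.

(** A control without the usual continuity, so that the q-th power of every finite
    q-variation is one. *)
Definition control s t w :=
  (forall u v, s <= u -> u <= v -> v <= t -> 0 <= w u v) /\
  (forall u r v, s <= u -> u <= r -> r <= v -> v <= t ->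
     w u r + w r v <= w u v).

Lemma control_ge0 s t w u v : control s t w ->
  s <= u -> u <= v -> v <= t -> 0 <= w u v.
Proof. by case=> + _; exact. Qed.

Lemma control_mono s t w u u' v' v : control s t w ->
  s <= u -> u <= u' -> u' <= v' -> v' <= v -> v <= t -> w u' v' <= w u v.
Proof.
move=> [w0 wD] su uu' u'v' v'v vt.
have h1 := wD u u' v su uu' (le_trans u'v' v'v) vt.
have h2 := wD u' v' v (le_trans su uu') u'v' v'v vt.
have h3 := w0 u u' su uu' (le_trans (le_trans u'v' v'v) vt).
have h4 := w0 v' v (le_trans (le_trans su uu') u'v') v'v vt.
lra.
Qed.

Lemma control_sub s t s' t' w : s <= s' -> t' <= t ->
  control s t w -> control s' t' w.
Proof.
move=> ss tt [w0 wD]; split=> [u v su uv vt|u r v su ur rv vt].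
  by apply: w0 => //; [exact: le_trans su|exact: le_trans tt].
by apply: wD => //; [exact: le_trans su|exact: le_trans tt].
Qed.

Lemma control0 s t : control s t (fun _ _ => 0).
Proof. by split=> // *; rewrite addr0. Qed.

Lemma controlD s t w1 w2 : control s t w1 -> control s t w2 ->
  control s t (fun u v => w1 u v + w2 u v).
Proof.
move=> [p1 a1] [p2 a2]; split=> [u v su uv vt|u r v su ur rv vt].
  by rewrite addr_ge0 ?p1 ?p2.
have := a1 u r v su ur rv vt; have := a2 u r v su ur rv vt; lra.
Qed.

Lemma controlZ s t w (c : R) : 0 <= c -> control s t w ->
  control s t (fun u v => c * w u v).
Proof.
move=> c0 [w0 wD]; split=> [u v su uv vt|u r v su ur rv vt].
  by rewrite mulr_ge0 // w0.
by rewrite -mulrDr ler_wpM2l // wD.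
Qed.

Lemma sum_control s t w pi : control s t w -> itv_partition s t pi ->
  \sum_(I <- subintervals s pi) w I.1 I.2 <= w s t.
Proof.
elim: pi s => [|x pi IH] s cw hpi.
  rewrite big_nil; apply: (control_ge0 cw) => //.
  exact: itv_partition_le hpi.
rewrite sum_subintervals_cons /=.
have hx := itv_partition_cons hpi.
have sx : s <= x by case: hpi => /= /andP[/ltW].
have xt := itv_partition_le hx.
apply: (le_trans (lerD (lexx _) (IH x _ hx))).
  exact: control_sub cw.
by case: cw => _; apply.
Qed.

Lemma subintervals_mem s t pi I : itv_partition s t pi ->
  I \in subintervals s pi -> [/\ s <= I.1, I.1 < I.2 & I.2 <= t].
Proof.
elim: pi s => [|x pi IH] s // hpi.
have hx := itv_partition_cons hpi.
have sx : s < x by case: hpi => /= /andP[].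
rewrite [subintervals _ _]/= inE => /orP[/eqP->/=|/(IH x hx)[h1 h2 h3]].
  by split => //; exact: itv_partition_le hx.
by split => //; rewrite (le_trans (ltW sx)).
Qed.

End Controls.

Section Variation.
Context {R : realType} {E : normedModType R}.
Implicit Types (q s t u v r a c : R) (A : R -> R -> E) (pi : seq R).

Definition varsum q A s pi : R :=
  \sum_(I <- subintervals s pi) `|A I.1 I.2| `^ q.

(** The q-th power of the q-variation norm: unlike the norm itself, it is
    superadditive in the interval. *)
Definition qsup q A s t : \bar R :=
  ereal_sup [set (varsum q A s pi)%:E | pi in itv_partition s t].

Lemma pvar2E q A s t : pvar2 q A s t = (qsup q A s t `^ q^-1)%E.
Proof. by []. Qed.

Lemma varsum_ge0 q A s pi : 0 <= varsum q A s pi.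
Proof. by apply: sumr_ge0 => I _; exact: powR_ge0. Qed.

Lemma varsum_cat q A s pi1 pi2 :
  varsum q A s (pi1 ++ pi2) = varsum q A s pi1 + varsum q A (last s pi1) pi2.
Proof. by rewrite /varsum subintervals_cat big_cat. Qed.

Lemma qsup_ge q A s t pi : itv_partition s t pi ->
  ((varsum q A s pi)%:E <= qsup q A s t)%E.
Proof. by move=> h; apply: ereal_sup_ubound; exists pi. Qed.

Lemma itv_partition_ex s t : s <= t -> exists pi, itv_partition s t pi.
Proof.
rewrite le_eqVlt => /orP[/eqP->|st]; first by exists [::]; split=> /=.
by exists [:: t]; exact: itv_partition1.
Qed.

Lemma qsup_ge0 q A s t : s <= t -> (0 <= qsup q A s t)%E.
Proof.
move=> /itv_partition_ex[pi hpi]; apply: le_trans (qsup_ge q A hpi).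
by rewrite lee_fin varsum_ge0.
Qed.

Lemma qsup_ge1 q A s t : s < t -> ((`|A s t| `^ q)%:E <= qsup q A s t)%E.
Proof.
move=> st; have := qsup_ge q A (itv_partition1 st).
by rewrite /varsum sum_subintervals_cons big_nil addr0.
Qed.

Lemma qsup_superadd q A s r t : s <= r -> r <= t ->
  (qsup q A s r + qsup q A r t <= qsup q A s t)%E.
Proof.
move=> sr rt.
have [->|foo] := eqVneq (qsup q A s t) +oo%E; first by rewrite leey.
have f : qsup q A s t \is a fin_num.
  by rewrite ge0_fin_numE ?ltey // qsup_ge0 // (le_trans sr).
set c := fine (qsup q A s t); have cE : qsup q A s t = c%:E by rewrite fineK.
have key pi1 pi2 : itv_partition s r pi1 -> itv_partition r t pi2 ->
    varsum q A s pi1 + varsum q A r pi2 <= c.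
  move=> h1 h2; rewrite -lee_fin -cE.
  have := qsup_ge q A (itv_partition_cat h1 h2).
  by rewrite varsum_cat; case: h1 => _ /eqP ->.
have h1 pi2 : itv_partition r t pi2 ->
    (qsup q A s r <= (c - varsum q A r pi2)%:E)%E.
  move=> h2; apply/ereal_supP => _ [pi1 h1 <-].
  by rewrite lee_fin lerBrDr key.
have f1 : qsup q A s r \is a fin_num.
  have [pi2 /h1 h2] := itv_partition_ex rt.
  by rewrite ge0_fin_numE ?qsup_ge0 // (le_lt_trans h2) // ltey.
rewrite -(fineK f1) cE addeC -leeBrDr // -EFinB.
apply/ereal_supP => _ [pi2 h2 <-].
have := h1 _ h2; rewrite -(fineK f1) !lee_fin; lra.
Qed.

Lemma qsup_mono q A s s' t' t : s <= s' -> s' <= t' -> t' <= t ->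
  (qsup q A s' t' <= qsup q A s t)%E.
Proof.
move=> h1 h2 h3.
apply: le_trans (qsup_superadd q A h1 (le_trans h2 h3)).
apply: le_trans (leeDr _ (qsup_ge0 q A h1)).
apply: le_trans (qsup_superadd q A h2 h3).
by rewrite leeDl // qsup_ge0.
Qed.

Lemma qsup_fin q A s t : s <= t -> (qsup q A s t < +oo)%E ->
  qsup q A s t \is a fin_num.
Proof. by move=> st h; rewrite ge0_fin_numE // qsup_ge0. Qed.

Lemma qsup_control q A s t : (qsup q A s t < +oo)%E ->
  control s t (fun u v => fine (qsup q A u v)).
Proof.
move=> foo.
have fn u v : s <= u -> u <= v -> v <= t -> qsup q A u v \is a fin_num.
  move=> su uv vt; apply: qsup_fin => //.
  by apply: le_lt_trans foo; exact: qsup_mono.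
split=> [u v su uv vt|u r v su ur rv vt].
  by rewrite fine_ge0 // qsup_ge0.
have su' := le_trans su ur; have rt := le_trans rv vt.
have uv := le_trans ur rv.
rewrite -lee_fin EFinD !fineK ?fn //; exact: qsup_superadd.
Qed.

(** Lower semicontinuity of the power of the norm. At l = 0, where the power is not
    differentiable, the bound y is negative. *)
Lemma near_powR_gt {T : Type} (F : set_system T) {FF : Filter F} (f : T -> E)
    (l : E) q y : f r @[r --> F] --> l -> y < `|l| `^ q ->
  \forall r \near F, 0 < q -> y < `|f r| `^ q.
Proof.
move=> fl yl; have [l0|l0] := eqVneq l 0.
  near=> r => q0; apply: lt_le_trans (powR_ge0 _ _).
  by move: yl; rewrite l0 normr0 powR0 // gt_eqF.
have lp : 0 < `|l| by rewrite normr_gt0.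
have c : {for `|l|, continuous (fun x : R => x `^ q)}.
  apply: differentiable_continuous; apply/derivable1_diffP.
  by have [] := is_derive1_powR q lp.
have h : `|f r| `^ q @[r --> F] --> `|l| `^ q.
  have fn : `|f r| @[r --> F] --> `|l| by exact: cvg_norm.
  have := continuous_cvg _ c fn.
  exact.
by near=> r => _; near: r; exact: (cvgr_gt _ h).
Unshelve. all: by end_near. Qed.

(** The last point t of a partition of [s, t] can be moved to a near r < t: by left
    continuity the sum hardly decreases, and it becomes a sum over [s, r]. *)
Lemma qsup_left q A s t (c : \bar R) : 0 < q -> s < t ->
  (forall u, s <= u < t -> A u r @[r --> t^'-] --> A u t) ->
  (forall r, s < r < t -> (qsup q A s r <= c)%E) -> (qsup q A s t <= c)%E.
Proof.
move=> q0 st cA hc; apply/ereal_supP => _ [pi hpi <-].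
have [->|cN] := eqVneq c +oo%E; first exact: leey.
have cf : c \is a fin_num.
  rewrite ge0_fin_numE ?ltey //.
  have sm : s < (s + t) / 2 < t by lra.
  by apply: le_trans (hc _ sm); rewrite qsup_ge0 // ltW //; lra.
rewrite -(fineK cf) lee_fin; set d := fine c.
case/lastP: pi hpi => [/itv_partition_nil e|pi x]; first by rewrite e ltxx in st.
rewrite /itv_partition rcons_path last_rcons => -[/andP[h1 h2] /eqP ?]; subst x.
have hu : itv_partition s (last s pi) pi by split.
have su := itv_partition_le hu; set u := last s pi in h2 hu su *.
rewrite /varsum sum_subintervals_rcons /= -/u -lerBrDl leNgt; apply/negP => hlt.
have /filter_ex[r [[ur rt] /(_ q0)]] : \forall r \near t^'-,
    (u < r /\ r < t) /\ (0 < q -> d - varsum q A s pi < `|A u r| `^ q).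
  near=> r; split; last first.
    near: r; apply: near_powR_gt hlt; first by apply: cA; rewrite su.
  by split; near: r; [exact: nbhs_left_gt|exact: nbhs_left_lt].
apply/negP; rewrite -leNgt.
have := hc r; rewrite (le_lt_trans su ur) rt -(fineK cf) => /(_ isT) hr.
have := le_trans (qsup_ge q A (itv_partition_cat hu (itv_partition1 ur))) hr.
rewrite lee_fin varsum_cat /= -/u {2}/varsum sum_subintervals_cons big_nil /=.
by rewrite addr0 -lerBrDl.
Unshelve. all: by end_near. Qed.

(** A path of finite variation that is right-continuous at s has no variation on
    small intervals to the right of s: a nearly optimal partition of [s, t] stays
    nearly optimal when its first point s is moved to a near r > s, which leaves
    nothing for [s, r]. *)
Lemma qsup_right0 q A s t e : 0 < q -> s < t -> (qsup q A s t < +oo)%E ->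
  (forall v, s < v <= t -> A r v @[r --> s^'+] --> A s v) ->
  0 < e -> \forall r \near s^'+, (qsup q A s r <= e%:E)%E.
Proof.
move=> q0 st foo cA e0.
have f := qsup_fin (ltW st) foo.
set S := fine (qsup q A s t); have SE : qsup q A s t = S%:E by rewrite fineK.
have [_ [pi hpi <-]] : exists2 y, [set (varsum q A s pi)%:E
    | pi in itv_partition s t] y & ((S - e / 2)%:E < y)%E.
  apply: ereal_sup_gt; rewrite -/(qsup _ _ _ _) SE lte_fin; lra.
rewrite lte_fin => hS.
case: pi hpi hS => [/itv_partition_nil h|x pi hpi hS]; first by rewrite h ltxx in st.
have hx := itv_partition_cons hpi.
have sx : s < x by case: hpi => /= /andP[].
have xt := itv_partition_le hx.
have e2 : `|A s x| `^ q - e / 2 < `|A s x| `^ q by lra.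
near=> r.
have sr : s < r by near: r; exact: nbhs_right_gt.
have rx : r < x by near: r; exact: nbhs_right_lt.
have hr : `|A s x| `^ q - e / 2 < `|A r x| `^ q.
  move: q0; near: r; apply: near_powR_gt e2; apply: cA; exact/andP.
have hp2 : itv_partition r t (x :: pi).
  by case: hx => ? ?; split => //=; rewrite rx.
have h1 := qsup_superadd q A (ltW sr) (le_trans (ltW rx) xt).
have f1 : qsup q A s r \is a fin_num.
  apply: qsup_fin; first exact: ltW.
  apply: le_lt_trans foo; apply: qsup_mono => //; first exact: ltW.
have h2 : (qsup q A s r + (varsum q A r (x :: pi))%:E <= S%:E)%E.
  rewrite -SE; apply: le_trans h1; rewrite leeD2l //; exact: qsup_ge.
move: h2 hS; rewrite -(fineK f1) -EFinD !lee_fin /varsum !sum_subintervals_cons /=.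
lra.
Unshelve. all: by end_near. Qed.

(** The q-th powers of the bounds are multiples of the control, hence superadditive. *)
Lemma pvar2_le q A s t w a : 0 < q -> 0 <= a -> s <= t -> control s t w -> w s t <= 1 ->
  (forall u v, s <= u -> u <= v -> v <= t -> `|A u v| <= a * w u v `^ q^-1) ->
  (pvar2 q A s t <= a%:E)%E.
Proof.
move=> q0 a0 st cw w1 hA; rewrite pvar2E.
suff h : (qsup q A s t <= (a `^ q)%:E)%E.
  have := @gt0_ler_poweR R q^-1 _ (qsup q A s t) ((a `^ q)%:E).
  rewrite poweR_EFin -powRrM divff ?gt_eqF // powRr1 //; apply => //.
  - by rewrite invr_ge0 ltW.
  - by rewrite in_itv /= qsup_ge0 //= leey.
  - by rewrite in_itv /= lee_fin powR_ge0 leey.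
apply/ereal_supP => _ [pi hpi <-]; rewrite lee_fin.
apply: (@le_trans _ _ (\sum_(I <- subintervals s pi) a `^ q * w I.1 I.2)).
  rewrite /varsum !big_seq; apply: ler_sum => I /(subintervals_mem hpi)[h1 h2 h3].
  have w0 : 0 <= w I.1 I.2 by apply: (control_ge0 cw) => //; apply: ltW.
  have := hA _ _ h1 (ltW h2) h3 => /(ge0_ler_powR (ltW q0)).
  rewrite powRM ?powR_ge0 // -powRrM mulVf ?gt_eqF // powRr1 //.
  apply => //; rewrite nnegrE //; exact: mulr_ge0 (powR_ge0 _ _).
rewrite -mulr_sumr -[leRHS]mulr1 ler_wpM2l ?powR_ge0 //.
exact: le_trans (sum_control cw hpi) w1.
Qed.

Lemma qsup_norm q A s t u v : 0 < q -> (qsup q A s t < +oo)%E ->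
  s <= u -> u < v -> v <= t ->
  `|A u v| <= fine (qsup q A u v) `^ q^-1.
Proof.
move=> q0 foo su uv vt.
have f : qsup q A u v \is a fin_num.
  apply: qsup_fin; first exact: ltW.
  apply: le_lt_trans foo; apply: qsup_mono => //; exact: ltW.
have := qsup_ge1 q A uv; rewrite -(fineK f) lee_fin.
move=> /(@ge0_ler_powR _ q^-1); rewrite -powRrM divff ?gt_eqF // powRr1 //.
apply => //; first by rewrite invr_ge0 ltW.
- by rewrite nnegrE powR_ge0.
- by rewrite nnegrE fine_ge0 // qsup_ge0 // ltW.
Qed.

Lemma pvar2_qsup q A s t a : 0 < q -> 0 <= a -> s <= t ->
  (pvar2 q A s t <= a%:E)%E -> (qsup q A s t <= (a `^ q)%:E)%E.
Proof.
move=> q0 a0 st; rewrite pvar2E => h.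
have := @gt0_ler_poweR R q (ltW q0) _ _ _ _ h.
rewrite -poweRrM mulVf ?gt_eqF // poweRe1 ?qsup_ge0 // poweR_EFin; apply.
- by rewrite in_itv /= poweR_ge0 leey.
- by rewrite in_itv /= lee_fin a0 leey.
Qed.

(** The control is the q-th power of the variation, normalised. Partitions do not
    see the diagonal, where A has to vanish for the bound to hold. *)
Lemma pvar2_control q A s t a : 0 < q -> 0 <= a ->
  (forall u, s <= u <= t -> A u u = 0) ->
  (pvar2 q A s t <= a%:E)%E ->
  exists w, [/\ control s t w, w s t <= 1 &
    forall u v, s <= u -> u <= v -> v <= t -> `|A u v| <= a * w u v `^ q^-1].
Proof.
move=> q0 a0 Adiag h.
have [st|ts] := leP s t; last first.
  exists (fun _ _ => 0); split; [exact: control0|by []|].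
  move=> u v su uv vt; have := le_trans su (le_trans uv vt).
  by rewrite leNgt ts.
have hq := pvar2_qsup q0 a0 st h.
have foo : (qsup q A s t < +oo)%E by apply: le_lt_trans hq (ltey _).
have f := qsup_fin st foo.
have cw := qsup_control foo.
have [a00|an0] := eqVneq a 0.
  exists (fun _ _ => 0); split; [exact: control0|by []|].
  move=> u v su uv vt; rewrite a00 mul0r.
  have ut := le_trans uv vt; move: uv; rewrite le_eqVlt => /orP[/eqP<-|uv].
    by rewrite Adiag ?normr0 // su ut.
  have := qsup_norm q0 foo su uv vt.
  suff -> : fine (qsup q A u v) = 0 by rewrite powR0 // invr_eq0 gt_eqF.
  apply/eqP; rewrite eq_le; apply/andP; split; last first.
    by apply: (control_ge0 cw) => //; apply: ltW.
  apply: le_trans (control_mono cw (lexx s) su (ltW uv) vt (lexx _)) _.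
  by rewrite -lee_fin fineK // (le_trans hq) // a00 powR0 // gt_eqF.
have ap : 0 < a by rewrite lt_neqAle eq_sym an0.
have aq : 0 < a `^ q by rewrite powR_gt0.
exists (fun u v => (a `^ q)^-1 * fine (qsup q A u v)); split.
- by apply: controlZ => //; rewrite invr_ge0 ltW.
- by rewrite mulrC ler_pdivrMr // mul1r -lee_fin fineK.
move=> u v su uv vt.
have q0' : 0 <= fine (qsup q A u v) by exact: (control_ge0 cw).
rewrite powRM ?invr_ge0 ?powR_ge0 // -[_^-1]powR_inv1 ?powR_ge0 //.
rewrite -!powRrM mulN1r mulrN divff ?gt_eqF // powR_inv1 // mulrA divff // mul1r.
have ut := le_trans uv vt; move: uv; rewrite le_eqVlt => /orP[/eqP<-|uv].
  by rewrite Adiag ?normr0 ?powR_ge0 // su ut.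
exact: (qsup_norm q0 foo).
Qed.

End Variation.

(** * Sewing *)

Section Sewing.
Context {R : realType} {E : normedModType R}.
Implicit Types (s t u v r : R) (w : R -> R -> R) (Xi : R -> R -> E) (pi : seq R).

Definition gsum Xi s pi : E := \sum_(I <- subintervals s pi) Xi I.1 I.2.

Lemma gsum_cat Xi s pi1 pi2 :
  gsum Xi s (pi1 ++ pi2) = gsum Xi s pi1 + gsum Xi (last s pi1) pi2.
Proof. by rewrite /gsum subintervals_cat big_cat. Qed.

Lemma control_diag s t w u : control s t w -> s <= u -> u <= t -> w u u = 0.
Proof.
move=> [w0 wD] su ut; have := w0 u u su (lexx u) ut.
by have := wD u u u su (lexx u) (lexx u) ut; lra.
Qed.

(** Follow the partition as long as w s . is at most half of its total mass: by
    superadditivity at most half of the mass is left after the next interval. *)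
Lemma split_half s t w pi : control s t w -> itv_partition s t pi ->
  pi != [::] -> exists pi1 x pi2, [/\ pi = pi1 ++ x :: pi2,
    w s (last s pi1) <= w s t / 2 & w x t <= w s t / 2].
Proof.
move=> cw hpi pi0.
have st := itv_partition_le hpi.
have W0 : 0 <= w s t by exact: (control_ge0 cw).
suff H : forall pi2 pi1, pi = pi1 ++ pi2 -> pi2 != [::] ->
    w s (last s pi1) <= w s t / 2 ->
    exists pi1 x pi2, [/\ pi = pi1 ++ x :: pi2,
    w s (last s pi1) <= w s t / 2 & w x t <= w s t / 2].
  apply: (H pi [::]) => //=; rewrite (control_diag cw) //; lra.
elim=> // y pi2 IH pi1 e _ h1.
have hy : s <= y /\ y <= t.
  have hI : (last s pi1, y) \in subintervals s pi.
    by rewrite e subintervals_cat mem_cat [subintervals _ (_ :: _)]/= inE eqxx orbT.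
  have [/= h2 h3 h4] := subintervals_mem hpi hI.
  by split => //; exact: le_trans h2 (ltW h3).
case: hy => sy yt.
have [hle|hlt] := leP (w s y) (w s t / 2); last first.
  exists pi1, y, pi2; split => //.
  by case: cw => _ /(_ s y t (lexx _) sy yt (lexx _)); lra.
case: pi2 e IH => [|z pi2] e IH.
  exists pi1, y, [::]; split => //.
  have -> : y = t by case: hpi => _ /eqP <-; rewrite e last_cat.
  by rewrite (control_diag cw) //; lra.
apply: (IH (rcons pi1 y)) => //; first by rewrite cat_rcons.
by rewrite last_rcons.
Qed.

(** The solution K of K = 2 + 2 * 2^-th * K, the recursion in the next proof. *)
Definition sewing_const (th : R) : R := 2 / (1 - 2 * 2^-1 `^ th).

Lemma half_powR_lt (th : R) : 1 < th -> 2 * 2^-1 `^ th < 1 :> R.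
Proof.
move=> th1; have h0 : 0 <= 2^-1 :> R by lra.
rewrite -(@mulr_powRB1 _ 2^-1 th) //; last by lra.
rewrite mulrA divff // mul1r.
have := @gt0_ltr_powR R (th - 1) _ 2^-1 1; rewrite powR1; apply; rewrite ?nnegrE //; lra.
Qed.

Lemma sewing_const_ge1 (th : R) : 1 < th -> 1 <= sewing_const th.
Proof.
move=> th1; have h := half_powR_lt th1.
have k0 : 0 <= 2^-1 `^ th :> R by exact: powR_ge0.
by rewrite /sewing_const ler_pdivlMr; lra.
Qed.

(** Cutting a partition as above leaves two partitions, on each of which the control
    is halved, and two defects of additivity; as th > 1, the powers of one half that
    accumulate in the induction on the number of points are summable. *)
Lemma sewing_sum s t w Xi pi (th rho : R) : 1 < th -> 0 <= rho ->
  control s t w ->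
  (forall u r v, s <= u -> u <= r -> r <= v -> v <= t ->
     `|Xi u v - Xi u r - Xi r v| <= rho * w u v `^ th) ->
  itv_partition s t pi ->
  `|gsum Xi s pi - Xi s t| <= sewing_const th * rho * w s t `^ th.
Proof.
move=> th1 rho0; have [n] := ubnP (size pi).
elim: n pi s t => // n IH pi s t /ltnSE hn cw hXi hpi.
have K1 := sewing_const_ge1 th1; set K := sewing_const th in K1 *.
have st := itv_partition_le hpi.
have p0 : 0 <= w s t `^ th by exact: powR_ge0.
have [e|pi0] := eqVneq pi [::].
  subst pi; have e := itv_partition_nil hpi; subst t.
  rewrite /gsum big_nil sub0r normrN.
  have := hXi s s s (lexx _) (lexx _) (lexx _) (lexx _).
  rewrite subrr sub0r normrN => h; apply: le_trans h _.
  by rewrite -mulrA ler_peMl // mulr_ge0.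
have [pi1 [x [pi2 [e h1 h2]]]] := split_half cw hpi pi0.
have hI : (last s pi1, x) \in subintervals s pi.
  by rewrite e subintervals_cat mem_cat [subintervals _ (_ :: _)]/= inE eqxx orbT.
have [/= sa ax xt] := subintervals_mem hpi hI.
have := hpi; rewrite e /itv_partition cat_path last_cat => -[/andP[q1 /= /andP[_ q2]] q3].
have hpi1 : itv_partition s (last s pi1) pi1 by split.
have hpi2 : itv_partition x t pi2 by split.
rewrite gsum_cat /gsum sum_subintervals_cons -/(gsum _ _ _) -/(gsum _ _ _) /=.
set a := last s pi1 in sa ax hpi1 h1 *.
have sz : (size pi1 < n)%N /\ (size pi2 < n)%N.
  move: hn; rewrite e size_cat /= addnS => hn.
  by split; apply: leq_trans hn; rewrite ltnS ?leq_addr ?leq_addl.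
have [a_t s_x] : a <= t /\ s <= x by split; [exact: le_trans (ltW ax) xt|exact: le_trans sa (ltW ax)].
have half z : 0 <= z -> z <= w s t / 2 -> z `^ th <= 2^-1 `^ th * w s t `^ th.
  move=> z0 hz; have W0 : 0 <= w s t by exact: (control_ge0 cw).
  rewrite -powRM ?invr_ge0 // mulrC; apply: ge0_ler_powR => //; rewrite ?nnegrE //.
    by lra.
  by rewrite mulr_ge0 // invr_ge0.
have b1 : `|gsum Xi s pi1 - Xi s a| <= K * rho * (2^-1 `^ th * w s t `^ th).
  apply: le_trans (IH pi1 s a sz.1 _ _ hpi1) _.
  - exact: control_sub cw.
  - by move=> u r v su ur rv va; apply: hXi => //; exact: le_trans a_t.
  apply: ler_wpM2l; first by rewrite mulr_ge0 // (le_trans _ K1).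
  by apply: half => //; exact: (control_ge0 cw).
have b2 : `|gsum Xi x pi2 - Xi x t| <= K * rho * (2^-1 `^ th * w s t `^ th).
  apply: le_trans (IH pi2 x t sz.2 _ _ hpi2) _.
  - exact: control_sub cw.
  - by move=> u r v su ur rv va; apply: hXi => //; exact: le_trans su.
  apply: ler_wpM2l; first by rewrite mulr_ge0 // (le_trans _ K1).
  by apply: half => //; exact: (control_ge0 cw).
have b3 := hXi s a t (lexx _) sa a_t (lexx _).
have b4 : `|Xi a t - Xi a x - Xi x t| <= rho * w s t `^ th.
  apply: le_trans (hXi a x t sa (ltW ax) xt (lexx _)) _.
  apply: ler_wpM2l => //; apply: ge0_ler_powR; rewrite ?nnegrE.
  - by lra.
  - exact: (control_ge0 cw).
  - exact: (control_ge0 cw).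
  - exact: (control_mono cw).
have -> : gsum Xi s pi1 + (Xi a x + gsum Xi x pi2) - Xi s t =
    (gsum Xi s pi1 - Xi s a) + (gsum Xi x pi2 - Xi x t)
    - (Xi s t - Xi s a - Xi a t) - (Xi a t - Xi a x - Xi x t).
  zmod.
have KE : K = 2 + 2 * 2^-1 `^ th * K.
  have := half_powR_lt th1; rewrite /K /sewing_const.
  move: (2^-1 `^ th) => k hk; field; lra.
apply: (le_trans (ler_normB _ _)); apply: le_trans (lerD (ler_normB _ _) b4) _.
apply: le_trans (lerD (lerD (ler_normD _ _) b3) (lexx _)) _.
apply: le_trans (lerD (lerD (lerD b1 b2) (lexx _)) (lexx _)) _.
set k := 2^-1 `^ th; set W := w s t `^ th.
rewrite [leRHS](_ : _ = (2 + 2 * k * K) * rho * W); last by rewrite -KE.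
rewrite le_eqVlt; apply/orP; left; apply/eqP; ring.
Qed.

Lemma mesh_cons s x pi : mesh s (x :: pi) = Num.max (x - s) (mesh x pi).
Proof. by rewrite /mesh [subintervals _ _]/= big_cons. Qed.

Lemma mesh_cat s pi1 pi2 :
  mesh s (pi1 ++ pi2) = Num.max (mesh s pi1) (mesh (last s pi1) pi2).
Proof.
elim: pi1 s => [|x pi1 IH] s /=; last by rewrite !mesh_cons IH maxA.
rewrite /mesh [in RHS]big_nil; apply/esym/max_idPr.
exact: bigmax_ge_id.
Qed.

Lemma mesh_ex s t (e : R) : s <= t -> 0 < e ->
  exists pi, itv_partition s t pi /\ mesh s pi < e.
Proof.
move=> st e0; have e20 : 0 < e / 2 by lra.
have [n hn] : exists n : nat, t - s <= n%:R * (e / 2).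
  exists (Num.bound ((t - s) / (e / 2))).
  rewrite -ler_pdivrMr //; apply: ltW; apply: archi_boundP.
  by rewrite divr_ge0 ?subr_ge0 // ltW.
elim: n s st hn => [|n IH] s st.
  rewrite mul0r => h; have -> : s = t by lra.
  by exists [::]; rewrite /mesh big_nil; split => //; split => /=.
move=> hn; have [h|h] := leP t (s + e / 2).
  move: st; rewrite le_eqVlt => /orP[/eqP->|st].
    by exists [::]; rewrite /mesh big_nil; split => //; split => /=.
  exists [:: t]; split; first exact: itv_partition1.
  by rewrite mesh_cons /mesh big_nil gt_max e0 andbT; lra.
have [|pi [[p1 p2] p3]] := IH (s + e / 2) (ltW h).
  by move: hn; rewrite -natr1; lra.
exists ((s + e / 2) :: pi); split; first by split => //=; rewrite p1 andbT; lra.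
by rewrite mesh_cons gt_max p3 andbT; lra.
Qed.

Global Instance mesh_to0_filter s t : Filter (mesh_to0 s t).
Proof.
apply: filter_from_filter; first by exists 1 => /=.
move=> e1 e2 /= e10 e20; exists (Num.min e1 e2); first by rewrite /= lt_min e10.
by move=> pi [h]; rewrite lt_min => /andP[h1 h2]; split; split.
Qed.

(** The increment over [s, t] of a function of t given by limits of sums over
    [0, t] is itself a limit of sums over [s, t], hence inherits their bounds. *)
Lemma limit_increment s t Xi (v1 v2 : E) (B : R) : 0 <= s -> s <= t ->
  gsum Xi 0 pi @[pi --> mesh_to0 0 s] --> v1 ->
  gsum Xi 0 pi @[pi --> mesh_to0 0 t] --> v2 ->
  (forall pi, itv_partition s t pi -> `|gsum Xi s pi - Xi s t| <= B) ->
  `|v2 - v1 - Xi s t| <= B.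
Proof.
move=> s0 st /cvgrPdist_lt c1 /cvgrPdist_lt c2 hB.
apply/ler_addgt0Pr => e e0; have e20 : 0 < e / 2 by lra.
have [e1 /= e10 h1] := c1 _ e20; have [e2 /= e2_0 h2] := c2 _ e20.
have m0 : 0 < Num.min e1 e2 by rewrite lt_min e10.
have [pi1 [p1 m1]] := mesh_ex s0 m0; have [pi2 [p2 m2]] := mesh_ex st m0.
move: m1 m2; rewrite !lt_min => /andP[m11 m12] /andP[m21 m22].
have b1 : `|v1 - gsum Xi 0 pi1| < e / 2 by apply: h1; split.
have l1 : last 0 pi1 = s by case: p1 => _ /eqP.
have b2 : `|v2 - gsum Xi 0 (pi1 ++ pi2)| < e / 2.
  apply: h2; split; first exact: itv_partition_cat p1 p2.
  by rewrite mesh_cat gt_max m12 l1.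
have b3 := hB _ p2.
have -> : v2 - v1 - Xi s t = (v2 - gsum Xi 0 (pi1 ++ pi2)) -
    (v1 - gsum Xi 0 pi1) + (gsum Xi s pi2 - Xi s t).
  by rewrite gsum_cat l1; zmod.
apply: le_trans (ler_normD _ _) _; rewrite addrC; apply: lerD => //.
apply: le_trans (ler_normB _ _) _; lra.
Qed.

End Sewing.

(** * Mean value estimates *)

Section MeanValue.
Context {R : realType} {W : normedModType R}.
Implicit Types (phi dphi : R -> W) (x y : R).

(** Differentiability on [0, 1], one-sided at the end points. *)
Definition deriv01 phi dphi := forall x, 0 <= x <= 1 -> forall e, 0 < e ->
  exists2 del, 0 < del & forall y, 0 <= y <= 1 -> `|y - x| < del ->
    `|phi y - phi x - (y - x) *: dphi x| <= e * `|y - x|.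

Lemma deriv01B phi1 dphi1 phi2 dphi2 : deriv01 phi1 dphi1 -> deriv01 phi2 dphi2 ->
  deriv01 (fun x => phi1 x - phi2 x) (fun x => dphi1 x - dphi2 x).
Proof.
move=> h1 h2 x x01 e e0; have e2 : 0 < e / 2 by lra.
have [d1 d10 k1] := h1 x x01 _ e2; have [d2 d20 k2] := h2 x x01 _ e2.
exists (Num.min d1 d2); first by rewrite lt_min d10.
move=> y y01; rewrite lt_min => /andP[l1 l2].
have -> : phi1 y - phi2 y - (phi1 x - phi2 x) - (y - x) *: (dphi1 x - dphi2 x) =
  (phi1 y - phi1 x - (y - x) *: dphi1 x) - (phi2 y - phi2 x - (y - x) *: dphi2 x).
  by rewrite scalerBr; zmod.
apply: le_trans (ler_normB _ _) _.
have := k1 y y01 l1; have := k2 y y01 l2; lra.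
Qed.

Lemma deriv01_lin (c : W) : deriv01 (fun x => x *: c) (fun=> c).
Proof.
move=> x x01 e e0; exists 1 => // y _ _.
by rewrite scalerBl subrr normr0 mulr_ge0 // ltW.
Qed.

(** The mean value inequality: for every e > 0 the points up to which the increments
    have slope at most M + e form an interval, which is closed by continuity at its
    supremum and open to the right by differentiability. *)
Lemma mean_value phi dphi (M : R) : deriv01 phi dphi ->
  (forall x, 0 <= x <= 1 -> `|dphi x| <= M) -> `|phi 1 - phi 0| <= M.
Proof.
move=> hd hM; apply/ler_addgt0Pr => e e0.
have M0 : 0 <= M by apply: le_trans (hM 0 _) => //; rewrite lexx ler01.
pose good x := `|phi x - phi 0| <= (M + e) * x.
pose B := [set x : R | 0 <= x <= 1 /\ forall y, 0 <= y <= x -> good y].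
have B0 : B 0.
  split; first by rewrite lexx ler01.
  move=> y /andP[y0 y1]; have -> : y = 0 by lra.
  by rewrite /good subrr normr0 mulr0.
have Bub : has_ubound B by exists 1 => x [/andP[]].
have hs : has_sup B by split => //; exists 0.
set s := sup B.
have s0 : 0 <= s by exact: ub_le_sup.
have s1 : s <= 1 by apply: sup_le_ub; [exists 0|move=> x [/andP[]]].
have s01 : 0 <= s <= 1 by rewrite s0.
have [del del0 hdel] := hd s s01 e e0.
have lip y : 0 <= y <= 1 -> `|y - s| < del -> `|phi y - phi s| <= (M + e) * `|y - s|.
  move=> y01 hy; have := hdel y y01 hy => h.
  have -> : phi y - phi s = (phi y - phi s - (y - s) *: dphi s) + (y - s) *: dphi s by zmod.
  apply: le_trans (ler_normD _ _) _; rewrite mulrDl addrC lerD // normrZ mulrC.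
  by rewrite ler_wpM2r // hM.
have [x xB xs] : exists2 x, B x & s - del < x by apply: sup_adherent.
have xs' : x <= s by exact: ub_le_sup.
have goods : good s.
  rewrite /good; case: xB => x01 /(_ x); rewrite lexx andbT /good.
  case/andP: (x01) => x0 x1 => /(_ x0) h.
  have := lip x x01; rewrite (ler0_norm (_ : x - s <= 0)); last by lra.
  move=> /(_ _) h2.
  have -> : phi s - phi 0 = (phi x - phi 0) - (phi x - phi s) by zmod.
  apply: le_trans (ler_normB _ _) _.
  have h3 := h2 ltac:(lra).
  have -> : (M + e) * s = (M + e) * x + (M + e) * - (x - s) by ring.
  exact: lerD.
have goodr y : s <= y -> y <= 1 -> y < s + del -> good y.
  move=> sy y1 ysd; have := lip y; rewrite ger0_norm; last by lra.
  have y01 : 0 <= y <= 1 by lra.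
  move=> /(_ y01 ltac:(lra)) h; rewrite /good.
  have -> : phi y - phi 0 = (phi y - phi s) + (phi s - phi 0) by zmod.
  apply: le_trans (ler_normD _ _) _.
  have -> : (M + e) * y = (M + e) * (y - s) + (M + e) * s by ring.
  exact: lerD.
have goodl y : 0 <= y -> y < s -> good y.
  move=> y0 ys; have [z zB yz] : exists2 z, B z & s - (s - y) < z.
    by apply: sup_adherent => //; lra.
  by case: zB => _; apply; rewrite y0 /=; lra.
have [s_1|s_1] := ltP s 1; last first.
  have e1 : s = 1 by lra.
  by move: goods; rewrite /good e1 mulr1.
pose z := Num.min 1 (s + del / 2).
have zs : s < z by rewrite /z lt_min s_1 /=; lra.
have : z <= s.
  apply: ub_le_sup => //; split.
    by rewrite (le_trans s0 (ltW zs)) /= /z ge_min lexx.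
  move=> y /andP[y0]; rewrite /z le_min => /andP[y1 y2].
  have [ys|ys] := ltP y s; first exact: goodl.
  by apply: goodr => //; lra.
by rewrite leNgt zs.
Qed.

End MeanValue.

Section Calculus.
Context {R : realType} {V W : normedModType R} (D : set V).

(** A finite basis of V whose coordinate functions have norm at most one. *)
Context (I : finType) (e : I -> V) (c : I -> V -> R).
Hypothesis basisE : forall v, v = \sum_i c i v *: e i.
Hypothesis coord_le : forall i v, `|c i v| <= `|v|.
Hypothesis convD : forall a b x, D a -> D b -> 0 <= x <= 1 -> D (a + x *: (b - a)).

Implicit Types (g : V -> W) (Dg : V -> {linear V -> W}) (M : R).

Definition deriv_in g Dg := forall z, D z -> forall eps, 0 < eps ->
  exists2 del, 0 < del & forall z', D z' -> `|z' - z| < del ->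
    `|g z' - g z - Dg z (z' - z)| <= eps * `|z' - z|.

Lemma Cb_deriv_in g Dg :
  (forall z, D z -> `|z' - z|^-1 *: (g z' - g z - Dg z (z' - z))
     @[z' --> within D (nbhs z)] --> (0 : W)) -> deriv_in g Dg.
Proof.
move=> h z Dz eps eps0; have /cvgrPdist_lt /(_ _ eps0) := h z Dz.
rewrite near_withinE => /nbhs_normP[del /= del0 hdel].
exists del => // z' Dz' hz.
have [->|zz] := eqVneq z' z; first by rewrite !subrr linear0 subr0 !normr0 mulr0.
have := hdel z'; rewrite /= distrC => /(_ hz Dz') /ltW.
have n0 : 0 < `|z' - z| by rewrite normr_gt0 subr_eq0.
rewrite sub0r normrN normrZ ger0_norm ?invr_ge0 //.
by rewrite ler_pdivrMl // mulrC.
Qed.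

Lemma fin_bound (P : I -> R -> Prop) :
  (forall i, exists M, P i M) ->
  (forall i M M', P i M -> M <= M' -> P i M') ->
  exists2 M, 1 <= M & forall i, P i M.
Proof.
move=> /choice[M hM] mono; exists (1 + \sum_i `|M i|).
  by rewrite lerDl sumr_ge0.
move=> i; apply: mono (hM i) _.
apply: le_trans (ler_norm _) _; rewrite (bigD1 i) //= addrCA lerDl addr_ge0 //.
exact: sumr_ge0.
Qed.

Lemma linear_bound (L : {linear V -> W}) M v : 0 <= M ->
  (forall i, `|L (e i)| <= M) -> `|L v| <= #|I|%:R * M * `|v|.
Proof.
move=> M0 hM; rewrite {1}(basisE v) linear_sum.
apply: le_trans (ler_norm_sum _ _ _) _.
apply: le_trans (ler_sum _ (G := fun=> M * `|v|) _) _ => [i _|].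
  by rewrite linearZ normrZ mulrC ler_pM.
by rewrite sumr_const -[leLHS]mulr_natl mulrA.
Qed.

Lemma linear_bound_comb (L1 L2 L3 L4 : {linear V -> W}) M v : 0 <= M ->
  (forall i, `|L1 (e i) - L2 (e i) - (L3 (e i) - L4 (e i))| <= M) ->
  `|L1 v - L2 v - (L3 v - L4 v)| <= #|I|%:R * M * `|v|.
Proof.
move=> M0 hM.
have LE (L : {linear V -> W}) : L v = \sum_i c i v *: L (e i).
  by rewrite [in LHS](basisE v) linear_sum; apply: eq_bigr => i _; rewrite linearZ.
rewrite !LE -!sumrB.
apply: le_trans (ler_norm_sum _ _ _) _.
apply: le_trans (ler_sum _ (G := fun=> M * `|v|) _) _ => [i _|].
  by rewrite -!scalerBr normrZ mulrC ler_pM.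
by rewrite sumr_const -[leLHS]mulr_natl mulrA.
Qed.

Lemma deriv01_seg g Dg a k : deriv_in g Dg ->
  (forall x, 0 <= x <= 1 -> D (a + x *: k)) ->
  deriv01 (fun x => g (a + x *: k)) (fun x => Dg (a + x *: k) k).
Proof.
move=> hg hD x x01 eps eps0; have k0 : 0 < `|k| + 1 by rewrite ltr_wpDl.
have [del del0 hdel] := hg _ (hD x x01) _ (divr_gt0 eps0 k0).
exists (del / (`|k| + 1)); first exact: divr_gt0.
move=> y y01 hy; have E : a + y *: k - (a + x *: k) = (y - x) *: k.
  by rewrite scalerBl; zmod.
have nE : `|(y - x) *: k| <= `|y - x| * (`|k| + 1).
  by rewrite normrZ ler_wpM2l // lerDl.
have := hdel _ (hD y y01); rewrite E linearZ => /(_ _) h.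
apply: le_trans (h _) _.
  by apply: le_lt_trans nE _; rewrite -ltr_pdivlMr.
rewrite -mulrA ler_wpM2l ?(ltW eps0) // mulrC ler_pdivrMr //.
Qed.

Lemma seg_in a b : D a -> D b -> forall x, 0 <= x <= 1 -> D (a + x *: (b - a)).
Proof. by move=> Da Db x x01; exact: convD. Qed.

Definition bounded_on M g := forall z, D z -> `|g z| <= M.
Definition lip_on M g := forall z z', D z -> D z' -> `|g z - g z'| <= M * `|z - z'|.

(** Second-order Lipschitz continuity: the increments of g along two parallel
    steps differ by the product of the step and the distance of the base
    points. *)
Definition lip2_on M g := forall a a' b b', D a -> D a' -> D b -> D b' ->
  D (a + (b' - b)) ->
  `|g a' - g a - (g b' - g b)| <=
    M * (`|a' - a - (b' - b)| + `|a - b| * `|b' - b|).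

(** The derivative is bounded on the basis vectors, hence bounded; convexity of D
    then bounds the increments of g. *)
Lemma Cb_lip k g : Cb k.+1 D g ->
  exists2 M, 1 <= M & bounded_on M g /\ lip_on M g.
Proof.
move=> [_ [M0 hM0] [Dg [hd hCb]]].
have {}hd := Cb_deriv_in hd.
have [M1 M11 hM1] : exists2 M, 1 <= M & forall i z, D z -> `|Dg z (e i)| <= M.
  apply: fin_bound => [i|i M M' h MM z Dz]; last exact: le_trans (h z Dz) MM.
  by have := hCb (e i); case: (k) => [|k'] [_ [M hM]] _; exists M.
have M10 : 0 <= M1 by lra.
have hL a b : D a -> D b -> `|g a - g b| <= (#|I|%:R * M1) * `|a - b|.
  move=> Da Db.
  have := @mean_value _ _ _ _ (#|I|%:R * M1 * `|a - b|)
     (deriv01_seg hd (seg_in Db Da)).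
  rewrite scale1r scale0r addr0 subrKC; apply => x x01.
  by apply: linear_bound => // i; apply: hM1; exact: seg_in.
exists (1 + `|M0| + #|I|%:R * M1); first by rewrite -addrA lerDl addr_ge0 // mulr_ge0.
split=> [z Dz|a b Da Db].
  apply: le_trans (hM0 z Dz) _; apply: le_trans (ler_norm _) _.
  by rewrite -addrA addrCA lerDl addr_ge0 // mulr_ge0.
apply: le_trans (hL _ _ Da Db) _; rewrite ler_wpM2r // lerDr.
by rewrite addr_ge0.
Qed.

Definition dlip_on M Dg := forall z z' h, D z -> D z' ->
  `|Dg z h - Dg z' h| <= M * `|z - z'| * `|h|.

Lemma Cb_dlip k g : Cb k.+2 D g ->
  exists Dg : V -> {linear V -> W}, deriv_in g Dg /\
  (forall v, Cb k.+1 D (fun z => Dg z v)) /\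
  exists2 M, 1 <= M & [/\ bounded_on M g, lip_on M g,
     forall z h, D z -> `|Dg z h| <= M * `|h| & dlip_on M Dg].
Proof.
move=> hg; have [M0 M01 [hb hl]] := Cb_lip hg.
case: hg => [_ _ [Dg [hd hCb]]].
have {}hd := Cb_deriv_in hd.
exists Dg; split => //; split => //.
have [M1 M11 hM1] : exists2 M, 1 <= M & forall i,
    bounded_on M (fun z => Dg z (e i)) /\ lip_on M (fun z => Dg z (e i)).
  apply: fin_bound => [i|i M M' [h1 h2] MM].
    by have [M _ h] := Cb_lip (hCb (e i)); exists M.
  split=> [z Dz|z z' Dz Dz']; first exact: le_trans (h1 z Dz) MM.
  by apply: le_trans (h2 z z' Dz Dz') _; rewrite ler_wpM2r.
have M10 : 0 <= M1 by lra.
have nM : 0 <= #|I|%:R * M1 by rewrite mulr_ge0.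
exists (M0 + #|I|%:R * M1); first by rewrite (le_trans M01) // lerDl.
split.
- by move=> z Dz; apply: le_trans (hb z Dz) _; rewrite lerDl.
- by move=> z z' Dz Dz'; apply: le_trans (hl z z' Dz Dz') _; rewrite ler_wpM2r // lerDl.
- move=> z h Dz; apply: le_trans (linear_bound h M10 _) _.
    by move=> i; exact: (hM1 i).1.
  by rewrite ler_wpM2r // lerDr; lra.
move=> z z' h Dz Dz'.
have := @linear_bound_comb (Dg z) (Dg z') (Dg z) (Dg z) (M1 * `|z - z'|) h.
rewrite !subrr !subr0 => /(_ _ _) hh; apply: le_trans (hh _ _) _.
- by rewrite mulr_ge0.
- by move=> i; rewrite subrr subr0; exact: (hM1 i).2.
rewrite ler_wpM2r // mulrA ler_wpM2r // lerDr; lra.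
Qed.

(** With the fourth vertex a + (b' - b) of the parallelogram, the increments along the
    two parallel sides are compared by the mean value inequality for their
    difference. *)
Lemma dlip_lip2 M g Dg : 0 <= M -> deriv_in g Dg -> lip_on M g -> dlip_on M Dg ->
  lip2_on M g.
Proof.
move=> M0 hd hl hdl a a' b b' Da Da' Db Db' Dc.
set k := b' - b in Dc *; set c0 := a + k in Dc *.
have -> : g a' - g a - (g b' - g b) = (g a' - g c0) + (g c0 - g b' - (g a - g b)) by zmod.
apply: le_trans (ler_normD _ _) _; rewrite mulrDr; apply: lerD.
  by apply: le_trans (hl _ _ Da' Dc) _; rewrite /c0 opprD addrA.
have h1 x : 0 <= x <= 1 -> D (a + x *: k).
  by move=> x01; have := seg_in Da Dc x01; rewrite /c0 addrAC subrr add0r.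
have h2 x : 0 <= x <= 1 -> D (b + x *: k) by exact: seg_in.
have := @mean_value _ _ _ _ (M * (`|a - b| * `|k|))
  (deriv01B (deriv01_seg hd h1) (deriv01_seg hd h2)).
rewrite scale1r scale0r !addr0 -/c0 subrKC; apply => x x01.
apply: le_trans (hdl _ _ _ (h1 x x01) (h2 x x01)) _.
by rewrite opprD addrACA subrr addr0 mulrA.
Qed.

Definition dlip2_on M Dg := forall a a' b b' h, D a -> D a' -> D b -> D b' ->
  D (a + (b' - b)) ->
  `|Dg a' h - Dg a h - (Dg b' h - Dg b h)| <=
    M * (`|a' - a - (b' - b)| + `|a - b| * `|b' - b|) * `|h|.

Definition taylor g Dg (a a' : V) : W := g a' - g a - Dg a (a' - a).

Lemma taylor_le M g Dg a a' : 0 <= M -> deriv_in g Dg -> dlip_on M Dg ->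
  D a -> D a' -> `|taylor g Dg a a'| <= M * `|a' - a| ^+ 2.
Proof.
move=> M0 hd hdl Da Da'; set k := a' - a.
have hs := seg_in Da Da'.
have := @mean_value _ _ _ _ (M * `|k| ^+ 2)
  (deriv01B (deriv01_seg hd hs) (deriv01_lin (Dg a k))).
rewrite !scale1r !scale0r addr0 subr0 subrKC.
rewrite /taylor -/k addrAC; apply => x x01.
apply: le_trans (hdl _ _ _ (hs x x01) Da) _.
rewrite addrAC subrr add0r expr2 mulrA ler_wpM2r // ler_wpM2l //.
by case/andP: x01 => x0 x1; rewrite normrZ ger0_norm // ler_piMl.
Qed.

(** The second-order Taylor remainder is Lipschitz in the base point and in the
    step, with the orders of magnitude of a quadratic function of the step. *)
Lemma taylor_lip M g Dg a a' b b' : 0 <= M -> deriv_in g Dg -> dlip_on M Dg ->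
  dlip2_on M Dg -> D a -> D a' -> D b -> D b' -> D (a + (b' - b)) ->
  `|taylor g Dg a a' - taylor g Dg b b'| <=
   M * (`|a - b| * `|b' - b| ^+ 2 +
        `|a' - a - (b' - b)| * (`|a' - a| + `|b' - b|)).
Proof.
move=> M0 hd hdl hd2 Da Da' Db Db' Dc.
set k := b' - b in Dc *; set h := a' - a; set c0 := a + k in Dc *.
have -> : taylor g Dg a a' - taylor g Dg b b' =
   (g c0 - g b' - (g a - g b) - (Dg a k - Dg b k))
   + (g a' - g c0 - Dg a (h - k)).
  have -> : Dg a (h - k) = Dg a h - Dg a k by exact: linearB.
  by rewrite /taylor -/h -/k; zmod.
apply: le_trans (ler_normD _ _) _; rewrite mulrDr; apply: lerD.
  have h1 x : 0 <= x <= 1 -> D (a + x *: k).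
    by move=> x01; have := seg_in Da Dc x01; rewrite /c0 addrAC subrr add0r.
  have h2 x : 0 <= x <= 1 -> D (b + x *: k) by exact: seg_in.
  have := @mean_value _ _ _ _ (M * (`|a - b| * `|k| ^+ 2))
   (deriv01B (deriv01B (deriv01_seg hd h1) (deriv01_seg hd h2))
   (deriv01_lin (Dg a k - Dg b k))).
  rewrite !scale1r !scale0r !addr0 subr0 -/c0 subrKC.
  rewrite [_ - _ - (g a - g b) - _]addrAC; apply => x x01.
  have -> : Dg (a + x *: k) k - Dg (b + x *: k) k - (Dg a k - Dg b k) =
    (Dg (a + x *: k) k - Dg a k) - (Dg (b + x *: k) k - Dg b k) by zmod.
  have Dbx : D (a + (b + x *: k - b)) by rewrite [b + _]addrC addrK; exact: h1.
  apply: le_trans (hd2 _ _ _ _ k Da (h1 x x01) Db (h2 x x01) Dbx) _.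
  have -> : a + x *: k - a - (b + x *: k - b) = 0 by zmod.
  rewrite normr0 add0r [b + _]addrC addrK -mulrA ler_wpM2l // -mulrA ler_wpM2l //.
  rewrite expr2 ler_wpM2r //.
  by case/andP: x01 => x0 x1; rewrite normrZ ger0_norm // ler_piMl.
have hs := seg_in Dc Da'.
have E : a' - c0 = h - k by rewrite /c0 /h; zmod.
have := @mean_value _ _ _ _ (M * (`|h - k| * (`|h| + `|k|)))
  (deriv01B (deriv01_seg hd hs) (deriv01_lin (Dg a (h - k)))).
rewrite !scale1r !scale0r addr0 subr0 subrKC E [g a' - _ - g c0]addrAC.
apply => x x01.
have := hs x x01; rewrite E => hx.
apply: le_trans (hdl _ _ _ hx Da) _.
rewrite -mulrA ler_wpM2l // mulrC ler_wpM2l //.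
have -> : c0 + x *: (h - k) - a = x *: h + (1 - x) *: k.
  by rewrite /c0 scalerBr scalerBl scale1r; zmod.
case/andP: x01 => x0 x1; apply: le_trans (ler_normD _ _) _; rewrite !normrZ.
rewrite !ger0_norm ?subr_ge0 //; apply: lerD; rewrite ler_piMl //; lra.
Qed.

(** The consequences of C^3_b regularity on which the estimates rely, with a single
    constant. *)
Record coef_bounds M g Dg : Prop := CoefBounds {
  coef_M : 1 <= M;
  coef_b : bounded_on M g;
  coef_l : lip_on M g;
  coef_l2 : lip2_on M g;
  coef_db : forall z h, D z -> `|Dg z h| <= M * `|h|;
  coef_dl : dlip_on M Dg;
  coef_dl2 : dlip2_on M Dg;
  coef_t : forall a a', D a -> D a' -> `|taylor g Dg a a'| <= M * `|a' - a| ^+ 2;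
  coef_tl : forall a a' b b', D a -> D a' -> D b -> D b' -> D (a + (b' - b)) ->
  `|taylor g Dg a a' - taylor g Dg b b'| <=
   M * (`|a - b| * `|b' - b| ^+ 2 +
        `|a' - a - (b' - b)| * (`|a' - a| + `|b' - b|)) }.

Lemma Cb3_coef_bounds g : Cb 3 D g ->
  exists M Dg, deriv_in g Dg /\ coef_bounds M g Dg.
Proof.
move=> /Cb_dlip[Dg [hd [hCb [M0 M01 [h1 h2 h3 h4]]]]].
have [M1 M11 hM1] : exists2 M, 1 <= M & forall i, lip2_on M (fun z => Dg z (e i)).
  apply: fin_bound => [i|i M M' h MM a a' b b' Da Da' Db Db' Dc].
    have [D2 [hd2 [_ [M M_1 [_ k2 _ k4]]]]] := Cb_dlip (hCb (e i)).
    exists M; apply: (dlip_lip2 _ hd2) => //; lra.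
  apply: le_trans (h _ _ _ _ Da Da' Db Db' Dc) _; rewrite ler_wpM2r // addr_ge0 // mulr_ge0.
have M10 : 0 <= M1 by lra.
have M00 : 0 <= M0 by lra.
have nM : 0 <= #|I|%:R * M1 by rewrite mulr_ge0.
set M := M0 + #|I|%:R * M1; have MM0 : M0 <= M by rewrite lerDl.
have M_0 : 0 <= M by lra.
have k2 : lip_on M g.
  by move=> z z' Dz Dz'; apply: le_trans (h2 z z' Dz Dz') _; rewrite ler_wpM2r.
have k4 : dlip_on M Dg.
  move=> z z' h Dz Dz'; apply: le_trans (h4 z z' h Dz Dz') _.
  by rewrite ler_wpM2r // ler_wpM2r.
have k5 : dlip2_on M Dg.
  move=> a a' b b' h Da Da' Db Db' Dc.
  set z := _ + _ * _.
  have z0 : 0 <= z by rewrite addr_ge0 // mulr_ge0.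
  apply: le_trans (@linear_bound_comb _ _ _ _ (M1 * z) h _ _) _.
  - by rewrite mulr_ge0.
  - by move=> i; exact: hM1.
  by rewrite ler_wpM2r // mulrA ler_wpM2r // lerDr.
exists M, Dg; split => //; split => //; first by lra.
- by move=> z Dz; apply: le_trans (h1 z Dz) _.
- exact: dlip_lip2 k4.
- by move=> z h Dz; apply: le_trans (h3 z h Dz) _; rewrite ler_wpM2r.
- by move=> a a'; exact: taylor_le.
- by move=> a a' b b'; exact: taylor_lip.
Qed.

End Calculus.

(** * Matrix norms and the space-time slab *)

Section MatrixNorm.
Context {R : realType}.

Lemma mx_norm_entry k l (A : 'M[R]_(k, l)) i j : `|A i j| <= `|A|.
Proof.
rewrite -[leRHS]/(mx_norm A) mx_normrE.
exact: (le_bigmax _ (fun ij : 'I_k * 'I_l => `|A ij.1 ij.2|) (i, j)).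
Qed.

Lemma mx_norm_le k l (A : 'M[R]_(k, l)) c : 0 <= c ->
  (forall i j, `|A i j| <= c) -> `|A| <= c.
Proof.
move=> c0 h; rewrite -[leLHS]/(mx_norm A) mx_normrE.
by apply: bigmax_le => // -[i j] _.
Qed.

Lemma mulmx_norm k l r (A : 'M[R]_(k, l)) (B : 'M[R]_(l, r)) :
  `|A *m B| <= l%:R * (`|A| * `|B|).
Proof.
apply: mx_norm_le => [|i j]; first by rewrite mulr_ge0 // mulr_ge0.
rewrite mxE; apply: le_trans (ler_norm_sum _ _ _) _.
apply: le_trans (ler_sum _ (G := fun=> `|A| * `|B|) _) _ => [q _|].
  by rewrite normrM ler_pM // mx_norm_entry.
by rewrite sumr_const card_ord -[leLHS]mulr_natl.
Qed.

Lemma col_norm k l (A : 'M[R]_(k, l)) j : `|col j A| <= `|A|.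
Proof. by apply: mx_norm_le => // i q; rewrite mxE mx_norm_entry. Qed.

Lemma row_norm k l (A : 'M[R]_(k, l)) j : `|row j A| <= `|A|.
Proof. by apply: mx_norm_le => // i q; rewrite mxE mx_norm_entry. Qed.

Lemma trmx_norm k l (A : 'M[R]_(k, l)) : `|A^T| <= `|A|.
Proof. by apply: mx_norm_le => // i q; rewrite mxE mx_norm_entry. Qed.

End MatrixNorm.

Section TimeSpace.
Context {R : realType} (n d : nat) (T : R).
Local Notation V := (R^o * 'cV[R]_n)%type.
Local Notation W := 'M[R]_(n, d).

Definition slab : set V := `[0, T] `*` setT.

Let e (i : unit + 'I_n) : V :=
  match i with inl _ => (1, 0) | inr i => (0, delta_mx i 0) end.
Let c (i : unit + 'I_n) (v : V) : R :=
  match i with inl _ => v.1 | inr i => v.2 i 0 end.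

Lemma pair_ext (a b : V) : a.1 = b.1 -> a.2 = b.2 -> a = b.
Proof. by case: a => ? ?; case: b => ? ? /= -> ->. Qed.

Lemma slab_basis v : v = \sum_i c i v *: e i.
Proof.
rewrite big_sumType /= (big_pred1 tt) => [|[]] //=.
case: v => t y /=.
apply: pair_ext => /=.
  rewrite (big_morph fst (id1 := 0) (op1 := +%R)) //= big1 => [|i _].
    by rewrite addr0 /GRing.scale /= mulr1.
  by rewrite scaler0.
rewrite scaler0 add0r (big_morph snd (id1 := 0) (op1 := +%R)) //=.
by rewrite [LHS]matrix_sum_delta; apply: eq_bigr => i _; rewrite big_ord1.
Qed.

Lemma pair_norm_le (t : R) (y : 'cV[R]_n) : `|((t, y) : V)| <= `|t| + `|y|.
Proof.
by rewrite prod_normE ge_max /= lerDl lerDr !normr_ge0.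
Qed.

Lemma pair0_norm (y : 'cV[R]_n) : `|((0, y) : V)| = `|y|.
Proof. by rewrite prod_normE /= normr0; apply/max_idPr. Qed.

Lemma slab_coord i v : `|c i v| <= `|v|.
Proof.
rewrite prod_normE le_max; case: i => [[]|i] /=; first by rewrite lexx.
by rewrite mx_norm_entry orbT.
Qed.

Lemma slab_convex a b x : slab a -> slab b -> 0 <= x <= 1 ->
  slab (a + x *: (b - a)).
Proof.
move=> [/= ha _] [/= hb _] /andP[x0 x1]; split => //=.
move: ha hb; rewrite !in_itv /= => /andP[a0 aT] /andP[b0 bT].
rewrite /GRing.scale /=; apply/andP; split; nra.
Qed.

(** The differential in space that enters the equation is a restriction of the
    derivative relative to the slab, whose bounds it inherits. *)
Lemma coef_time_space (sigma : R -> 'cV[R]_n -> W) :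
  Cb 3 slab (fun z : V => sigma z.1 z.2) ->
  exists M (Df : V -> {linear V -> W}),
    coef_bounds slab M (fun z : V => sigma z.1 z.2) Df /\
    forall s x h, 0 <= s <= T -> 'd (sigma s) x h = Df (s, x) (0, h).
Proof.
move=> hs.
have [M [Df [hd hb]]] := Cb3_coef_bounds slab_basis slab_coord slab_convex hs.
exists M, Df; split => // s x h sT.
have hl : linear (fun h : 'cV[R]_n => Df (s, x) ((0, h) : V)).
  move=> k a b; rewrite -linearP; congr (Df _ _).
  by apply: pair_ext => //=; rewrite scaler0 add0r.
pose L : {linear 'cV[R]_n -> W} := HB.pack (fun h : 'cV[R]_n => Df (s, x) ((0, h) : V))
   (GRing.isLinear.Build _ _ _ _ _ hl).
have sl y : slab ((s, y) : V) by split.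
suff -> : 'd (sigma s) x = L :> ('cV[R]_n -> W) by [].
apply: diff_unique.
  apply: bounded_linear_continuous.
  rewrite /bounded_near; near=> N.
  suff : \forall y \near (0 : 'cV[R]_n), `|L y| <= N by [].
  apply/nbhs_normP; exists 1; first exact: ltr01.
  move=> y; rewrite /= sub0r normrN => y1.
  apply: le_trans (coef_db hb _ (sl x)) _; rewrite pair0_norm.
  have M0 : 0 <= M by apply: le_trans (coef_M hb).
  apply: (@le_trans _ _ M); first by rewrite ler_piMr // ltW.
  by near: N; apply: nbhs_pinfty_ge; rewrite num_real.
apply/eqaddoP => eps eps0.
have [del del0 hdel] := hd _ (sl x) _ eps0.
suff : \forall y \near (0 : 'cV[R]_n),
  `|(sigma s \o shift x - (cst (sigma s x) + L)) y| <= eps * `|id y| by [].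
apply/nbhs_normP; exists del => // y; rewrite /= sub0r normrN => hy.
have := hdel _ (sl (y + x)).
have E : (((s, y + x) : V) - ((s, x) : V)) = ((0, y) : V).
  by apply: pair_ext => /=; rewrite ?subrr // addrK.
rewrite E pair0_norm => /(_ hy) /=.
by rewrite !fctE /= opprD addrA.
Unshelve. all: by end_near. Qed.

End TimeSpace.

(** * Measurability and integrals of the drift *)

Section DenseSequence.
Context {R : realType} (Z : Type) (I : finType) (c : I -> Z -> R) (A : set Z).

(** Every set is separable for finitely many real coordinates: pick a point, if
    there is one, near each rational vector. *)
Lemma dense_sequence z0 : A z0 -> exists q : nat -> Z, (forall k, A (q k)) /\
  forall z e, A z -> 0 < e -> exists k, forall i, `|c i z - c i (q k)| <= e.
Proof.
move=> Az0.
pose P (x : {ffun I -> rat} * nat) z :=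
  A z /\ forall i, `|c i z - ratr (x.1 i)| <= x.2.+1%:R^-1.
pose q n := if unpickle n is Some x then
  if pselect (exists z, P x z) is left h then sval (cid h) else z0 else z0.
exists q; split.
  move=> k; rewrite /q; case: unpickle => // x.
  by case: pselect => // h; case: (svalP (cid h)).
move=> z e Az e0.
have [k hk] : exists k : nat, k.+1%:R^-1 <= e / 2.
  have e2 : 0 < e / 2 by lra.
  exists (Num.bound (e / 2)^-1); rewrite -[leRHS]invrK lef_pV2 ?posrE //; last first.
    by rewrite invr_gt0.
  apply: le_trans (ltW (archi_boundP _)) _; first by rewrite invr_ge0 ltW.
  by rewrite ler_nat.
have k0 : 0 < k.+1%:R^-1 :> R by rewrite invr_gt0.
have hf i : exists r : rat, `|c i z - ratr r| <= k.+1%:R^-1.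
  have [r] : exists r : rat, ratr r \in `]c i z, c i z + k.+1%:R^-1[.
    by apply: rat_in_itvoo; rewrite ltrDl.
  rewrite in_itv /= => hr; exists r; rewrite ler_norml.
  by move: (_^-1) hr => del hr; lra.
have [f hfi] := choice hf.
pose x : {ffun I -> rat} * nat := ([ffun i => f i], k).
have Px : exists z, P x z by exists z; split => //= i; rewrite ffunE.
exists (pickle x) => i; rewrite /q pickleK; case: pselect => //= h.
case: (svalP (cid h)) => /= _ /(_ i); rewrite ffunE.
move: (sval (cid h)) => z' hz'; have := hfi i => h1.
have -> : c i z - c i z' = (c i z - ratr (f i)) - (c i z' - ratr (f i)) by ring.
by apply: le_trans (ler_normB _ _) _; move: (_^-1) hk h1 hz' => del hk h1 hz'; lra.
Qed.

End DenseSequence.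

Section Measurability.
Context {R : realType} {disp : measure_display} {Om : measurableType disp}.
Variable mu : {measure set Om -> \bar R}.
Hypothesis cmu : measure_is_complete mu.
Context (Z : Type) (I : finType) (c : I -> Z -> R) (A : set Z).

(** A function that is measurable in t and Lipschitz in z is the infimum, over z'
    in a countable dense set, of the functions b t z' + K |z - z'|; this makes
    its composition with a measurable path measurable. *)
Lemma measurable_lipschitz_comp (D : set Om) (K : R) (b : Om -> Z -> R)
    (z : Om -> Z) :
  measurable D -> 0 <= K ->
  (forall x, A x -> measurable_fun D (fun t => b t x)) ->
  (forall i, measurable_fun D (fun t => c i (z t))) ->
  (forall t, D t -> A (z t)) ->
  {ae mu, forall t, D t -> forall x x', A x -> A x' ->
     `|b t x - b t x'| <= K * \sum_i `|c i x - c i x'|} ->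
  measurable_fun D (fun t => b t (z t)).
Proof.
move=> mD K0 mb mz Az hb.
have [D0|/set0P[t0 Dt0]] := eqVneq D set0.
  by rewrite D0; exact: measurable_fun_set0.
have [q [Aq hq]] := dense_sequence c (Az _ Dt0).
pose g k t : R := b t (q k) + K * \sum_i `|c i (z t) - c i (q k)|.
have mg k : measurable_fun D (g k).
  apply: measurable_funD; first exact: mb.
  apply: measurable_funM; first exact: measurable_cst.
  apply: measurable_sum => i; apply: measurableT_comp => //.
  by apply: measurable_funB; [exact: mz|exact: measurable_cst].
apply/measurable_EFinP.
apply: (ae_measurable_fun cmu (f := fun t => einfs (fun k => (g k t)%:E) 0)); last first.
  by apply: (measurable_fun_einfs (f := fun k t => (g k t)%:E)) => k; apply/measurable_EFinP.
move: hb; apply: filterS => t /= ht Dt.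
have {}ht := ht Dt.
apply/eqP; rewrite eq_le /einfs; apply/andP; split.
  apply/lee_addgt0Pr => e e0.
  pose N := 2 * K * #|I|%:R + 1.
  have N0 : 0 < N by rewrite ltr_wpDl // mulr_ge0 // mulr_ge0.
  have [k hk] := hq (z t) (e / N) (Az _ Dt) (divr_gt0 e0 N0).
  apply: ereal_inf_le; exists (g k t)%:E => /=; first by exists k.
  rewrite -EFinD lee_fin /g.
  have hs : \sum_i `|c i (z t) - c i (q k)| <= #|I|%:R * (e / N).
    apply: le_trans (ler_sum _ (G := fun=> e / N) _) _ => [i _|]; first exact: hk.
    by rewrite sumr_const -[leLHS]mulr_natl.
  have h1 := ht _ _ (Aq k) (Az _ Dt).
  have h2 : b t (q k) - b t (z t) <= K * \sum_i `|c i (z t) - c i (q k)|.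
    apply: le_trans (ler_norm _) _; apply: le_trans h1 _.
    by rewrite le_eqVlt; apply/orP; left; apply/eqP; congr (_ * _);
      apply: eq_bigr => i _; rewrite distrC.
  have h3 := ler_wpM2l K0 hs.
  have h4 : 2 * (K * (#|I|%:R * (e / N))) <= e.
    rewrite -[leRHS](divfK (lt0r_neq0 N0)).
    have eN : 0 < e / N by exact: divr_gt0.
    rewrite /N in eN *; nra.
  lra.
apply: le_ereal_inf_tmp => _ [k _ <-]; rewrite lee_fin /g.
have := ht _ _ (Az _ Dt) (Aq k); move: (K * _) => S.
by move=> /(le_trans (ler_norm _)); lra.
Qed.

End Measurability.

Section RealIntegral.
Context {R : realType} {disp : measure_display} {Om : measurableType disp}.
Variable mu : {measure set Om -> \bar R}.

Lemma ae_bounded_integrable (D : set Om) (g : Om -> R) (K : R) :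
  measurable D -> (mu D < +oo)%E -> measurable_fun D g -> 0 <= K ->
  {ae mu, forall t, D t -> `|g t| <= K} ->
  mu.-integrable D (EFin \o g).
Proof.
move=> mD fD mg K0 hg; apply/integrableP; split; first exact/measurable_EFinP.
apply: le_lt_trans (_ : (\int[mu]_(x in D) K%:E < +oo)%E); last first.
  rewrite integral_cst //; apply: lte_mul_pinfty => //.
apply: ae_ge0_le_integral => //.
- apply: measurableT_comp => //; exact/measurable_EFinP.
Qed.

(** The indicator function is to isolate the times at which two controls differ. *)
Lemma Rintegral_norm_le (D J : set Om) (g : Om -> R) (c1 c2 : R) :
  measurable D -> (mu D < +oo)%E -> measurable J ->
  mu.-integrable D (EFin \o g) -> 0 <= c1 -> 0 <= c2 ->
  {ae mu, forall t, D t -> `|g t| <= c1 + c2 * \1_J t} ->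
  `|\int[mu]_(x in D) g x| <= c1 * fine (mu D) + c2 * fine (mu (D `&` J)).
Proof.
move=> mD fD mJ ig c10 c20 hg.
apply: le_trans (le_normr_Rintegral mD ig) _.
have mg : measurable_fun D g by apply/measurable_EFinP; exact: measurable_int ig.
have fDJ : (mu (D `&` J) < +oo)%E.
  by apply: le_lt_trans fD; apply: le_measure; rewrite ?inE //; exact: measurableI.
have ig' : mu.-integrable D (EFin \o (fun x => `|g x|)) by exact: integrable_norm.
rewrite -lee_fin /Rintegral fineK; last exact: integrable_fin_num.
have : (\int[mu]_(x in D) (`|g x|)%:E <=
        \int[mu]_(x in D) (c1 + c2 * \1_J x)%:E)%E.
  apply: ae_ge0_le_integral => //.
  - by apply/measurable_EFinP; apply: measurableT_comp.
  - by move=> x _; rewrite lee_fin addr_ge0 // mulr_ge0.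
  - apply/measurable_EFinP; apply: measurable_funD; first exact: measurable_cst.
    apply: measurable_funM; first exact: measurable_cst.
    by apply: measurable_indic; exact: mJ.
move=> /le_trans; apply.
under eq_integral do rewrite EFinD EFinM.
rewrite ge0_integralD //; last 2 first.
- by move=> x _; rewrite mule_ge0 // lee_fin.
- apply: measurable_funeM; apply/measurable_EFinP; apply: measurable_indic; exact: mJ.
rewrite integral_cst // ge0_integralZl //; last first.
  by apply/measurable_EFinP; apply: measurable_indic; exact: mJ.
rewrite integral_indic // EFinD !EFinM setIC !fineK //.
- by rewrite ge0_fin_numE.
- by rewrite ge0_fin_numE.
Qed.

End RealIntegral.

Section AlmostEverywhere.
Context {R : realType} {disp : measure_display} {Om : measurableType disp}.
Variable mu : {measure set Om -> \bar R}.
Implicit Types P Q : Om -> Prop.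

Lemma ae_imp P Q : {ae mu, forall t, P t} -> (forall t, P t -> Q t) ->
  {ae mu, forall t, Q t}.
Proof. by move=> h PQ; apply: filterS h. Qed.

Lemma ae_imp3 P1 P2 P3 Q : {ae mu, forall t, P1 t} -> {ae mu, forall t, P2 t} ->
  {ae mu, forall t, P3 t} -> (forall t, P1 t -> P2 t -> P3 t -> Q t) ->
  {ae mu, forall t, Q t}.
Proof. by move=> h1 h2 h3 PQ; apply: filterS3 h1 h2 h3. Qed.

End AlmostEverywhere.

Section CompletedLebesgue.
Context {R : realType}.
Local Notation Om := (caratheodory_type (@wlength R idfun)^*%mu).

Lemma cara_measurable (A : set R) :
  measurable (A : set (measurableTypeR R)) -> measurable (A : set Om).
Proof. by move=> mA; exact: sub_caratheodory. Qed.

Lemma leb_itv_oc (s t : R) : s <= t -> leb `]s, t] = (t - s)%:E.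
Proof.
move=> st; have -> : leb `]s, t] = lebesgue_measure (`]s, t]%classic : set R) by [].
rewrite lebesgue_measure_itv /= lte_fin.
move: st; rewrite le_eqVlt => /predU1P[->|->]; last by rewrite EFinB.
by rewrite ltxx subrr.
Qed.

Lemma within_continuous_measurable k l (D : set R) (Y : R -> 'M[R]_(k, l)) i j :
  measurable (D : set (measurableTypeR R)) -> {within D, continuous Y} ->
  @measurable_fun _ _ Om (measurableTypeR R) D (fun t => Y t i j).
Proof.
move=> mD cY mD' B mB; apply: cara_measurable.
have : measurable_fun (T := measurableTypeR R) D (fun t => Y t i j).
  apply: subspace_continuous_measurable_fun => //.
  move=> x; apply: (@continuous_comp (subspace D) 'M[R]_(k, l) R Y (fun M => M i j)).
    exact: cY.
  exact: coord_continuous.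
exact.
Qed.

End CompletedLebesgue.

Section Drift.
Context {R : realType} (n m : nat) (T : R) (U : set 'cV[R]_m).
Variable b : R -> 'cV[R]_n -> 'cV[R]_m -> 'cV[R]_n.
Local Notation Om := (caratheodory_type (@wlength R idfun)^*%mu).
Local Notation lebm := (@completed_lebesgue_measure R).

Definition drift_lipschitz (K : R) := forall Y u s t,
  {within `[0, T], continuous Y} -> Linf T U u ->
  0 <= s -> s <= t -> t <= T ->
  `|drift b Y u t - drift b Y u s| <= K * (t - s).

(** The error due to the controls is proportional to the time spent in the set J
    outside of which they agree. *)
Definition drift_stability (K : R) := forall Y Yt u ut s t (J : set R) (D N : R),
  {within `[0, T], continuous Y} -> {within `[0, T], continuous Yt} ->
  Linf T U u -> Linf T U ut ->
  0 <= s -> s <= t -> t <= T -> 0 <= D -> 0 <= N ->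
  measurable (J : set (measurableTypeR R)) ->
  (forall r, s <= r <= t -> `|Y r - Yt r| <= D) ->
  {ae leb, forall r, s <= r <= t -> ~ J r -> u r = ut r} ->
  {ae leb, forall r, s <= r <= t -> `|u r - ut r| <= N} ->
  `|(drift b Y u t - drift b Y u s) - (drift b Yt ut t - drift b Yt ut s)|
    <= K * D * (t - s) + K * N * fine (lebm (`]s, t] `&` J)).

Hypothesis hb : drift_assumption T U b.

Lemma mx_norm_sum k (x : 'cV[R]_k) : `|x| <= \sum_i `|x i 0|.
Proof.
apply: mx_norm_le => [|i j]; first exact: sumr_ge0.
by rewrite ord1 (bigD1 i) //= lerDl sumr_ge0.
Qed.

Lemma drift_measurable (Y : R -> 'cV[R]_n) (u : R -> 'cV[R]_m) i :
  {within `[0, T], continuous Y} -> Linf T U u ->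
  @measurable_fun _ _ Om (measurableTypeR R) `[0, T]
    (fun t => b t (Y t) (u t) i 0).
Proof.
case: hb => mb _ [K K0 hK] cY [uU mu _].
pose c (k : 'I_n + 'I_m) (z : 'cV[R]_n * 'cV[R]_m) : R :=
  match k with inl k => z.1 k 0 | inr k => z.2 k 0 end.
have mI : measurable (`[0, T]%classic : set (measurableTypeR R)) by exact: measurable_itv.
have /(_ (cara_measurable mI) K0) P := @measurable_lipschitz_comp R _ Om lebm
  completed_lebesgue_measure_is_complete ('cV[R]_n * 'cV[R]_m)%type _ c (setT `*` U)
  (`[0, T]%classic : set R) K (fun t z => b t z.1 z.2 i 0) (fun t => (Y t, u t)).
apply: P.
- by move=> [x v] [_ Uv]; exact: mb.
- by case=> k /=; [exact: within_continuous_measurable|exact: mu].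
- by move=> t tT; split=> [|/=]; [by []|exact: uU].
- apply: (ae_imp (mu := lebm) hK) => t h tT [x v] [x' v'] [_ /= Uv] [_ /= Uv'].
  have [_ h1 _] := h tT x x' v v' Uv Uv'.
  have [_ _ h2] := h tT x' x' v v' Uv Uv'.
  rewrite big_sumType /= mulrDr.
  have -> : b t x v i 0 - b t x' v' i 0 =
    (b t x v - b t x' v) i 0 + (b t x' v - b t x' v') i 0 by rewrite !mxE; ring.
  apply: le_trans (ler_normD _ _) _; apply: lerD.
    apply: le_trans (mx_norm_entry _ _ _) _; apply: le_trans h1 _.
    apply: ler_wpM2l => //; apply: le_trans (mx_norm_sum _) _.
    by rewrite le_eqVlt; apply/orP; left; apply/eqP; apply: eq_bigr => k _; rewrite !mxE.
  apply: le_trans (mx_norm_entry _ _ _) _; apply: le_trans h2 _.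
  apply: ler_wpM2l => //; apply: le_trans (mx_norm_sum _) _.
  by rewrite le_eqVlt; apply/orP; left; apply/eqP; apply: eq_bigr => k _; rewrite !mxE.
Qed.

Lemma leb_itv_fin (s t : R) (A : set R) :
  measurable (A : set (measurableTypeR R)) -> A `<=` `]s, t] ->
  (lebm A < +oo)%E.
Proof.
move=> mA hA; have [st|ts] := leP s t; last first.
  have -> : A = set0.
    by rewrite -subset0 => x /hA /=; rewrite in_itv /= => /andP[]; lra.
  by rewrite measure0.
apply: (@le_lt_trans _ _ (lebm `]s, t])); last by rewrite leb_itv_oc // ltey.
by apply: le_measure; rewrite ?inE //; apply: cara_measurable => //; exact: measurable_itv.
Qed.

Lemma drift_integrable (K : R) (Y : R -> 'cV[R]_n) (u : R -> 'cV[R]_m) i :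
  0 <= K -> {ae leb, forall t, t \in `[0, T] ->
    forall x v, U v -> `|b t x v| <= K} ->
  {within `[0, T], continuous Y} -> Linf T U u ->
  lebm.-integrable `[0, T] (EFin \o (fun t => b t (Y t) (u t) i 0)).
Proof.
move=> K0 hK cY hu; have mI : measurable (`[0, T]%classic : set (measurableTypeR R)).
  exact: measurable_itv.
have fI : (lebm `[0%R, T] < +oo)%E.
  apply: (@leb_itv_fin (-1) T) => // x /=; rewrite !in_itv /= => /andP[x0 ->].
  by rewrite andbT; lra.
apply: (ae_bounded_integrable (cara_measurable mI) fI (drift_measurable i cY hu) K0).
apply: (ae_imp (mu := lebm) hK) => t h tT; apply: le_trans (mx_norm_entry _ _ _) _.
  by apply: h => //; case: hu => + _ _; apply.
Qed.

Lemma drift_incr (K : R) (Y : R -> 'cV[R]_n) (u : R -> 'cV[R]_m) s t i :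
  0 <= K -> {ae leb, forall t, t \in `[0, T] ->
    forall x v, U v -> `|b t x v| <= K} ->
  {within `[0, T], continuous Y} -> Linf T U u -> 0 <= s -> s <= t -> t <= T ->
  (drift b Y u t - drift b Y u s) i 0 = \int[lebm]_(r in `]s, t]) b r (Y r) (u r) i 0.
Proof.
move=> K0 hK cY hu s0 st tT; rewrite !mxE.
have E : `[0, t]%classic = (`[0, s]%classic `|` `]s, t]%classic) :> set R.
  apply/seteqP; split=> x /=; rewrite !in_itv /=.
    by move=> /andP[x0 xt]; case: (leP x s) => xs; [left|right]; rewrite ?x0 ?xt.
  by move=> [/andP[-> xs]|/andP[sx ->]]; rewrite ?(le_trans xs st) // ?(le_trans s0 (ltW sx)).
rewrite E Rintegral_setU; first by rewrite addrAC subrr add0r.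
- by apply: cara_measurable; exact: measurable_itv.
- by apply: cara_measurable; exact: measurable_itv.
- rewrite -E; apply: integrableS (drift_integrable i K0 hK cY hu).
  + by apply: cara_measurable; exact: measurable_itv.
  + by apply: cara_measurable; exact: measurable_itv.
  + by move=> x /=; rewrite !in_itv /= => /andP[-> xt]; exact: le_trans tT.
- apply/disj_setPS => x [] /=; rewrite !in_itv /= => /andP[_ xs] /andP[sx _].
  by move: (lt_le_trans sx xs); rewrite ltxx.
Qed.

(** In b r (Y r) (u r) - b r (Yt r) (ut r), change the state first: this costs a
    multiple of the distance of the paths, and the remaining change of control costs
    nothing off J. *)
Lemma drift_bounds : exists2 K, 1 <= K &
  drift_lipschitz K /\ drift_stability K.
Proof.
have [_ _ [K K0 hK]] := hb.
have hK' : {ae leb, forall t, t \in `[0, T] ->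
    forall x v, U v -> `|b t x v| <= K}.
  by apply: (ae_imp (mu := lebm) hK) => t h tT x v Uv; have [] := h tT x x v v Uv Uv.
have K10 : 0 <= K + 1 by lra.
have KK1 : K <= K + 1 by lra.
exists (K + 1); first by lra.
have mJ s t : measurable (`]s, t]%classic : set Om).
  by apply: cara_measurable; exact: measurable_itv.
have fJ (s t : R) : (lebm `]s, t] < +oo)%E.
  by apply: (@leb_itv_fin s t) => //; exact: measurable_itv.
have sI s t : 0 <= s -> t <= T -> `]s, t]%classic `<=` `[0, T]%classic.
  move=> s0 tT x /=; rewrite !in_itv /= => /andP[sx xt].
  by rewrite (le_trans s0 (ltW sx)) (le_trans xt).
have mT : measurable (`[0, T]%classic : set Om).
  by apply: cara_measurable; exact: measurable_itv.
split=> [Y u s t cY hu s0 st tT|].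
  apply: mx_norm_le => [|i j]; first by rewrite mulr_ge0 // subr_ge0.
  rewrite ord1 (drift_incr i K0 hK') //.
  have i1 := integrableS mT (mJ s t) (sI _ _ s0 tT) (drift_integrable i K0 hK' cY hu).
  have := Rintegral_norm_le (mJ s t) (fJ s t) measurable0 i1 K10 (lexx 0).
  rewrite mul0r addr0 -[t - s]/(fine (t - s)%:E) -(leb_itv_oc st); apply.
  apply: (ae_imp (mu := lebm) hK') => r h rst; rewrite mul0r addr0.
  apply: le_trans (mx_norm_entry _ _ _) _; apply: le_trans KK1.
  have rT := sI _ _ s0 tT _ rst.
  by apply: h => //; case: hu => + _ _; apply.
move=> Y Yt u ut s t J D N cY cYt hu hut s0 st tT D0 N0 mJ' hD hJ hN.
apply: mx_norm_le => [|i j].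
  by rewrite addr_ge0 // !mulr_ge0 // ?subr_ge0 // fine_ge0.
rewrite ord1 [X in `|X| <= _]mxE [X in `|_ + X| <= _]mxE.
rewrite (drift_incr i K0 hK' cY) // (drift_incr i K0 hK' cYt) //.
have i1 := integrableS mT (mJ s t) (sI _ _ s0 tT) (drift_integrable i K0 hK' cY hu).
have i2 := integrableS mT (mJ s t) (sI _ _ s0 tT) (drift_integrable i K0 hK' cYt hut).
have i3 := integrableB (mJ s t) i1 i2.
rewrite -(RintegralB (mJ s t) i1 i2).
have := Rintegral_norm_le (mJ s t) (fJ s t) (cara_measurable mJ') i3
   (mulr_ge0 K10 D0) (mulr_ge0 K10 N0).
rewrite -[t - s]/(fine (t - s)%:E) -(leb_itv_oc st); apply.
apply: (ae_imp3 (mu := lebm) hK hJ hN) => r h1 h2 h3 rst.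
  have rT := sI _ _ s0 tT _ rst.
  have rst' : s <= r <= t.
    by move: rst; rewrite /= in_itv /= => /andP[/ltW -> ->].
  have Uu : U (u r) by case: hu => + _ _; apply.
  have Uut : U (ut r) by case: hut => + _ _; apply.
  have [_ e1 _] := h1 rT (Y r) (Yt r) (u r) (u r) Uu Uu.
  have [_ _ e2] := h1 rT (Yt r) (Yt r) (u r) (ut r) Uu Uut.
  have -> : b r (Y r) (u r) i 0 - b r (Yt r) (ut r) i 0 =
    (b r (Y r) (u r) - b r (Yt r) (u r)) i 0 +
    (b r (Yt r) (u r) - b r (Yt r) (ut r)) i 0 by rewrite !mxE; ring.
  apply: le_trans (ler_normD _ _) _; apply: lerD.
    apply: le_trans (mx_norm_entry _ _ _) _; apply: le_trans e1 _.
    by apply: ler_pM => //; exact: hD.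
  apply: le_trans (mx_norm_entry _ _ _) _; apply: le_trans e2 _.
  rewrite indicE; case: (boolP (r \in J)) => rJ; last first.
    have -> : u r = ut r by apply: h2 => // Jr; move/negP: rJ; apply; exact/mem_set.
    by rewrite subrr normr0 !mulr0.
by rewrite mulr1; apply: ler_pM => //; exact: h3.
Qed.

End Drift.

(** * The local expansion of a rough differential equation *)

Section LocalExpansion.
Context {R : realType} (n d : nat) (T : R).
Local Notation V := (R^o * 'cV[R]_n)%type.
Local Notation W := 'M[R]_(n, d).
Variables (f : V -> W) (Df : V -> {linear V -> W}) (N : R).
Hypothesis hf : coef_bounds (slab T) N f Df.
Hypothesis dN : d%:R <= N.

Let N1 : 1 <= N. Proof. exact: coef_M hf. Qed.
Let N0 : 0 <= N. Proof. exact: le_trans ler01 N1. Qed.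

(** The Gubinelli derivative of f (., Y) in the l-th direction of the driver. *)
Definition gub (l : 'I_d) (z : V) : W := Df z (0, col l (f z)).

Lemma lin_sub (L : {linear V -> W}) (x y : 'cV[R]_n) :
  L ((0, x - y) : V) = L (0, x) - L (0, y).
Proof.
rewrite -linearB; have e : ((0, x - y) : V) = ((0, x) : V) - ((0, y) : V).
  by apply: pair_ext => //=; rewrite subrr.
by rewrite e.
Qed.

Lemma gub_b l z : slab T z -> `|gub l z| <= N ^+ 2.
Proof.
move=> Dz; apply: le_trans (coef_db hf _ Dz) _; rewrite pair0_norm expr2.
rewrite ler_wpM2l //; apply: le_trans (col_norm _ _) _; exact: coef_b hf _ Dz.
Qed.

Lemma col_subE l (A B : W) : col l A - col l B = col l (A - B).
Proof. by rewrite linearB. Qed.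

Lemma gub_l l z z' : slab T z -> slab T z' ->
  `|gub l z - gub l z'| <= 5 * N ^+ 2 * `|z - z'|.
Proof.
move=> Dz Dz'.
have -> : gub l z - gub l z' = (Df z (0, col l (f z)) - Df z' (0, col l (f z)))
    + Df z' (0, col l (f z - f z')).
  by rewrite /gub -col_subE lin_sub; zmod.
apply: le_trans (ler_normD _ _) _.
have h1 := coef_dl hf ((0, col l (f z)) : V) Dz Dz'.
have h2 := coef_db hf ((0, col l (f z - f z')) : V) Dz'.
rewrite !pair0_norm in h1 h2.
have h3 := le_trans (col_norm (f z) l) (coef_b hf Dz).
have h4 := le_trans (col_norm (f z - f z') l) (coef_l hf Dz Dz').
have n0 : 0 <= `|z - z'| by [].
have {}h1 := le_trans h1 (ler_wpM2l (mulr_ge0 N0 n0) h3).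
have {}h2 := le_trans h2 (ler_wpM2l N0 h4).
apply: le_trans (lerD h1 h2) _; nra.
Qed.

(** Bilinear expansion of Df applied to a column of f: the increments of each factor
    are of second-order Lipschitz type. *)
Lemma gub_l2 l a a' b b' : slab T a -> slab T a' -> slab T b -> slab T b' ->
  slab T (a + (b' - b)) ->
  `|gub l a' - gub l a - (gub l b' - gub l b)| <=
   5 * N ^+ 2 * (`|a' - a - (b' - b)| + `|a - b| * `|b' - b|).
Proof.
move=> Da Da' Db Db' Dc.
pose y z : 'cV[R]_n := col l (f z).
pose A z x : W := Df z ((0, x) : V).
have -> : gub l a' - gub l a - (gub l b' - gub l b) =
  (A a' (y a') - A a (y a') - (A b' (y a') - A b (y a')))
  + (A b' (y a' - y b') - A b (y a' - y b'))
  + A a (y a' - y a - (y b' - y b))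
  + (A a (y b' - y b) - A b (y b' - y b)).
  by rewrite /gub /A !lin_sub -/(y _) -/(y _) -/(y _); zmod.
have yb z : slab T z -> `|y z| <= N.
  by move=> Dz; apply: le_trans (col_norm _ _) _; exact: coef_b hf _ Dz.
have yl z z' : slab T z -> slab T z' -> `|y z - y z'| <= N * `|z - z'|.
  move=> Dz Dz'; rewrite /y col_subE; apply: le_trans (col_norm _ _) _.
  exact: coef_l hf _ _ Dz Dz'.
set E := `|a' - a - (b' - b)|; set D := `|a - b|; set H := `|b' - b|.
have E0 : 0 <= E by exact: normr_ge0.
have D0 : 0 <= D by exact: normr_ge0.
have H0 : 0 <= H by exact: normr_ge0.
have t1 : `|A a' (y a') - A a (y a') - (A b' (y a') - A b (y a'))| <=
    N * (E + D * H) * N.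
  apply: le_trans (coef_dl2 hf _ Da Da' Db Db' Dc) _; rewrite pair0_norm.
  by rewrite ler_wpM2l ?yb // mulr_ge0 // addr_ge0 // mulr_ge0.
have t3 : `|A a (y a' - y a - (y b' - y b))| <= N * (N * (E + D * H)).
  apply: le_trans (coef_db hf _ Da) _; rewrite pair0_norm ler_wpM2l //.
  rewrite /y !col_subE; apply: le_trans (col_norm _ _) _.
  exact: coef_l2 hf _ _ _ _ Da Da' Db Db' Dc.
have t4 : `|A a (y b' - y b) - A b (y b' - y b)| <= N * D * (N * H).
  apply: le_trans (coef_dl hf _ Da Db) _; rewrite pair0_norm ler_wpM2l ?mulr_ge0 //.
  exact: yl.
have t2 : `|A b' (y a' - y b') - A b (y a' - y b')| <= N * (N * D * H) + 2 * N * (N * E).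
  have e : y a' - y b' = (y a' - y (a + (b' - b))) + (y (a + (b' - b)) - y b') by zmod.
  have -> : A b' (y a' - y b') - A b (y a' - y b') =
    (A b' (y (a + (b' - b)) - y b') - A b (y (a + (b' - b)) - y b')) +
    (A b' (y a' - y (a + (b' - b))) - A b (y a' - y (a + (b' - b)))).
    by rewrite /A !lin_sub; zmod.
  apply: le_trans (ler_normD _ _) _; apply: lerD.
    apply: le_trans (coef_dl hf _ Db' Db) _; rewrite pair0_norm -/H.
    have := yl _ _ Dc Db'; have -> : a + (b' - b) - b' = a - b by zmod.
    rewrite -/D => h; have := ler_wpM2l (mulr_ge0 N0 H0) h.
    move=> h'; apply: le_trans h' _; nra.
  apply: le_trans (ler_normB _ _) _.
  have := yl _ _ Da' Dc; have -> : a' - (a + (b' - b)) = a' - a - (b' - b) by zmod.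
  rewrite -/E => h.
  have h1 := coef_db hf ((0, y a' - y (a + (b' - b))) : V) Db'.
  have h2 := coef_db hf ((0, y a' - y (a + (b' - b))) : V) Db.
  rewrite !pair0_norm in h1 h2; have := ler_wpM2l N0 h.
  rewrite /A; lra.
apply: le_trans (ler_normD _ _) _; apply: le_trans (lerD (ler_normD _ _) t4) _.
apply: le_trans (lerD (lerD (ler_normD _ _) t3) (lexx _)) _.
apply: le_trans (lerD (lerD (lerD t1 t2) (lexx _)) (lexx _)) _.
have : 0 <= N * N * E by rewrite !mulr_ge0.
have : 0 <= N * N * (D * H) by rewrite !mulr_ge0.
by rewrite expr2; nra.
Qed.

Implicit Types (X : R -> 'cV[R]_d) (XX : R -> R -> 'M[R]_d) (Y : R -> 'cV[R]_n).

Definition pt Y u : V := (u, Y u).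

(** The compensated Riemann summand of the rough integral of f (., Y). *)
Definition germ Y X XX u v : 'cV[R]_n :=
  f (pt Y u) *m (X v - X u) + \sum_(l < d) gub l (pt Y u) *m (row l (XX u v))^T.

(** The remainder of f (., Y) as a path controlled by X. *)
Definition coef_rem Y X u v : W :=
  f (pt Y v) - f (pt Y u) - Df (pt Y u) (0, f (pt Y u) *m (X v - X u)).

Definition second_incr Y XX u r v : 'cV[R]_n :=
  \sum_(l < d) (gub l (pt Y r) - gub l (pt Y u)) *m (row l (XX r v))^T.

Lemma mulmx_sum_col k (A : 'M[R]_(k, d)) (x : 'cV[R]_d) :
  A *m x = \sum_l x l 0 *: col l A.
Proof.
apply/matrixP => i j; rewrite ord1 mxE summxE; apply: eq_bigr => l _.
by rewrite !mxE mulrC.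
Qed.

Lemma gub_sum z (x : 'cV[R]_d) :
  Df z (0, f z *m x) = \sum_l x l 0 *: gub l z.
Proof.
have -> : ((0, f z *m x) : V) = \sum_l x l 0 *: ((0, col l (f z)) : V).
  apply: pair_ext => /=.
    rewrite (big_morph fst (id1 := 0) (op1 := +%R)) //= big1 // => l _.
    by rewrite scaler0.
  by rewrite (big_morph snd (id1 := 0) (op1 := +%R)) //= mulmx_sum_col.
by rewrite linear_sum; apply: eq_bigr => l _; rewrite linearZ.
Qed.

(** Chen's relation turns the defect of additivity of the germ into products of
    increments. *)
Lemma germ_defect Y X XX u r v :
  XX u v = XX u r + XX r v + (X r - X u) *m (X v - X r)^T ->
  germ Y X XX u v - germ Y X XX u r - germ Y X XX r v =
  - (coef_rem Y X u r *m (X v - X r) + second_incr Y XX u r v).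
Proof.
move=> chen; rewrite /germ /coef_rem /second_incr.
set zu := pt Y u; set zr := pt Y r.
have E1 : \sum_(l < d) gub l zu *m (row l (XX u v))^T =
   \sum_(l < d) gub l zu *m (row l (XX u r))^T +
   \sum_(l < d) gub l zu *m (row l (XX r v))^T +
   Df zu (0, f zu *m (X r - X u)) *m (X v - X r).
  rewrite gub_sum mulmx_suml -!big_split /=; apply: eq_bigr => l _.
  have -> : (row l (XX u v))^T = (row l (XX u r))^T + (row l (XX r v))^T +
      (X r - X u) l 0 *: (X v - X r).
    rewrite chen; move: (X r - X u) (X v - X r) => x y.
    by apply/matrixP => i j; rewrite !mxE big_ord1 !mxE (ord1 j).
  by move: (X v - X r) => y; rewrite !mulmxDr -scalemxAl scalemxAr.
have E2 : \sum_(l < d) (gub l zr - gub l zu) *m (row l (XX r v))^T =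
   \sum_(l < d) gub l zr *m (row l (XX r v))^T -
   \sum_(l < d) gub l zu *m (row l (XX r v))^T.
  by rewrite -sumrB; apply: eq_bigr => l _; rewrite mulmxBl.
have E3 : X v - X u = (X v - X r) + (X r - X u) by zmod.
rewrite E1 E2 {1}E3 !mulmxDr !mulmxBl; zmod.
Qed.

End LocalExpansion.

Section LocalBounds.
Context {R : realType} (n d : nat) (T : R).
Local Notation V := (R^o * 'cV[R]_n)%type.
Local Notation W := 'M[R]_(n, d).
Variables (f : V -> W) (Df : V -> {linear V -> W}) (N K : R).
Hypothesis hf : coef_bounds (slab T) N f Df.
Hypothesis dN : d%:R <= N.
Hypothesis K1 : 1 <= K.

Let N1 : 1 <= N. Proof. exact: coef_M hf. Qed.
Let N0 : 0 <= N. Proof. exact: le_trans ler01 N1. Qed.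
Let K0 : 0 <= K. Proof. exact: le_trans ler01 K1. Qed.

Lemma mulmx_le k (A : 'M[R]_(k, d)) (x : 'cV[R]_d) (al be : R) :
  `|A| <= al -> `|x| <= be -> `|A *m x| <= N * (al * be).
Proof.
move=> hA hx; apply: le_trans (mulmx_norm _ _) _.
by apply: ler_pM; rewrite ?mulr_ge0 ?normr_ge0 ?ler0n // ler_pM.
Qed.

Lemma sum_mulmx_le k (A : 'I_d -> 'M[R]_(k, d)) (B : 'M[R]_d) (al be : R) :
  0 <= al -> (forall l, `|A l| <= al) -> `|B| <= be ->
  `|\sum_(l < d) A l *m (row l B)^T| <= N * (N * (al * be)).
Proof.
move=> al0 hA hB; have be0 : 0 <= be by exact: le_trans hB.
apply: le_trans (ler_norm_sum _ _ _) _.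
apply: le_trans (ler_sum _ (G := fun=> N * (al * be)) _) _ => [l _|].
  apply: mulmx_le => //; apply: le_trans (trmx_norm _) _.
  exact: le_trans (row_norm _ _) hB.
rewrite sumr_const card_ord -[leLHS]mulr_natl ler_wpM2r //.
by rewrite !mulr_ge0.
Qed.

Variables (s t : R).
Hypothesis s0 : 0 <= s.
Hypothesis tT : t <= T.

Lemma slab_pt (Y : R -> 'cV[R]_n) u : s <= u -> u <= t -> slab T (pt Y u).
Proof.
by move=> su ut; split => //=; rewrite in_itv /= (le_trans s0 su) (le_trans ut tT).
Qed.

(** The scale h plays the part of |t - s|^(1/p) in the Hoelder case. *)
Variable h : R -> R -> R.
Definition scale := forall u r v, s <= u -> u <= r -> r <= v -> v <= t ->
  [/\ 0 <= h u r, 0 <= h r v, h u r <= h u v, h r v <= h u v & h u v <= 1].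
Hypothesis hh : scale.

Lemma scale01 u v : s <= u -> u <= v -> v <= t -> 0 <= h u v <= 1.
Proof. by move=> su uv vt; have [_ -> _ _ ->] := hh su (lexx u) uv vt. Qed.

Implicit Types (X : R -> 'cV[R]_d) (XX : R -> R -> 'M[R]_d) (Y B : R -> 'cV[R]_n).

Definition path_rem X Y u v : 'cV[R]_n := Y v - Y u - f (pt Y u) *m (X v - X u).

Definition driver_le (a : R) X XX := forall u v, s <= u -> u <= v -> v <= t ->
  [/\ `|X v - X u| <= a * h u v, `|XX u v| <= a * h u v ^+ 2 &
      v - u <= a * h u v ^+ 2].

Definition chen XX X := forall u r v, s <= u -> u <= r -> r <= v -> v <= t ->
  XX u v = XX u r + XX r v + (X r - X u) *m (X v - X r)^T.

(** The constants c1 to cB below are explicit polynomials in N and in the sewing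
    constant K; only that they depend on nothing else matters. *)
Definition c1 := 4 * N * (N ^+ 4 + 1) + N.
Definition c2 := 5 * N ^+ 4 + 5 * N ^+ 2.
Definition cA := K * (N * c1 + N ^+ 2 * c2) + N ^+ 4 + N.

Create HintDb nng.
Local Hint Resolve N0 K0 : nng.
Ltac nng := repeat first [solve [auto 2 with nng nocore] | exact: normr_ge0
  | exact: ler0n | exact: ler01 | apply: exprn_ge0 | apply: addr_ge0 | apply: mulr_ge0].

Lemma c1_ge0 : 0 <= c1.
Proof. by rewrite /c1 addr_ge0 // !mulr_ge0 // addr_ge0 // exprn_ge0. Qed.
Lemma c2_ge0 : 0 <= c2.
Proof. by rewrite /c2 addr_ge0 // mulr_ge0 // exprn_ge0. Qed.
Lemma cA_ge0 : 0 <= cA.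
Proof.
by rewrite /cA !addr_ge0 // ?exprn_ge0 // mulr_ge0 // addr_ge0 // mulr_ge0
  ?exprn_ge0 ?c1_ge0 ?c2_ge0.
Qed.

Section APriori.
Variables (a Q : R) (X : R -> 'cV[R]_d) (XX : R -> R -> 'M[R]_d) (Y : R -> 'cV[R]_n).
Hypothesis a01 : 0 <= a <= 1.
Hypothesis Q0 : 0 <= Q.
Hypothesis hX : driver_le a X XX.
Hypothesis hR : forall u v, s <= u -> u <= v -> v <= t ->
  `|path_rem X Y u v| <= Q * h u v ^+ 2.

Let a0 : 0 <= a. Proof. by case/andP: a01. Qed.
Let a1 : a <= 1. Proof. by case/andP: a01. Qed.

Lemma incr_le u v : s <= u -> u <= v -> v <= t ->
  `|Y v - Y u| <= N ^+ 2 * a * h u v + Q * h u v ^+ 2.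
Proof.
move=> su uv vt.
have -> : Y v - Y u = f (pt Y u) *m (X v - X u) + path_rem X Y u v by rewrite /path_rem; zmod.
apply: le_trans (ler_normD _ _) _; apply: lerD; last exact: hR.
have [h1 _ _] := hX su uv vt.
have := mulmx_le (coef_b hf (slab_pt Y su (le_trans uv vt))) h1.
by move=> /le_trans; apply; rewrite expr2 !mulrA.
Qed.

Lemma pt_incr u v : pt Y v - pt Y u = ((v - u, Y v - Y u) : V).
Proof. exact: pair_ext. Qed.

Lemma pt_incr_le u v : s <= u -> u <= v -> v <= t ->
  `|pt Y v - pt Y u| <= N ^+ 2 * a * h u v + (a + Q) * h u v ^+ 2.
Proof.
move=> su uv vt; rewrite pt_incr; apply: le_trans (pair_norm_le _ _) _.
have [_ _ h3] := hX su uv vt; have := incr_le su uv vt.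
have -> : `|v - u| = v - u by rewrite ger0_norm // subr_ge0.
lra.
Qed.

(** The Taylor remainder is bounded by |z|^2 and by |z|; playing one bound against
    the other keeps the estimate linear in Q. *)
Lemma taylor_pt_le u v : s <= u -> u <= v -> v <= t ->
  `|taylor f Df (pt Y u) (pt Y v)| <=
  4 * N * (N ^+ 4 * (a * h u v ^+ 2) + (a + Q) * h u v ^+ 2).
Proof.
move=> su uv vt.
have Du := slab_pt Y su (le_trans uv vt); have Dv := slab_pt Y (le_trans su uv) vt.
have hy := pt_incr_le su uv vt.
have t1 := coef_t hf Du Dv.
have t2 : `|taylor f Df (pt Y u) (pt Y v)| <= 2 * N * `|pt Y v - pt Y u|.
  apply: le_trans (ler_normB _ _) _.
  have := coef_l hf Dv Du; have := coef_db hf (pt Y v - pt Y u) Du; lra.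
have /andP[H0 H1] := scale01 su uv vt.
set H := h u v in hy H0 H1 *.
set y := `|_ - _| in hy t1 t2; have y0 : 0 <= y by exact: normr_ge0.
set x := N ^+ 2 * a * H in hy; set r := (a + Q) * H ^+ 2 in hy *.
have x0 : 0 <= x by rewrite !mulr_ge0 ?exprn_ge0.
have r0 : 0 <= r by rewrite mulr_ge0 ?exprn_ge0 // addr_ge0.
have xx : x ^+ 2 <= N ^+ 4 * (a * H ^+ 2).
  have -> : x ^+ 2 = N ^+ 4 * (a ^+ 2 * H ^+ 2) by rewrite /x; ring.
  apply: ler_wpM2l; first exact: exprn_ge0.
  apply: ler_wpM2r; first exact: exprn_ge0.
  by rewrite expr2 ler_piMl.
suff : `|taylor f Df (pt Y u) (pt Y v)| <= 4 * N * (x ^+ 2 + r).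
  move=> /le_trans; apply; rewrite ler_wpM2l ?mulr_ge0 //; lra.
have [rx|xr] := leP r x.
  apply: le_trans t1 _; rewrite [4 * N]mulrC -mulrA ler_wpM2l //.
  have : y ^+ 2 <= (2 * x) ^+ 2.
    by rewrite ler_pXn2r ?nnegrE ?mulr_ge0 //; lra.
  rewrite exprMn => yx; have := sqr_ge0 x; lra.
apply: le_trans t2 _; have := sqr_ge0 x => x2.
have : N * y <= N * (2 * r + x ^+ 2) by rewrite ler_wpM2l //; lra.
have := mulr_ge0 N0 x2; lra.
Qed.

Lemma coef_remE u v : coef_rem f Df Y X u v =
  taylor f Df (pt Y u) (pt Y v) + Df (pt Y u) (v - u, 0)
  + Df (pt Y u) (0, path_rem X Y u v).
Proof.
have E : pt Y v - pt Y u = ((v - u, 0) : V) + ((0, path_rem X Y u v) : V)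
   + ((0, f (pt Y u) *m (X v - X u)) : V).
  by rewrite pt_incr; apply: pair_ext => /=; rewrite ?addr0 // add0r /path_rem; zmod.
rewrite /taylor /coef_rem E.
move: (f (pt Y u) *m _) (path_rem _ _ _ _) => y1 y2.
have -> : Df (pt Y u) (((v - u, 0) : V) + (0, y2) + (0, y1)) =
    Df (pt Y u) (v - u, 0) + Df (pt Y u) (0, y2) + Df (pt Y u) (0, y1).
  by rewrite !linearD.
zmod.
Qed.

Lemma pair_time_norm (x : R) : `|((x, 0) : V)| = `|x|.
Proof. by rewrite prod_normE /= normr0; apply/max_idPl. Qed.

Lemma coef_rem_le u v : s <= u -> u <= v -> v <= t ->
  `|coef_rem f Df Y X u v| <= c1 * ((a + Q) * h u v ^+ 2).
Proof.
move=> su uv vt; rewrite coef_remE.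
have Du := slab_pt Y su (le_trans uv vt).
have [_ _ h3] := hX su uv vt; have t1 := taylor_pt_le su uv vt.
have t2 := coef_db hf ((v - u, 0) : V) Du.
have t3 := coef_db hf ((0, path_rem X Y u v) : V) Du.
have h4 := hR su uv vt.
rewrite pair_time_norm ger0_norm ?subr_ge0 // in t2; rewrite pair0_norm in t3.
have /andP[H0 H1] := scale01 su uv vt; set H := h u v in h3 h4 t1 H0 H1 *.
have {}t2 := le_trans t2 (ler_wpM2l N0 h3).
have {}t3 := le_trans t3 (ler_wpM2l N0 h4).
apply: le_trans (ler_normD _ _) _; apply: le_trans (lerD (ler_normD _ _) t3) _.
apply: le_trans (lerD (lerD t1 t2) (lexx _)) _.
have H2 : 0 <= H ^+ 2 by exact: exprn_ge0.
have : 0 <= N * N ^+ 4 * (Q * H ^+ 2) by rewrite !mulr_ge0 // exprn_ge0.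
rewrite /c1; move: (N ^+ 4) (H ^+ 2) => N4 HH; lra.
Qed.

Lemma gub_incr_le l u v : s <= u -> u <= v -> v <= t ->
  `|gub f Df l (pt Y v) - gub f Df l (pt Y u)| <= c2 * ((a + Q) * h u v).
Proof.
move=> su uv vt.
have Du := slab_pt Y su (le_trans uv vt); have Dv := slab_pt Y (le_trans su uv) vt.
apply: le_trans (gub_l hf l Dv Du) _.
have -> : c2 * ((a + Q) * h u v) = 5 * N ^+ 2 * ((N ^+ 2 + 1) * ((a + Q) * h u v)).
  by rewrite /c2; ring.
apply: ler_wpM2l; first by rewrite mulr_ge0 // exprn_ge0.
apply: le_trans (pt_incr_le su uv vt) _.
have /andP[H0 H1] := scale01 su uv vt; set H := h u v in H0 H1 *.
have HH : H ^+ 2 <= H by rewrite expr2 ler_piMl.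
have : (a + Q) * H ^+ 2 <= (a + Q) * H by rewrite ler_wpM2l // addr_ge0.
have : 0 <= N ^+ 2 * (Q * H) by rewrite !mulr_ge0 // exprn_ge0.
move: (N ^+ 2) => N2; lra.
Qed.

Hypothesis hchen : chen XX X.

Lemma germ_defect_le u r v : s <= u -> u <= r -> r <= v -> v <= t ->
  `|germ f Df Y X XX u v - germ f Df Y X XX u r - germ f Df Y X XX r v| <=
  (N * c1 + N ^+ 2 * c2) * (a * (a + Q)) * h u v ^+ 3.
Proof.
move=> su ur rv vt; rewrite (germ_defect f Df Y (hchen su ur rv vt)) normrN.
have [q1 q2 q3 q4 q5] := hh su ur rv vt.
have rt := le_trans rv vt; have sr := le_trans su ur.
have [x1 x2 _] := hX sr rv vt.
have aQ : 0 <= a + Q by rewrite addr_ge0.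
have e1 := mulmx_le (coef_rem_le su ur rt) x1.
have e2 := sum_mulmx_le (mulr_ge0 c2_ge0 (mulr_ge0 aQ q1))
  (fun l => gub_incr_le l su ur rt) x2.
have H0 := le_trans q1 q3.
apply: le_trans (ler_normD _ _) _; apply: le_trans (lerD e1 e2) _.
set H := h u v in q3 q4 q5 H0 *.
have b1 : h u r ^+ 2 * h r v <= H ^+ 3.
  by rewrite [H ^+ 3]exprSr; apply: ler_pM; rewrite ?exprn_ge0 // ler_pXn2r ?nnegrE.
have b2 : h u r * h r v ^+ 2 <= H ^+ 3.
  by rewrite [H ^+ 3]exprS; apply: ler_pM; rewrite ?exprn_ge0 // ler_pXn2r ?nnegrE.
have k1 : 0 <= N * c1 * (a * (a + Q)) by rewrite !mulr_ge0 ?c1_ge0 //.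
have k2 : 0 <= N ^+ 2 * c2 * (a * (a + Q)) by rewrite !mulr_ge0 ?exprn_ge0 ?c2_ge0 //.
have := ler_wpM2l k1 b1; have := ler_wpM2l k2 b2.
rewrite !expr2; lra.
Qed.

Variable B : R -> 'cV[R]_n.
Hypothesis hB : forall u v, s <= u -> u <= v -> v <= t -> `|B v - B u| <= N * (v - u).
Hypothesis hS : forall rho, 0 <= rho ->
  (forall u r v, s <= u -> u <= r -> r <= v -> v <= t ->
  `|germ f Df Y X XX u v - germ f Df Y X XX u r - germ f Df Y X XX r v| <=
    rho * h u v ^+ 3) ->
  forall u v, s <= u -> u <= v -> v <= t ->
  `|Y v - Y u - (B v - B u) - germ f Df Y X XX u v| <= K * rho * h u v ^+ 3.

(** The increment of Y differs from that of B by the germ, up to the sewing error. The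
    defect of the germ is of third order in h and each of its terms contains an
    increment of the driver, whence the small factor a in front of Q. *)
Lemma a_priori u v : s <= u -> u <= v -> v <= t ->
  `|path_rem X Y u v| <= cA * (a * (1 + Q)) * h u v ^+ 2.
Proof.
move=> su uv vt.
have aQ : 0 <= a + Q by rewrite addr_ge0.
have rho0 : 0 <= (N * c1 + N ^+ 2 * c2) * (a * (a + Q)).
  by rewrite mulr_ge0 ?mulr_ge0 // addr_ge0 // mulr_ge0 ?exprn_ge0 // ?c1_ge0 // c2_ge0.
have t1 := hS rho0 germ_defect_le su uv vt.
have [x1 x2 x3] := hX su uv vt.
have Du := slab_pt Y su (le_trans uv vt).
have t2 := sum_mulmx_le (exprn_ge0 2 N0) (fun l => gub_b hf l Du) x2.
have t3 := le_trans (hB su uv vt) (ler_wpM2l N0 x3).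
have -> : path_rem X Y u v = (Y v - Y u - (B v - B u) - germ f Df Y X XX u v) +
   \sum_(l < d) gub f Df l (pt Y u) *m (row l (XX u v))^T + (B v - B u).
  by rewrite /path_rem /germ; zmod.
apply: le_trans (ler_normD _ _) _; apply: le_trans (lerD (ler_normD _ _) t3) _.
apply: le_trans (lerD (lerD t1 t2) (lexx _)) _.
have /andP[H0 H1] := scale01 su uv vt; set H := h u v in H0 H1 *.
have H2 : 0 <= H ^+ 2 by exact: exprn_ge0.
have H3 : H ^+ 3 <= H ^+ 2 by rewrite exprS ler_piMl.
have b1 : K * ((N * c1 + N ^+ 2 * c2) * (a * (a + Q))) * H ^+ 3 <=
   K * ((N * c1 + N ^+ 2 * c2) * (a * (1 + Q))) * H ^+ 2.
  apply: ler_pM => //; rewrite ?mulr_ge0 ?exprn_ge0 //.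
    rewrite addr_ge0 // mulr_ge0 ?exprn_ge0 // ?c1_ge0 // c2_ge0 //.
  apply: ler_wpM2l => //; apply: ler_wpM2l.
    by rewrite addr_ge0 // mulr_ge0 ?exprn_ge0 // ?c1_ge0 // c2_ge0.
  by apply: ler_wpM2l => //; rewrite lerD2r.
have b2 : 0 <= N ^+ 4 * (a * Q) * H ^+ 2 by rewrite !mulr_ge0 // exprn_ge0.
have b3 : 0 <= N * (a * Q) * H ^+ 2 by rewrite !mulr_ge0 //.
apply: le_trans (lerD (lerD b1 (lexx _)) (lexx _)) _.
rewrite /cA; move: (N * c1 + _) => C0.
have -> : N * (N * (N ^+ 2 * (a * H ^+ 2))) = N ^+ 4 * (a * H ^+ 2) by ring.
move: (N ^+ 4) (H ^+ 2) b2 b3 => N4 HH; lra.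
Qed.

End APriori.

Definition e2 := N ^+ 2 + 2.
Definition e1 := N ^+ 2 + 1.
Definition e3 := N ^+ 2 * e1 + N ^+ 2 + 1.
Definition e4 := N * e1 * e2 ^+ 2 + 2 * N * e3 * e2.
Definition e5 := e4 + 2 * N * e1 + N.
Definition e6 := 5 * N ^+ 2 * e3 + 5 * N ^+ 2 * e1 * e2.
Definition e7 := 5 * N ^+ 2 * e2.
Definition e8 := N * e5 + 2 * N * c1 + N ^+ 2 * e6 + N ^+ 2 * e7.
Definition e9 := N * e3 + N * e1 * e2.
Definition cB := K * e8 + 5 * N ^+ 4 * e1 + N ^+ 4 + N * e1 + 1.

Local Hint Resolve c1_ge0 c2_ge0 cA_ge0 : nng.
Lemma e1_ge0 : 0 <= e1. Proof. rewrite /e1; nng. Qed.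
Local Hint Resolve e1_ge0 : nng.
Lemma e2_ge0 : 0 <= e2. Proof. rewrite /e2; nng. Qed.
Local Hint Resolve e2_ge0 : nng.
Lemma e3_ge0 : 0 <= e3. Proof. rewrite /e3; nng. Qed.
Local Hint Resolve e3_ge0 : nng.
Lemma e4_ge0 : 0 <= e4. Proof. rewrite /e4; nng. Qed.
Local Hint Resolve e4_ge0 : nng.
Lemma e5_ge0 : 0 <= e5. Proof. rewrite /e5; nng. Qed.
Local Hint Resolve e5_ge0 : nng.
Lemma e6_ge0 : 0 <= e6. Proof. rewrite /e6; nng. Qed.
Local Hint Resolve e6_ge0 : nng.
Lemma e7_ge0 : 0 <= e7. Proof. rewrite /e7; nng. Qed.
Local Hint Resolve e7_ge0 : nng.
Lemma e8_ge0 : 0 <= e8. Proof. rewrite /e8; nng. Qed.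
Local Hint Resolve e8_ge0 : nng.
Lemma e9_ge0 : 0 <= e9. Proof. rewrite /e9; nng. Qed.
Local Hint Resolve e9_ge0 : nng.
Lemma cB_ge0 : 0 <= cB. Proof. rewrite /cB; nng. Qed.
Local Hint Resolve cB_ge0 : nng.

Section Difference.
Variables (a del Q : R) (X Xt : R -> 'cV[R]_d) (XX XXt : R -> R -> 'M[R]_d).
Variables (Y Yt : R -> 'cV[R]_n).
Hypothesis st : s <= t.
Hypothesis a01 : 0 <= a <= 1.
Hypothesis del0 : 0 <= del.
Hypothesis Q0 : 0 <= Q.
Hypothesis hX : driver_le a X XX.
Hypothesis hXt : driver_le a Xt XXt.
Hypothesis hR : forall u v, s <= u -> u <= v -> v <= t ->
  `|path_rem X Y u v| <= a * h u v ^+ 2.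
Hypothesis hRt : forall u v, s <= u -> u <= v -> v <= t ->
  `|path_rem Xt Yt u v| <= a * h u v ^+ 2.
Hypothesis hdX : forall u v, s <= u -> u <= v -> v <= t ->
  `|X v - X u - (Xt v - Xt u)| <= del * h u v.
Hypothesis hdXX : forall u v, s <= u -> u <= v -> v <= t ->
  `|XX u v - XXt u v| <= del * h u v ^+ 2.
Hypothesis hdR : forall u v, s <= u -> u <= v -> v <= t ->
  `|path_rem X Y u v - path_rem Xt Yt u v| <= Q * h u v ^+ 2.

(** All by which two solutions may differ: initial values, drivers, remainders. *)
Definition dist0 := `|Y s - Yt s| + del + Q.

Let a0 : 0 <= a. Proof. by case/andP: a01. Qed.
Let a1 : a <= 1. Proof. by case/andP: a01. Qed.
Let S0 : 0 <= dist0. Proof. by rewrite /dist0 !addr_ge0. Qed.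
Local Hint Resolve a0 S0 : nng.

Lemma pt_incr_le' X0 XX0 Y0 u v : driver_le a X0 XX0 ->
  (forall u v, s <= u -> u <= v -> v <= t -> `|path_rem X0 Y0 u v| <= a * h u v ^+ 2) ->
  s <= u -> u <= v -> v <= t -> `|pt Y0 v - pt Y0 u| <= e2 * (a * h u v).
Proof.
move=> h1 h2 su uv vt; apply: le_trans (pt_incr_le h1 h2 su uv vt) _.
have /andP[H0 H1] := scale01 su uv vt; set H := h u v in H0 H1 *.
have : a * H ^+ 2 <= a * H by rewrite ler_wpM2l // expr2 ler_piMl.
by rewrite /e2; lra.
Qed.

Lemma diff_mulmx k (A A' : 'M[R]_(k, d)) (x x' : 'cV[R]_d) :
  A *m x - A' *m x' = (A - A') *m x + A' *m (x - x').
Proof. by rewrite mulmxBl mulmxBr; zmod. Qed.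

Lemma trmx_row_sub k l (A A' : 'M[R]_(k, l)) i :
  (row i (A - A'))^T = (row i A)^T - (row i A')^T.
Proof. by apply/matrixP => j q; rewrite !mxE. Qed.

Lemma diff_incr_le u v (D : R) : s <= u -> u <= v -> v <= t ->
  `|Y u - Yt u| <= D ->
  `|Y v - Y u - (Yt v - Yt u)| <=
    N ^+ 2 * (D * a + del) * h u v + Q * h u v ^+ 2.
Proof.
move=> su uv vt hD; have ut := le_trans uv vt.
have Du := slab_pt Y su ut; have Dut := slab_pt Yt su ut.
have -> : Y v - Y u - (Yt v - Yt u) =
  (f (pt Y u) *m (X v - X u) - f (pt Yt u) *m (Xt v - Xt u))
  + (path_rem X Y u v - path_rem Xt Yt u v) by rewrite /path_rem; zmod.
apply: le_trans (ler_normD _ _) _; apply: lerD; last exact: hdR.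
rewrite diff_mulmx; apply: le_trans (ler_normD _ _) _.
have [x1 _ _] := hX su uv vt.
have k1 : `|f (pt Y u) - f (pt Yt u)| <= N * D.
  apply: le_trans (coef_l hf Du Dut) _; rewrite ler_wpM2l //.
  by rewrite /pt (_ : _ - _ = ((0, Y u - Yt u) : V)) ?pair0_norm //;
    apply: pair_ext => //=; rewrite subrr.
have := mulmx_le k1 x1; have := mulmx_le (coef_b hf Dut) (hdX su uv vt).
by rewrite expr2; lra.
Qed.

Lemma diff_sup_le u : s <= u -> u <= t -> `|Y u - Yt u| <= e1 * dist0.
Proof.
move=> su ut; have := diff_incr_le (lexx s) su ut (lexx _).
have /andP[H0 H1] := scale01 (lexx s) su ut; set H := h s u in H0 H1 *.
have -> : Y u - Yt u = (Y u - Y s - (Yt u - Yt s)) + (Y s - Yt s) by zmod.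
set D := `|Y s - Yt s|; have D0 : 0 <= D by exact: normr_ge0.
move=> h1; apply: le_trans (ler_normD _ _) _; rewrite -/D.
apply: le_trans (lerD h1 (lexx _)) _.
have Da : D * a <= D by rewrite ler_piMr.
have h2 : N ^+ 2 * (D * a + del) * H <= N ^+ 2 * (D + del).
  apply: (@le_trans _ _ (N ^+ 2 * (D * a + del))).
    by rewrite ler_piMr // mulr_ge0 ?exprn_ge0 // addr_ge0 // mulr_ge0.
  by rewrite ler_wpM2l ?exprn_ge0 // lerD2r.
have h3 : Q * H ^+ 2 <= Q by rewrite ler_piMr // exprn_ile1.
have h4 : 0 <= N ^+ 2 * Q by rewrite mulr_ge0 ?exprn_ge0.
have del0' := del0.
by rewrite /e1 /dist0 -/D; move: (N ^+ 2) h2 h4 => N2 h2 h4; lra.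
Qed.

Lemma diff_incr_le' u v : s <= u -> u <= v -> v <= t ->
  `|Y v - Y u - (Yt v - Yt u)| <= e3 * (dist0 * h u v).
Proof.
move=> su uv vt; have ut := le_trans uv vt.
apply: le_trans (diff_incr_le su uv vt (diff_sup_le su ut)) _.
have /andP[H0 H1] := scale01 su uv vt; set H := h u v in H0 H1 *.
have D0 : 0 <= `|Y s - Yt s| by exact: normr_ge0.
have h1 : Q * H ^+ 2 <= dist0 * H.
  apply: ler_pM => //; first exact: exprn_ge0.
    by rewrite /dist0 lerDr addr_ge0.
  by rewrite expr2 ler_piMl.
have h2 : N ^+ 2 * (e1 * dist0 * a + del) * H <= N ^+ 2 * (e1 * dist0 + dist0) * H.
  apply: ler_wpM2r => //; apply: ler_wpM2l; first exact: exprn_ge0.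
  apply: lerD; first by rewrite ler_piMr // mulr_ge0 ?e1_ge0.
  by have Q0' := Q0; rewrite /dist0; lra.
by rewrite /e3; move: (N ^+ 2) h2 => N2 h2; lra.
Qed.

Lemma pt_diff u : pt Y u - pt Yt u = ((0, Y u - Yt u) : V).
Proof. by apply: pair_ext => //=; rewrite subrr. Qed.

Lemma pt_diff_incr u v :
  pt Y v - pt Y u - (pt Yt v - pt Yt u) = ((0, Y v - Y u - (Yt v - Yt u)) : V).
Proof. by apply: pair_ext => //=; rewrite subrr. Qed.

(** The two paths are compared at equal times, so the fourth vertex of the
    parallelogram is again at a time of [0, T]. *)
Lemma slab_shift u v : s <= u -> u <= v -> v <= t ->
  slab T (pt Y u + (pt Yt v - pt Yt u)).
Proof.
move=> su uv vt; split => //=; rewrite subrKC in_itv /=.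
by rewrite (le_trans s0 (le_trans su uv)) (le_trans vt tT).
Qed.

Lemma diff_gub_le l u v : s <= u -> u <= v -> v <= t ->
  `|gub f Df l (pt Y v) - gub f Df l (pt Y u)
    - (gub f Df l (pt Yt v) - gub f Df l (pt Yt u))| <= e6 * (dist0 * h u v).
Proof.
move=> su uv vt; have ut := le_trans uv vt; have sv := le_trans su uv.
apply: le_trans (gub_l2 hf l (slab_pt Y su ut) (slab_pt Y sv vt)
  (slab_pt Yt su ut) (slab_pt Yt sv vt) (slab_shift su uv vt)) _.
rewrite pt_diff_incr pt_diff !pair0_norm.
have h1 := diff_incr_le' su uv vt; have h2 := diff_sup_le su ut.
have h3 := pt_incr_le' hXt hRt su uv vt.
have /andP[H0 H1] := scale01 su uv vt; set H := h u v in h1 h3 H0 H1 *.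
have h4 := ler_pM (normr_ge0 _) (normr_ge0 _) h2 h3.
have h5 : e1 * dist0 * (e2 * (a * H)) <= e1 * dist0 * (e2 * H).
  apply: ler_wpM2l; first nng.
  by apply: ler_wpM2l; [exact: e2_ge0|rewrite ler_piMl].
have h6 := lerD h1 (le_trans h4 h5).
have := ler_wpM2l (mulr_ge0 (ler0n _ 5) (exprn_ge0 2 N0)) h6.
by move=> /le_trans; apply; rewrite /e6 le_eqVlt; apply/orP; left; apply/eqP; ring.
Qed.

Lemma diff_coef_le u v : s <= u -> u <= v -> v <= t ->
  `|f (pt Y v) - f (pt Y u) - (f (pt Yt v) - f (pt Yt u))| <= e9 * (dist0 * h u v).
Proof.
move=> su uv vt; have ut := le_trans uv vt; have sv := le_trans su uv.
apply: le_trans (coef_l2 hf (slab_pt Y su ut) (slab_pt Y sv vt)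
  (slab_pt Yt su ut) (slab_pt Yt sv vt) (slab_shift su uv vt)) _.
rewrite pt_diff_incr pt_diff !pair0_norm.
have h1 := diff_incr_le' su uv vt; have h2 := diff_sup_le su ut.
have h3 := pt_incr_le' hXt hRt su uv vt.
have /andP[H0 H1] := scale01 su uv vt; set H := h u v in h1 h3 H0 H1 *.
have h4 := ler_pM (normr_ge0 _) (normr_ge0 _) h2 h3.
have h5 : e1 * dist0 * (e2 * (a * H)) <= e1 * dist0 * (e2 * H).
  apply: ler_wpM2l; first nng.
  by apply: ler_wpM2l; [exact: e2_ge0|rewrite ler_piMl].
have h6 := lerD h1 (le_trans h4 h5).
have := ler_wpM2l N0 h6.
by move=> /le_trans; apply; rewrite /e9 le_eqVlt; apply/orP; left; apply/eqP; ring.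
Qed.

Lemma diff_taylor_le u v : s <= u -> u <= v -> v <= t ->
  `|taylor f Df (pt Y u) (pt Y v) - taylor f Df (pt Yt u) (pt Yt v)| <=
  e4 * (dist0 * h u v ^+ 2).
Proof.
move=> su uv vt; have ut := le_trans uv vt; have sv := le_trans su uv.
apply: le_trans (coef_tl hf (slab_pt Y su ut) (slab_pt Y sv vt)
  (slab_pt Yt su ut) (slab_pt Yt sv vt) (slab_shift su uv vt)) _.
rewrite pt_diff_incr pt_diff !pair0_norm.
have h1 := diff_incr_le' su uv vt; have h2 := diff_sup_le su ut.
have h3 := pt_incr_le' hXt hRt su uv vt; have h4 := pt_incr_le' hX hR su uv vt.
have /andP[H0 H1] := scale01 su uv vt; set H := h u v in h1 h3 h4 H0 H1 *.
have aH : a * H <= H by rewrite ler_piMl.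
have {}h3 : `|pt Yt v - pt Yt u| <= e2 * H.
  by apply: le_trans h3 _; rewrite ler_wpM2l ?e2_ge0.
have {}h4 : `|pt Y v - pt Y u| <= e2 * H.
  by apply: le_trans h4 _; rewrite ler_wpM2l ?e2_ge0.
have h5 : `|pt Yt v - pt Yt u| ^+ 2 <= (e2 * H) ^+ 2.
  by rewrite ler_pXn2r ?nnegrE ?mulr_ge0 ?e2_ge0.
have h6 := ler_pM (normr_ge0 _) (exprn_ge0 2 (normr_ge0 _)) h2 h5.
have h7 := ler_pM (normr_ge0 _) (addr_ge0 (normr_ge0 _) (normr_ge0 _)) h1 (lerD h4 h3).
have := ler_wpM2l N0 (lerD h6 h7).
by move=> /le_trans; apply; rewrite /e4 le_eqVlt; apply/orP; left; apply/eqP; ring.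
Qed.

Lemma diff_coef_rem_le u v : s <= u -> u <= v -> v <= t ->
  `|coef_rem f Df Y X u v - coef_rem f Df Yt Xt u v| <=
  e5 * (dist0 * h u v ^+ 2).
Proof.
move=> su uv vt; have ut := le_trans uv vt; rewrite !coef_remE.
have Du := slab_pt Y su ut; have Dut := slab_pt Yt su ut.
have t1 := diff_taylor_le su uv vt.
have [_ _ x3] := hX su uv vt.
have h2 := diff_sup_le su ut.
have k1 := coef_dl hf ((v - u, 0) : V) Du Dut.
have k2 := coef_dl hf ((0, path_rem X Y u v) : V) Du Dut.
have k3 := coef_db hf ((0, path_rem X Y u v - path_rem Xt Yt u v) : V) Dut.
rewrite pt_diff pair0_norm pair_time_norm ger0_norm ?subr_ge0 // in k1.
rewrite pt_diff !pair0_norm in k2; rewrite pair0_norm in k3.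
have h4 := hR su uv vt; have h5 := hdR su uv vt.
have /andP[H0 H1] := scale01 su uv vt; set H := h u v in t1 x3 h4 h5 H0 H1 *.
have H2 : 0 <= H ^+ 2 by exact: exprn_ge0.
have aH : a * H ^+ 2 <= H ^+ 2 by rewrite ler_piMl.
have g1 : N * `|Y u - Yt u| <= N * (e1 * dist0) by rewrite ler_wpM2l.
have uv0 : 0 <= v - u by rewrite subr_ge0.
have {}k1 := le_trans k1 (ler_pM (mulr_ge0 N0 (normr_ge0 _)) uv0 g1 (le_trans x3 aH)).
have {}k2 := le_trans k2 (ler_pM (mulr_ge0 N0 (normr_ge0 _)) (normr_ge0 _) g1 (le_trans h4 aH)).
have hQ : Q * H ^+ 2 <= dist0 * H ^+ 2.
  by rewrite ler_wpM2r // /dist0 lerDr addr_ge0.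
have {}k3 := le_trans k3 (ler_wpM2l N0 (le_trans h5 hQ)).
rewrite lin_sub in k3.
set t0 := taylor _ _ _ _ in t1 *; set t0' := taylor _ _ _ _ in t1 *.
have -> : t0 + Df (pt Y u) (v - u, 0) + Df (pt Y u) (0, path_rem X Y u v) -
   (t0' + Df (pt Yt u) (v - u, 0) + Df (pt Yt u) (0, path_rem Xt Yt u v)) =
   (t0 - t0') + (Df (pt Y u) (v - u, 0) - Df (pt Yt u) (v - u, 0)) +
   ((Df (pt Y u) (0, path_rem X Y u v) - Df (pt Yt u) (0, path_rem X Y u v)) +
   (Df (pt Yt u) (0, path_rem X Y u v) - Df (pt Yt u) (0, path_rem Xt Yt u v))) by zmod.
apply: le_trans (ler_normD _ _) _.
apply: le_trans (lerD (ler_normD _ _) (ler_normD _ _)) _.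
apply: le_trans (lerD (lerD t1 k1) (lerD k2 k3)) _.
by rewrite /e5 le_eqVlt; apply/orP; left; apply/eqP; ring.
Qed.

Hypothesis hchen : chen XX X.
Hypothesis hchent : chen XXt Xt.

Definition dgerm u v := germ f Df Y X XX u v - germ f Df Yt Xt XXt u v.

(** In the difference of two products either the second factor is an increment of the
    driver, of size a, and the first one a difference of solutions, or the second
    factor is a difference of drivers, of size del. *)
Lemma diff_germ_le u r v : s <= u -> u <= r -> r <= v -> v <= t ->
  `|dgerm u v - dgerm u r - dgerm r v| <=
  e8 * (a * dist0 + del) * h u v ^+ 3.
Proof.
move=> su ur rv vt; have rt := le_trans rv vt; have sr := le_trans su ur.
have -> : dgerm u v - dgerm u r - dgerm r v =
   (germ f Df Y X XX u v - germ f Df Y X XX u r - germ f Df Y X XX r v) -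
   (germ f Df Yt Xt XXt u v - germ f Df Yt Xt XXt u r - germ f Df Yt Xt XXt r v).
  by rewrite /dgerm; zmod.
rewrite (germ_defect f Df Y (hchen su ur rv vt)).
rewrite (germ_defect f Df Yt (hchent su ur rv vt)).
have E (A1 A2 B1 B2 : 'cV[R]_n) : - (A1 + A2) - - (B1 + B2) = - ((A1 - B1) + (A2 - B2)).
  by zmod.
rewrite E normrN diff_mulmx; move: E => _.
have -> : second_incr f Df Y XX u r v - second_incr f Df Yt XXt u r v =
  \sum_(l < d) (gub f Df l (pt Y r) - gub f Df l (pt Y u)
     - (gub f Df l (pt Yt r) - gub f Df l (pt Yt u))) *m (row l (XX r v))^T +
  \sum_(l < d) (gub f Df l (pt Yt r) - gub f Df l (pt Yt u)) *m
     (row l (XX r v - XXt r v))^T.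
  rewrite /second_incr -sumrB -big_split /=; apply: eq_bigr => l _.
  by rewrite diff_mulmx trmx_row_sub.
have [q1 q2 q3 q4 q5] := hh su ur rv vt.
have [x1 x2 _] := hX sr rv vt.
have H0 := le_trans q1 q3.
have aa : 0 <= a + a by rewrite addr_ge0.
have m1 := mulmx_le (diff_coef_rem_le su ur rt) x1.
have m2 := mulmx_le (coef_rem_le a01 a0 hXt hRt su ur rt) (hdX sr rv vt).
have m3 := sum_mulmx_le (mulr_ge0 e6_ge0 (mulr_ge0 S0 q1))
   (fun l => diff_gub_le l su ur rt) x2.
have g7 l : `|gub f Df l (pt Yt r) - gub f Df l (pt Yt u)| <= e7 * h u r.
  apply: le_trans (gub_l hf l (slab_pt Yt sr rt) (slab_pt Yt su (le_trans ur rt))) _.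
  have := pt_incr_le' hXt hRt su ur rt => k.
  rewrite (_ : e7 * h u r = 5 * N ^+ 2 * (e2 * h u r)); last by rewrite /e7; ring.
  apply: ler_wpM2l; first nng.
  apply: le_trans k _; rewrite ler_wpM2l ?e2_ge0 // ler_piMl //.
have m4 := sum_mulmx_le (mulr_ge0 e7_ge0 q1) g7 (hdXX sr rv vt).
apply: le_trans (ler_normD _ _) _.
apply: le_trans (lerD (ler_normD _ _) (ler_normD _ _)) _.
apply: le_trans (lerD (lerD m1 m2) (lerD m3 m4)) _.
set H := h u v in q3 q4 q5 H0 *.
have b1 : h u r ^+ 2 * h r v <= H ^+ 3.
  by rewrite [H ^+ 3]exprSr; apply: ler_pM; rewrite ?exprn_ge0 // ler_pXn2r ?nnegrE.
have b2 : h u r * h r v ^+ 2 <= H ^+ 3.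
  by rewrite [H ^+ 3]exprS; apply: ler_pM; rewrite ?exprn_ge0 // ler_pXn2r ?nnegrE.
have H3 : 0 <= H ^+ 3 by exact: exprn_ge0.
have k1 : 0 <= N * e5 * (a * dist0).
  exact: mulr_ge0 (mulr_ge0 N0 e5_ge0) (mulr_ge0 a0 S0).
have k2 : 0 <= N * c1 * ((a + a) * del).
  exact: mulr_ge0 (mulr_ge0 N0 c1_ge0) (mulr_ge0 aa del0).
have k3 : 0 <= N ^+ 2 * e6 * (a * dist0).
  exact: mulr_ge0 (mulr_ge0 (exprn_ge0 2 N0) e6_ge0) (mulr_ge0 a0 S0).
have k4 : 0 <= N ^+ 2 * e7 * del.
  exact: mulr_ge0 (mulr_ge0 (exprn_ge0 2 N0) e7_ge0) del0.
have w1 := ler_wpM2l k1 b1; have w2 := ler_wpM2l k2 b1.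
have w3 := ler_wpM2l k3 b2; have w4 := ler_wpM2l k4 b2.
have w5 : N * c1 * ((a + a) * del) * H ^+ 3 <= 2 * N * c1 * del * H ^+ 3.
  apply: ler_wpM2r => //.
  have -> : N * c1 * ((a + a) * del) = a * (2 * N * c1 * del) by ring.
  by rewrite ler_piMl //; nng.
have v1 : 0 <= (2 * N * c1 * (a * dist0)) * H ^+ 3.
  apply: mulr_ge0 => //; apply: mulr_ge0 (mulr_ge0 a0 S0).
  nng.
have v2 : 0 <= (N ^+ 2 * e7 * (a * dist0)) * H ^+ 3.
  by apply: mulr_ge0 => //; exact: mulr_ge0 (mulr_ge0 (exprn_ge0 2 N0) e7_ge0) (mulr_ge0 a0 S0).
have v3 : 0 <= (N * e5 * del) * H ^+ 3.
  by apply: mulr_ge0 => //; exact: mulr_ge0 (mulr_ge0 N0 e5_ge0) del0.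
have v4 : 0 <= (N ^+ 2 * e6 * del) * H ^+ 3.
  by apply: mulr_ge0 => //; exact: mulr_ge0 (mulr_ge0 (exprn_ge0 2 N0) e6_ge0) del0.
rewrite /e8; move: (dist0) w1 w2 w3 w4 w5 v1 v2 v3 v4 => S w1 w2 w3 w4 w5 v1 v2 v3 v4.
lra.
Qed.

Variables B Bt : R -> 'cV[R]_n.
Hypothesis hB : forall D : R, 0 <= D ->
  (forall u, s <= u -> u <= t -> `|Y u - Yt u| <= D) ->
  forall u v, s <= u -> u <= v -> v <= t ->
  `|B v - B u - (Bt v - Bt u)| <= N * D * (v - u) + del * h u v ^+ 2.
Hypothesis hS : forall rho, 0 <= rho ->
  (forall u r v, s <= u -> u <= r -> r <= v -> v <= t ->
  `|dgerm u v - dgerm u r - dgerm r v| <= rho * h u v ^+ 3) ->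
  forall u v, s <= u -> u <= v -> v <= t ->
  `|Y v - Y u - (B v - B u) - (Yt v - Yt u - (Bt v - Bt u)) - dgerm u v| <=
    K * rho * h u v ^+ 3.

(** As in the a priori estimate, the sewing error and the second-order terms carry a
    factor a or del, and so does the difference of the drifts. *)
Lemma diff_rem_le u v : s <= u -> u <= v -> v <= t ->
  `|path_rem X Y u v - path_rem Xt Yt u v| <= cB * (a * dist0 + del) * h u v ^+ 2.
Proof.
move=> su uv vt; have ut := le_trans uv vt.
have as0 : 0 <= a * dist0 + del by rewrite addr_ge0 // mulr_ge0.
have rho0 : 0 <= e8 * (a * dist0 + del) by nng.
have t1 := hS rho0 diff_germ_le su uv vt.
have D0 : 0 <= e1 * dist0 by nng.
have t3 := hB D0 diff_sup_le su uv vt.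
have Du := slab_pt Y su ut; have Dut := slab_pt Yt su ut.
have [x1 x2 x3] := hX su uv vt.
have g1 l : `|gub f Df l (pt Y u) - gub f Df l (pt Yt u)| <= 5 * N ^+ 2 * (e1 * dist0).
  apply: le_trans (gub_l hf l Du Dut) _; rewrite pt_diff pair0_norm.
  by rewrite ler_wpM2l ?diff_sup_le // mulr_ge0 // exprn_ge0.
have g0 : 0 <= 5 * N ^+ 2 * (e1 * dist0) by apply: mulr_ge0 D0; rewrite mulr_ge0 // exprn_ge0.
have t2 := sum_mulmx_le g0 g1 x2.
have t4 := sum_mulmx_le (exprn_ge0 2 N0) (fun l => gub_b hf l Dut) (hdXX su uv vt).
have -> : path_rem X Y u v - path_rem Xt Yt u v =
  (Y v - Y u - (B v - B u) - (Yt v - Yt u - (Bt v - Bt u)) - dgerm u v) +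
  (\sum_(l < d) (gub f Df l (pt Y u) - gub f Df l (pt Yt u)) *m (row l (XX u v))^T +
  \sum_(l < d) gub f Df l (pt Yt u) *m (row l (XX u v - XXt u v))^T) +
  (B v - B u - (Bt v - Bt u)).
  have -> : \sum_(l < d) (gub f Df l (pt Y u) - gub f Df l (pt Yt u)) *m (row l (XX u v))^T +
    \sum_(l < d) gub f Df l (pt Yt u) *m (row l (XX u v - XXt u v))^T =
    \sum_(l < d) gub f Df l (pt Y u) *m (row l (XX u v))^T -
    \sum_(l < d) gub f Df l (pt Yt u) *m (row l (XXt u v))^T.
    rewrite -sumrB -big_split /=; apply: eq_bigr => l _.
    by rewrite diff_mulmx trmx_row_sub.
  by rewrite /path_rem /dgerm /germ; zmod.
apply: le_trans (ler_normD _ _) _; apply: le_trans (lerD (ler_normD _ _) t3) _.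
apply: le_trans (lerD (lerD t1 (ler_normD _ _)) (lexx _)) _.
apply: le_trans (lerD (lerD (lexx _) (lerD t2 t4)) (lexx _)) _.
have /andP[H0 H1] := scale01 su uv vt; set H := h u v in x3 H0 H1 *.
have H2 : 0 <= H ^+ 2 by exact: exprn_ge0.
have H3 : H ^+ 3 <= H ^+ 2 by rewrite exprS ler_piMl.
have b1 := ler_wpM2l (mulr_ge0 K0 rho0) H3.
have b2 := ler_wpM2l (mulr_ge0 N0 D0) x3.
have e1p := e1_ge0.
have v1 : 0 <= 5 * N ^+ 4 * e1 * del * H ^+ 2 by nng.
have v2 : 0 <= N ^+ 4 * (a * dist0) * H ^+ 2 by nng.
have v3 : 0 <= N * e1 * del * H ^+ 2 by nng.
have v4 : 0 <= a * dist0 * H ^+ 2 by nng.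
apply: le_trans (lerD (lerD b1 (lexx _)) (lerD b2 (lexx _))) _.
rewrite /cB.
have -> : N * (N * (5 * N ^+ 2 * (e1 * dist0) * (a * H ^+ 2))) =
  5 * N ^+ 4 * e1 * (a * dist0) * H ^+ 2 by ring.
have -> : N * (N * (N ^+ 2 * (del * H ^+ 2))) = N ^+ 4 * del * H ^+ 2 by ring.
move: (N ^+ 4) (H ^+ 2) v1 v2 v3 v4 (e8) => N4 HH v1 v2 v3 v4 E8; lra.
Qed.

End Difference.

End LocalBounds.

(** * Several variations dominated by one control *)

Section AverageControl.
Context {R : realType}.
Implicit Types (ws : seq (R -> R -> R)) (s t u v p q : R).

(** The average of normalised controls is normalised, and dominates each of them up to
    a factor, their number. *)
Definition wavg ws u v : R := (size ws)%:R^-1 * \sum_(w <- ws) w u v.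

Fixpoint unit_controls s t ws : Prop :=
  if ws is w :: ws' then [/\ control s t w, w s t <= 1 & unit_controls s t ws']
  else True.

Lemma sum_controls s t ws : unit_controls s t ws ->
  control s t (fun u v => \sum_(w <- ws) w u v) /\
  \sum_(w <- ws) w s t <= (size ws)%:R.
Proof.
elim: ws => [_|w ws IH /= [cw w1 /IH[c1 c2]]].
  split; last by rewrite big_nil.
  by under eq_fun do under eq_fun do rewrite big_nil; exact: control0.
split; last by rewrite big_cons -natr1 addrC lerD.
by under eq_fun do under eq_fun do rewrite big_cons; exact: controlD.
Qed.

Lemma wavg_control s t ws : unit_controls s t ws -> control s t (wavg ws).
Proof. by move=> /sum_controls[h _]; apply: controlZ. Qed.

Lemma wavg_le1 s t ws : unit_controls s t ws -> wavg ws s t <= 1.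
Proof.
case: ws => [_|w ws hw]; first by rewrite /wavg big_nil mulr0.
have [_ h] := sum_controls hw.
by rewrite /wavg mulrC ler_pdivrMr ?mul1r // ltr0n.
Qed.

Lemma nth_wavg s t ws k u v : unit_controls s t ws -> (k < size ws)%N ->
  s <= u -> u <= v -> v <= t ->
  nth (fun _ _ => 0) ws k u v <= (size ws)%:R * wavg ws u v.
Proof.
move=> hw kl su uv vt; have s0 : (0 < size ws)%N by case: (size ws) kl.
rewrite /wavg mulrA divff ?pnatr_eq0 -?lt0n // mul1r.
elim: ws k hw kl {s0} => // w ws IH k /= [cw w1 hw] kl; rewrite big_cons.
have [c0 _] := sum_controls hw.
have h0 := control_ge0 c0 su uv vt; have h1 := control_ge0 cw su uv vt.
case: k kl => [|k] /= kl; first by rewrite lerDl.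
by apply: le_trans (IH k hw kl) _; rewrite lerDr.
Qed.

Lemma nth_control s t ws k : unit_controls s t ws -> (k < size ws)%N ->
  control s t (nth (fun _ _ => 0) ws k).
Proof. by elim: ws k => // w ws IH [|k] /= [cw _ hw] kl //; exact: IH. Qed.

Lemma nth_wavg_powR s t ws k u v q : unit_controls s t ws -> (k < size ws)%N ->
  s <= u -> u <= v -> v <= t -> 0 <= q <= 1 ->
  nth (fun _ _ => 0) ws k u v `^ q <= (size ws)%:R * wavg ws u v `^ q.
Proof.
move=> hw kl su uv vt /andP[q0 q1].
have h0 := control_ge0 (nth_control hw kl) su uv vt.
have h1 := control_ge0 (wavg_control hw) su uv vt.
have m1 : 1 <= (size ws)%:R :> R by rewrite ler1n; case: (size ws) kl.
have := @ge0_ler_powR _ q q0 _ _ _ _ (nth_wavg hw kl su uv vt).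
rewrite !nnegrE h0 mulr_ge0 // => /(_ isT isT) /le_trans; apply.
by rewrite powRM // ler_wpM2r ?powR_ge0 // ler1_powR.
Qed.

Definition wscale p ws u v : R := wavg ws u v `^ p^-1.

Lemma wscale_scale p s t ws : 0 < p -> unit_controls s t ws ->
  scale s t (wscale p ws).
Proof.
move=> p0 hw u r v su ur rv vt; have cw := wavg_control hw.
have uv := le_trans ur rv; have rt := le_trans rv vt; have sr := le_trans su ur.
have pp : 0 <= p^-1 by rewrite invr_ge0 ltW.
have st : s <= t by exact: le_trans su (le_trans uv vt).
have mono x y x' y' : s <= x -> x <= x' -> x' <= y' -> y' <= y -> y <= t ->
    wscale p ws x' y' <= wscale p ws x y.
  move=> sx xx xy yy yt; apply: ge0_ler_powR => //; rewrite ?nnegrE.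
  - by apply: (control_ge0 cw) => //; [exact: le_trans xx|exact: le_trans yt].
  - by apply: (control_ge0 cw) => //; exact: le_trans xx (le_trans xy yy).
  - exact: (control_mono cw).
split; rewrite ?powR_ge0 //; try by apply: mono.
apply: le_trans (mono s t u v _ _ _ _ _) _ => //.
rewrite /wscale; apply: (@le_trans _ _ (1 `^ p^-1)); last by rewrite powR1.
apply: ge0_ler_powR => //; rewrite ?nnegrE ?ler01 ?(control_ge0 cw) //.
exact: wavg_le1.
Qed.

Lemma wscale2 p s t ws u v : 0 < p -> unit_controls s t ws ->
  wscale p ws u v ^+ 2 = wavg ws u v `^ (p / 2)^-1.
Proof.
move=> p0 hw; rewrite -powR_mulrn ?powR_ge0 // -powRrM; congr (_ `^ _).
by rewrite invf_div mulrC.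
Qed.

Lemma wscale3 p ws u v : 0 < p ->
  wscale p ws u v ^+ 3 = wavg ws u v `^ (3 / p).
Proof. by move=> p0; rewrite -powR_mulrn ?powR_ge0 // -powRrM mulrC. Qed.

End AverageControl.

(** * Estimates on an interval of small driver *)

Section LocalEstimates.
Context {R : realType} (n d : nat) (p T : R).
Local Notation V := (R^o * 'cV[R]_n)%type.
Local Notation W := 'M[R]_(n, d).
Variables (f : V -> W) (Df : V -> {linear V -> W}) (N : R).
Hypothesis hp : 2 <= p < 3.
Hypothesis hf : coef_bounds (slab T) N f Df.
Hypothesis dN : d%:R <= N.

Let K : R := sewing_const (3 / p).

Let p0 : 0 < p. Proof. by case/andP: hp => h _; apply: lt_le_trans h. Qed.
Let th1 : 1 < 3 / p.
Proof. by case/andP: hp => _ h; rewrite ltr_pdivlMr // mul1r. Qed.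
Let K1 : 1 <= K. Proof. exact: sewing_const_ge1. Qed.

Implicit Types (X : R -> 'cV[R]_d) (XX : R -> R -> 'M[R]_d) (Y B : R -> 'cV[R]_n).

(** Y solves the equation driven by (X, XX) with the drift already integrated
    to B. *)
Definition solves X XX Y B :=
  [/\ chen 0 T XX X,
      forall u v, 0 <= u -> u <= v -> v <= T -> `|B v - B u| <= N * (v - u) &
      exists y, forall t, 0 <= t -> t <= T ->
        gsum (germ f Df Y X XX) 0 pi @[pi --> mesh_to0 0 t] --> Y t - y - B t].

Lemma solves_sewing X XX Y B s t w : solves X XX Y B ->
  0 <= s -> t <= T -> control s t w ->
  forall rho, 0 <= rho ->
  (forall u r v, s <= u -> u <= r -> r <= v -> v <= t ->
  `|germ f Df Y X XX u v - germ f Df Y X XX u r - germ f Df Y X XX r v| <=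
    rho * w u v `^ (3 / p)) ->
  forall u v, s <= u -> u <= v -> v <= t ->
  `|Y v - Y u - (B v - B u) - germ f Df Y X XX u v| <= K * rho * w u v `^ (3 / p).
Proof.
move=> [_ _ [y hy]] s0 tT cw rho rho0 hd u v su uv vt.
have u0 := le_trans s0 su; have vT := le_trans vt tT.
have e : Y v - Y u - (B v - B u) = (Y v - y - B v) - (Y u - y - B u) by zmod.
rewrite e; apply: (limit_increment u0 uv (hy u u0 (le_trans uv vT))
  (hy v (le_trans u0 uv) vT)) => pi hpi.
apply: (sewing_sum th1 rho0 _ _ hpi); first exact: control_sub cw.
move=> x r z ux xr rz zv; apply: hd => //; [exact: le_trans ux|exact: le_trans vt].
Qed.

Lemma solves_diff_sewing X XX Y B Xt XXt Yt Bt s t w :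
  solves X XX Y B -> solves Xt XXt Yt Bt ->
  0 <= s -> t <= T -> control s t w ->
  forall rho, 0 <= rho ->
  (forall u r v, s <= u -> u <= r -> r <= v -> v <= t ->
  `|dgerm f Df X Xt XX XXt Y Yt u v - dgerm f Df X Xt XX XXt Y Yt u r -
    dgerm f Df X Xt XX XXt Y Yt r v| <= rho * w u v `^ (3 / p)) ->
  forall u v, s <= u -> u <= v -> v <= t ->
  `|Y v - Y u - (B v - B u) - (Yt v - Yt u - (Bt v - Bt u)) -
    dgerm f Df X Xt XX XXt Y Yt u v| <= K * rho * w u v `^ (3 / p).
Proof.
move=> [_ _ [y hy]] [_ _ [yt hyt]] s0 tT cw rho rho0 hd u v su uv vt.
have u0 := le_trans s0 su; have vT := le_trans vt tT.
have e : Y v - Y u - (B v - B u) - (Yt v - Yt u - (Bt v - Bt u)) =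
  ((Y v - y - B v) - (Yt v - yt - Bt v)) - ((Y u - y - B u) - (Yt u - yt - Bt u)).
  by zmod.
have hlim x : 0 <= x -> x <= T ->
    gsum (dgerm f Df X Xt XX XXt Y Yt) 0 pi @[pi --> mesh_to0 0 x] -->
    (Y x - y - B x) - (Yt x - yt - Bt x).
  move=> x0 xT; have -> : gsum (dgerm f Df X Xt XX XXt Y Yt) 0 =
      gsum (germ f Df Y X XX) 0 \- gsum (germ f Df Yt Xt XXt) 0.
    by apply/funext => pi; rewrite /gsum /dgerm sumrB.
  by apply: cvgB; [exact: hy|exact: hyt].
rewrite e; apply: (limit_increment u0 uv (hlim u u0 (le_trans uv vT))
  (hlim v (le_trans u0 uv) vT)) => pi hpi.
apply: (sewing_sum th1 rho0 _ _ hpi); first exact: control_sub cw.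
move=> x r z ux xr rz zv; apply: hd => //; [exact: le_trans ux|exact: le_trans vt].
Qed.

Lemma chen_diag XX X u : chen 0 T XX X -> 0 <= u -> u <= T -> XX u u = 0.
Proof.
move=> h u0 uT; have := h u u u u0 (lexx _) (lexx _) uT.
rewrite subrr mul0mx addr0 => e.
by apply: (addrI (XX u u)); rewrite -e addr0.
Qed.

Let p1 : 0 <= p^-1 <= 1.
Proof.
rewrite invr_ge0 ltW // invf_le1 //; case/andP: hp => h _; lra.
Qed.
Let p20 : 0 < p / 2. Proof. by rewrite divr_gt0. Qed.
Let p2 : 0 <= (p / 2)^-1 <= 1.
Proof.
by rewrite invr_ge0 ltW // invf_le1 // ler_pdivlMr //; case/andP: hp => h _; lra.
Qed.

Lemma time_control s t a : s <= t -> 0 < a -> t - s <= a -> exists w,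
  [/\ control s t w, w s t <= 1 &
   forall u v, s <= u -> u <= v -> v <= t -> v - u <= a * w u v `^ (p / 2)^-1].
Proof.
move=> st a0 ha; exists (fun u v => a^-1 * (v - u)).
have h1 : a^-1 * (t - s) <= 1 by rewrite ler_pdivrMl // mulr1.
have cw : control s t (fun u v => a^-1 * (v - u)).
  apply: controlZ; first by rewrite invr_ge0 ltW.
  split=> [u v _ uv _|u r v _ _ _ _]; first by rewrite subr_ge0.
  by rewrite addrC subrKA.
split=> // u v su uv vt.
have h0 := control_ge0 cw su uv vt.
have h2 := le_trans (control_mono cw (lexx s) su uv vt (lexx t)) h1.
rewrite -ler_pdivrMl // .
move: h0 h2; set x := a^-1 * _ => x0 x1.
move: x0; rewrite le_eqVlt => /predU1P[<-|x0]; first exact: powR_ge0.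
by apply: ger1_powR; [rewrite x0|case/andP: p2].
Qed.

Lemma nth_le1 ws s t k a (E : normedModType R) (A : R -> R -> E) :
  unit_controls s t ws -> (k < size ws)%N -> 0 <= a ->
  (forall u v, s <= u -> u <= v -> v <= t ->
    `|A u v| <= a * nth (fun _ _ => 0) ws k u v `^ p^-1) ->
  forall u v, s <= u -> u <= v -> v <= t ->
    `|A u v| <= (size ws)%:R * a * wscale p ws u v.
Proof.
move=> hw kl a0 h u v su uv vt; apply: le_trans (h u v su uv vt) _.
rewrite [_%:R * a]mulrC -mulrA ler_wpM2l //; exact: (nth_wavg_powR hw).
Qed.

Lemma nth_le2 ws s t k a (E : normedModType R) (A : R -> R -> E) :
  unit_controls s t ws -> (k < size ws)%N -> 0 <= a ->
  (forall u v, s <= u -> u <= v -> v <= t ->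
    `|A u v| <= a * nth (fun _ _ => 0) ws k u v `^ (p / 2)^-1) ->
  forall u v, s <= u -> u <= v -> v <= t ->
    `|A u v| <= (size ws)%:R * a * wscale p ws u v ^+ 2.
Proof.
move=> hw kl a0 h u v su uv vt; apply: le_trans (h u v su uv vt) _.
rewrite (wscale2 u v p0 hw) [_%:R * a]mulrC -mulrA ler_wpM2l //.
exact: (nth_wavg_powR hw).
Qed.

Lemma local_a_priori X XX Y B s t a Q : solves X XX Y B ->
  0 <= s -> s <= t -> t <= T -> 0 < a -> 4 * a <= 1 -> 0 <= Q ->
  (pvar p X s t <= a%:E)%E -> (pvar2 (p / 2) XX s t <= a%:E)%E -> t - s <= a ->
  (pvar2 (p / 2) (path_rem f X Y) s t <= Q%:E)%E ->
  (pvar2 (p / 2) (path_rem f X Y) s t <= (cA N K * (4 * a * (1 + 4 * Q)))%:E)%E.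
Proof.
move=> hsol s0 st tT a0 a4 Q0 hX hXX hts hR.
have [hch hBl _] := hsol.
have a0' := ltW a0.
have [w1 [cw1 b1 k1]] := pvar2_control p0 a0' (fun u _ => subrr (X u)) hX.
have XXd u : s <= u <= t -> XX u u = 0.
  by move=> /andP[su ut]; apply: (chen_diag hch); [exact: le_trans su|exact: le_trans tT].
have [w2 [cw2 b2 k2]] := pvar2_control p20 a0' XXd hXX.
have [w3 [cw3 b3 k3]] := time_control st a0 hts.
have remd u : s <= u <= t -> path_rem f X Y u u = 0.
  by move=> _; rewrite /path_rem !subrr mulmx0 subrr.
have [w4 [cw4 b4 k4]] := pvar2_control p20 Q0 remd hR.
pose ws := [:: w1; w2; w3; w4].
have hw : unit_controls s t ws by [].
have hs := wscale_scale p0 hw.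
have k1' := @nth_le1 ws s t 0 a _ _ hw isT a0' k1.
have k2' := @nth_le2 ws s t 1 a _ _ hw isT a0' k2.
have k3' := @nth_le2 ws s t 2 a R^o (fun u v => v - u) hw isT a0'.
have k4' := @nth_le2 ws s t 3 Q _ _ hw isT Q0 k4.
have hd : driver_le s t (wscale p ws) (4 * a) X XX.
  move=> u v su uv vt; split; [exact: k1'|exact: k2'|].
  apply: le_trans (ler_norm _) _; apply: k3' => // x y sx xy yt.
  by rewrite ger0_norm ?subr_ge0 //; exact: k3.
have hch' : chen s t XX X.
  move=> u r v su ur rv vt; apply: hch => //; [exact: le_trans su|exact: le_trans tT].
have hB u v : s <= u -> u <= v -> v <= t -> `|B v - B u| <= N * (v - u).
  by move=> su uv vt; apply: hBl => //; [exact: le_trans su|exact: le_trans tT].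
have a01 : 0 <= 4 * a <= 1 by rewrite a4 mulr_ge0.
have Q4 : 0 <= 4 * Q by rewrite mulr_ge0.
have C0 : 0 <= cA N K * (4 * a * (1 + 4 * Q)).
  apply: mulr_ge0; first exact: cA_ge0 hf K1.
  by apply: mulr_ge0; [case/andP: a01|rewrite addr_ge0].
apply: (pvar2_le p20 C0 st (wavg_control hw) (wavg_le1 hw)) => u v su uv vt.
rewrite -(wscale2 u v p0 hw).
apply: (a_priori hf dN K1 s0 tT hs a01 Q4 hd k4' hch' hB) => // rho rho0 h x y sx xy yt.
rewrite wscale3 //; apply: (solves_sewing hsol s0 tT (wavg_control hw) rho0) => //.
by move=> x' r' y' h1 h2 h3 h4; rewrite -wscale3 //; exact: h.
Qed.

(** The difference of the integrated drifts is that of the solutions times the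
    length, plus del times a control: the shape of an error due to the controls
    of the two equations. *)
Definition drift_diff_le s t (del : R) Y Yt B Bt := exists w,
  [/\ control s t w, w s t <= 1 &
   forall D : R, 0 <= D -> (forall u, s <= u -> u <= t -> `|Y u - Yt u| <= D) ->
   forall u v, s <= u -> u <= v -> v <= t ->
   `|B v - B u - (Bt v - Bt u)| <= N * D * (v - u) + del * w u v `^ (p / 2)^-1].

Definition dR X Xt Y Yt u v := path_rem f X Y u v - path_rem f Xt Yt u v.

Lemma local_diff X XX Y B Xt XXt Yt Bt s t a del Q :
  solves X XX Y B -> solves Xt XXt Yt Bt ->
  0 <= s -> s <= t -> t <= T -> 0 < a -> 11 * a <= 1 -> 0 <= del -> 0 <= Q ->
  (pvar p X s t <= a%:E)%E -> (pvar2 (p / 2) XX s t <= a%:E)%E -> t - s <= a ->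
  (pvar p Xt s t <= a%:E)%E -> (pvar2 (p / 2) XXt s t <= a%:E)%E ->
  (pvar2 (p / 2) (path_rem f X Y) s t <= a%:E)%E ->
  (pvar2 (p / 2) (path_rem f Xt Yt) s t <= a%:E)%E ->
  (pvar p (fun u => X u - Xt u)%R s t <= del%:E)%E ->
  (pvar2 (p / 2) (fun u v => XX u v - XXt u v)%R s t <= del%:E)%E ->
  drift_diff_le s t del Y Yt B Bt ->
  (pvar2 (p / 2) (dR X Xt Y Yt) s t <= Q%:E)%E ->
  let S := (`|Y s - Yt s| + 11 * del + 11 * Q)%R in
  [/\ (pvar2 (p / 2) (dR X Xt Y Yt) s t <=
         (cB N K * (11 * a * S + 11 * del))%:E)%E,
      (pvar p (fun u => f (pt Y u) - f (pt Yt u))%R s t <= (e9 N * S)%:E)%E &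
      forall u, s <= u -> u <= t -> `|Y u - Yt u| <= e1 N * S].
Proof.
move=> hsol hsolt s0 st tT a0 a11 del0 Q0 hX hXX hts hXt hXXt hR hRt hdX hdXX
  [w11 [cw11 b11 k11]] hdR S.
have [hch _ _] := hsol; have [hcht _ _] := hsolt.
have a0' := ltW a0.
have diag XX0 X0 u : chen 0 T XX0 X0 -> s <= u <= t -> XX0 u u = 0.
  by move=> h /andP[su ut]; apply: (chen_diag h); [exact: le_trans su|exact: le_trans tT].
have remd X0 Y0 u : s <= u <= t -> path_rem f X0 Y0 u u = 0.
  by move=> _; rewrite /path_rem !subrr mulmx0 subrr.
have [w1 [cw1 b1 k1]] := pvar2_control p0 a0' (fun u _ => subrr (X u)) hX.
have [w2 [cw2 b2 k2]] := pvar2_control p20 a0' (fun u => diag _ _ u hch) hXX.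
have [w3 [cw3 b3 k3]] := time_control st a0 hts.
have [w4 [cw4 b4 k4]] := pvar2_control p0 a0' (fun u _ => subrr (Xt u)) hXt.
have [w5 [cw5 b5 k5]] := pvar2_control p20 a0' (fun u => diag _ _ u hcht) hXXt.
have [w6 [cw6 b6 k6]] := pvar2_control p20 a0' (remd X Y) hR.
have [w7 [cw7 b7 k7]] := pvar2_control p20 a0' (remd Xt Yt) hRt.
have [w8 [cw8 b8 k8]] := pvar2_control p0 del0 (fun u _ => subrr (X u - Xt u)) hdX.
have dd u : s <= u <= t -> XX u u - XXt u u = 0.
  by move=> h; rewrite (diag _ _ _ hch h) (diag _ _ _ hcht h) subrr.
have [w9 [cw9 b9 k9]] := pvar2_control p20 del0 dd hdXX.
have ddR u : s <= u <= t -> dR X Xt Y Yt u u = 0.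
  by move=> h; rewrite /dR !remd // subrr.
have [w10 [cw10 b10 k10]] := pvar2_control p20 Q0 ddR hdR.
pose ws := [:: w1; w2; w3; w4; w5; w6; w7; w8; w9; w10; w11].
have hw : unit_controls s t ws by [].
have hs := wscale_scale p0 hw.
have k1' := @nth_le1 ws s t 0 a _ _ hw isT a0' k1.
have k2' := @nth_le2 ws s t 1 a _ _ hw isT a0' k2.
have k3' := @nth_le2 ws s t 2 a R^o (fun u v => v - u) hw isT a0'.
have k4' := @nth_le1 ws s t 3 a _ _ hw isT a0' k4.
have k5' := @nth_le2 ws s t 4 a _ _ hw isT a0' k5.
have k6' := @nth_le2 ws s t 5 a _ _ hw isT a0' k6.
have k7' := @nth_le2 ws s t 6 a _ _ hw isT a0' k7.
have k8' := @nth_le1 ws s t 7 del _ _ hw isT del0 k8.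
have k9' := @nth_le2 ws s t 8 del _ _ hw isT del0 k9.
have k10' := @nth_le2 ws s t 9 Q _ _ hw isT Q0 k10.
have ht u v : s <= u -> u <= v -> v <= t ->
    v - u <= 11 * a * wscale p ws u v ^+ 2.
  move=> su uv vt; apply: le_trans (ler_norm _) _; apply: k3' => // x y sx xy yt.
  by rewrite ger0_norm ?subr_ge0 //; exact: k3.
have hd : driver_le s t (wscale p ws) (11 * a) X XX.
  by move=> u v su uv vt; split; [exact: k1'|exact: k2'|exact: ht].
have hdt : driver_le s t (wscale p ws) (11 * a) Xt XXt.
  by move=> u v su uv vt; split; [exact: k4'|exact: k5'|exact: ht].
have sub XX0 X0 : chen 0 T XX0 X0 -> chen s t XX0 X0.
  move=> h u r v su ur rv vt; apply: h => //; [exact: le_trans su|exact: le_trans tT].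
have a01 : 0 <= 11 * a <= 1 by rewrite a11 mulr_ge0.
have d11 : 0 <= 11 * del by rewrite mulr_ge0.
have Q11 : 0 <= 11 * Q by rewrite mulr_ge0.
have k8'' u v : s <= u -> u <= v -> v <= t ->
    `|X v - X u - (Xt v - Xt u)| <= 11 * del * wscale p ws u v.
  move=> su uv vt; have := k8' u v su uv vt.
  by have -> : X v - Xt v - (X u - Xt u) = X v - X u - (Xt v - Xt u) by zmod.
have hB (D : R) : 0 <= D -> (forall u, s <= u -> u <= t -> `|Y u - Yt u| <= D) ->
   forall u v, s <= u -> u <= v -> v <= t ->
   `|B v - B u - (Bt v - Bt u)| <= N * D * (v - u) + 11 * del * wscale p ws u v ^+ 2.
  move=> D0 hD u v su uv vt; apply: le_trans (k11 D D0 hD u v su uv vt) _.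
  rewrite lerD2l (wscale2 u v p0 hw) [11 * del]mulrC -mulrA ler_wpM2l //.
  exact: (@nth_wavg_powR _ s t ws 10 u v (p / 2)^-1 hw isT su uv vt p2).
have S0 : 0 <= S by rewrite /S !addr_ge0.
have C0 : 0 <= cB N K * (11 * a * S + 11 * del).
  apply: mulr_ge0; first exact: cB_ge0 hf K1.
  by apply: addr_ge0 => //; apply: mulr_ge0 => //; case/andP: a01.
have hdS rho : 0 <= rho ->
  (forall u r v, s <= u -> u <= r -> r <= v -> v <= t ->
  `|dgerm f Df X Xt XX XXt Y Yt u v - dgerm f Df X Xt XX XXt Y Yt u r -
    dgerm f Df X Xt XX XXt Y Yt r v| <= rho * wscale p ws u v ^+ 3) ->
  forall u v, s <= u -> u <= v -> v <= t ->
  `|Y v - Y u - (B v - B u) - (Yt v - Yt u - (Bt v - Bt u)) -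
    dgerm f Df X Xt XX XXt Y Yt u v| <= K * rho * wscale p ws u v ^+ 3.
  move=> rho0 h u v su uv vt; rewrite wscale3 //.
  apply: (solves_diff_sewing hsol hsolt s0 tT (wavg_control hw) rho0) => //.
  by move=> x' r' y' h1 h2 h3 h4; rewrite -wscale3 //; exact: h.
split.
- apply: (pvar2_le p20 C0 st (wavg_control hw) (wavg_le1 hw)) => u v su uv vt.
  rewrite -(wscale2 u v p0 hw).
  exact: (diff_rem_le hf dN K1 s0 tT hs a01 d11 Q11 hd hdt k6' k7' k8'' k9' k10'
    (sub _ _ hch) (sub _ _ hcht) hB hdS su uv vt).
- have C9 : 0 <= e9 N * S by apply: mulr_ge0 => //; exact: e9_ge0 hf.
  apply: (pvar2_le p0 C9 st (wavg_control hw) (wavg_le1 hw)) => u v su uv vt.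
  have -> : f (pt Y v) - f (pt Yt v) - (f (pt Y u) - f (pt Yt u)) =
    f (pt Y v) - f (pt Y u) - (f (pt Yt v) - f (pt Yt u)) by zmod.
  rewrite -mulrA -/(wscale p ws u v).
  exact: (diff_coef_le hf dN s0 tT hs a01 d11 Q11 hd hdt k7' k8'' k10').
- move=> u su ut.
  exact: (diff_sup_le hf dN s0 tT hs a01 d11 Q11 hd k8'' k10').
Qed.

Lemma pvar2_diff (E : normedModType R) q (A1 A2 : R -> R -> E) s t a1 a2 :
  1 <= q -> s <= t -> 0 <= a1 -> 0 <= a2 ->
  (forall u, s <= u <= t -> A1 u u = 0) -> (forall u, s <= u <= t -> A2 u u = 0) ->
  (pvar2 q A1 s t <= a1%:E)%E -> (pvar2 q A2 s t <= a2%:E)%E ->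
  (pvar2 q (fun u v => A1 u v - A2 u v)%R s t <= (2 * (a1 + a2))%:E)%E.
Proof.
move=> q1 st a10 a20 d1 d2 h1 h2.
have q0 : 0 < q by apply: lt_le_trans q1.
have qq : 0 <= q^-1 <= 1 by rewrite invr_ge0 ltW // invf_le1.
have [w1 [cw1 b1 k1]] := pvar2_control q0 a10 d1 h1.
have [w2 [cw2 b2 k2]] := pvar2_control q0 a20 d2 h2.
pose ws := [:: w1; w2]; have hw : unit_controls s t ws by [].
have C0 : 0 <= 2 * (a1 + a2) by rewrite mulr_ge0 // addr_ge0.
apply: (pvar2_le q0 C0 st (wavg_control hw) (wavg_le1 hw)) => u v su uv vt.
apply: le_trans (ler_normB _ _) _.
apply: le_trans (lerD (k1 u v su uv vt) (k2 u v su uv vt)) _.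
have j1 := @nth_wavg_powR _ s t ws 0 u v _ hw isT su uv vt qq.
have j2 := @nth_wavg_powR _ s t ws 1 u v _ hw isT su uv vt qq.
have := ler_wpM2l a10 j1; have := ler_wpM2l a20 j2 => /=; lra.
Qed.

Lemma pvar2_fin (E : normedModType R) q (A : R -> R -> E) s t :
  (pvar2 q A s t < +oo)%E -> exists2 Q, 0 <= Q & pvar2 q A s t = Q%:E.
Proof.
move=> foo; have ge0 : (0 <= pvar2 q A s t)%E by exact: poweR_ge0.
exists (fine (pvar2 q A s t)); first exact: fine_ge0.
by rewrite fineK // ge0_fin_numE.
Qed.

Definition local_stability (a C : R) := forall X XX Y B Xt XXt Yt Bt s t del,
  solves X XX Y B -> solves Xt XXt Yt Bt ->
  0 <= s -> s <= t -> t <= T -> 0 <= del ->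
  (pvar p X s t <= a%:E)%E -> (pvar2 (p / 2) XX s t <= a%:E)%E -> t - s <= a ->
  (pvar p Xt s t <= a%:E)%E -> (pvar2 (p / 2) XXt s t <= a%:E)%E ->
  (pvar2 (p / 2) (path_rem f X Y) s t < +oo)%E ->
  (pvar2 (p / 2) (path_rem f Xt Yt) s t < +oo)%E ->
  (pvar p (fun u => X u - Xt u)%R s t <= del%:E)%E ->
  (pvar2 (p / 2) (fun u v => XX u v - XXt u v)%R s t <= del%:E)%E ->
  drift_diff_le s t del Y Yt B Bt ->
  [/\ (pvar2 (p / 2) (dR X Xt Y Yt) s t <= (C * (`|Y s - Yt s| + del))%:E)%E,
      (pvar p (fun u => f (pt Y u) - f (pt Yt u))%R s t <=
         (C * (`|Y s - Yt s| + del))%:E)%E &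
      forall u, s <= u -> u <= t -> `|Y u - Yt u| <= C * (`|Y s - Yt s| + del)].

(** On an interval where the drivers are small, the a priori estimate and the
    estimate of the difference bound a norm by a small multiple of itself, hence
    close up. *)
Lemma local_estimate : exists a C,
  [/\ 0 < a, a < 1, 1 <= C & local_stability a C].
Proof.
set A0 := cA N K; set B0 := cB N K.
have A00 : 0 <= A0 by exact: cA_ge0 hf K1.
have B00 : 0 <= B0 by exact: cB_ge0 hf K1.
have E10 : 0 <= e1 N by exact: e1_ge0 hf.
have E90 : 0 <= e9 N by exact: e9_ge0 hf.
(* The bound b is small enough for the estimate of the difference to absorb its own
   remainder, and a is small enough for the a priori estimate to bring the
   remainders of both solutions below b. The numerical factors come from the 4 and
   the 11 controls that are averaged in the two estimates. *)
pose m := 8 * A0 + 1; pose g := 242 * B0 + 44.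
have m1 : 1 <= m by rewrite lerDr mulr_ge0.
have B242 : 0 <= 242 * B0 := mulr_ge0 (ler0n R 242) B00.
have g1 : 44 <= g by rewrite lerDr.
have m0 : 0 < m by lra. have g0 : 0 < g by lra.
pose b := g^-1; pose a := b / m.
have b0 : 0 < b by rewrite invr_gt0.
have a0 : 0 < a by rewrite divr_gt0.
have bg : b * g = 1 by rewrite mulVf // gt_eqF.
have am : a * m = b by rewrite /a divfK // gt_eqF.
have ab : a <= b by rewrite -am ler_peMr // ltW.
have bB : 242 * (B0 * b) + 44 * b = 1.
  by transitivity (b * g) => //; rewrite /g; ring.
have bB0 : 0 <= B0 * b by rewrite mulr_ge0 // ltW.
have Bb : B0 * b <= 242^-1 by lra.
have a4 : 4 * a <= 1 by lra. have b11 : 11 * b <= 1 by lra.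
have aA : 8 * (A0 * a) + a = b.
  by transitivity (a * m) => //; rewrite /m; ring.
have aA0 : 0 <= A0 * a by rewrite mulr_ge0 // ltW.
pose C2 := 22 + 242 * B0.
have C20 : 0 <= C2 := addr_ge0 (ler0n R 22) B242.
pose C := (1 + 22 * B0) + (e9 N + e1 N) * C2.
have EC0 : 0 <= (e9 N + e1 N) * C2 by rewrite mulr_ge0 // addr_ge0.
exists a, C; split => //.
- lra.
- rewrite /C; lra.
move=> X XX Y B Xt XXt Yt Bt s t del hsol hsolt s0 st tT del0 hX hXX hts hXt hXXt
  fR fRt hdX hdXX hB.
have small X0 XX0 Y0 B1 : solves X0 XX0 Y0 B1 -> (pvar p X0 s t <= a%:E)%E ->
    (pvar2 (p / 2) XX0 s t <= a%:E)%E ->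
    (pvar2 (p / 2) (path_rem f X0 Y0) s t < +oo)%E ->
    (pvar2 (p / 2) (path_rem f X0 Y0) s t <= b%:E)%E.
  move=> h1 h2 h3 /pvar2_fin[Q Q0 QE].
  have hQ : (pvar2 (p / 2) (path_rem f X0 Y0) s t <= Q%:E)%E by rewrite QE.
  have := local_a_priori h1 s0 st tT a0 a4 Q0 h2 h3 hts hQ.
  rewrite QE !lee_fin -/A0 => k.
  have : A0 * a * Q <= Q / 32.
    have : A0 * a <= 32^-1 by lra.
    by move=> /(ler_wpM2r Q0) /le_trans; apply; rewrite mulrC.
  lra.
have hR := small _ _ _ _ hsol hX hXX fR; have hRt := small _ _ _ _ hsolt hXt hXXt fRt.
have up (x : \bar R) : (x <= a%:E)%E -> (x <= b%:E)%E.
  by move=> /le_trans; apply; rewrite lee_fin.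
have remd X0 Y0 u : s <= u <= t -> path_rem f X0 Y0 u u = 0.
  by move=> _; rewrite /path_rem !subrr mulmx0 subrr.
have p21 : 1 <= p / 2 by rewrite ler_pdivlMr // mul1r; case/andP: hp.
have fdR : (pvar2 (p / 2) (dR X Xt Y Yt) s t < +oo)%E.
  apply: le_lt_trans (ltry (2 * (b + b))).
  exact: (pvar2_diff p21 st (ltW b0) (ltW b0) (remd X Y) (remd Xt Yt) hR hRt).
have hts' : t - s <= b := le_trans hts ab.
have loc Q (Q0 : 0 <= Q) := local_diff hsol hsolt s0 st tT b0 b11 del0 Q0 (up _ hX)
  (up _ hXX) hts' (up _ hXt) (up _ hXXt) hR hRt hdX hdXX hB.
have [Q Q0 QE] := pvar2_fin fdR.
have hQ : (pvar2 (p / 2) (dR X Xt Y Yt) s t <= Q%:E)%E by rewrite QE.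
have /= [l1 l2 l3] := loc Q Q0 hQ.
set D := `|Y s - Yt s| in l1 l2 l3 *; have D0 : 0 <= D by exact: normr_ge0.
have QC : Q <= (1 + 22 * B0) * (D + del).
  move: l1; rewrite QE lee_fin -/B0 => l1.
  have h1 : B0 * b * Q <= Q / 242.
    by move: Bb => /(ler_wpM2r Q0) /le_trans; apply; rewrite mulrC.
  have h2 : B0 * b * D <= D / 242.
    by move: Bb => /(ler_wpM2r D0) /le_trans; apply; rewrite mulrC.
  have h3 : B0 * b * del <= del / 242.
    by move: Bb => /(ler_wpM2r del0) /le_trans; apply; rewrite mulrC.
  have h4 : 0 <= B0 * D by rewrite mulr_ge0.
  lra.
have SC : D + 11 * del + 11 * Q <= C2 * (D + del).
  have h4 : 0 <= B0 * D by rewrite mulr_ge0.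
  by rewrite /C2; lra.
have Dd : 0 <= D + del by rewrite addr_ge0.
have C1D : 0 <= (1 + 22 * B0) * (D + del) by rewrite mulr_ge0 // addr_ge0 // mulr_ge0.
have m1' : e9 N * (D + 11 * del + 11 * Q) <= e9 N * (C2 * (D + del)) by rewrite ler_wpM2l.
have m2' : e1 N * (D + 11 * del + 11 * Q) <= e1 N * (C2 * (D + del)) by rewrite ler_wpM2l.
have P9 : 0 <= e9 N * (C2 * (D + del)) by rewrite !mulr_ge0.
have P1 : 0 <= e1 N * (C2 * (D + del)) by rewrite !mulr_ge0.
split.
- rewrite QE lee_fin; apply: le_trans QC _; rewrite /C; lra.
- by apply: le_trans l2 _; rewrite lee_fin /C; lra.
- move=> u su ut; apply: le_trans (l3 u su ut) _; rewrite /C; lra.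
Qed.

End LocalEstimates.

(** * Concatenation of variation estimates *)

Section Concatenation.
Context {R : realType} {E : normedModType R}.
Implicit Types (s r t u v : R) (w : R -> R -> R) (A : R -> R -> E).

Lemma control_clipl s r t w : s <= r -> r <= t -> control s r w ->
  control s t (fun u v => w (Num.min u r) (Num.min v r)).
Proof.
move=> sr rt [w0 wD]; split=> [u v su uv vt|u x v su ux xv vt].
  by apply: w0; rewrite ?le_min ?su ?ge_min ?lexx ?orbT //= uv.
by apply: wD; rewrite ?le_min ?su ?ge_min ?lexx ?orbT //= ?ux ?xv.
Qed.

Lemma control_clipr s r t w : s <= r -> r <= t -> control r t w ->
  control s t (fun u v => w (Num.max u r) (Num.max v r)).
Proof.
move=> sr rt [w0 wD]; split=> [u v su uv vt|u x v su ux xv vt].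
  by apply: w0; rewrite ?ge_max ?vt ?le_max ?lexx ?orbT //= uv.
by apply: wD; rewrite ?ge_max ?vt ?le_max ?lexx ?orbT //= ?ux ?xv.
Qed.

Lemma control_straddle s r t :
  control s t (fun u v => if (u < r) && (r < v) then 1 else 0).
Proof.
split=> [u v _ _ _|u x v su ux xv vt]; first by case: ifP.
case: ifP => [/andP[ur rx]|_].
  rewrite ur (lt_le_trans rx xv) /= ifN ?addr0 //.
  by rewrite negb_and -leNgt (ltW rx).
rewrite add0r; case: ifP => [/andP[xr rv]|_]; last by case: ifP.
by rewrite (le_lt_trans ux xr) rv.
Qed.

(** A partition of [s, t] has at most one interval that straddles r: the indicator
    function of straddling is a third control, besides those of the two parts. *)
Lemma pvar2_concat q A s r t a1 a2 e : 1 <= q -> s <= r -> r <= t ->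
  0 <= a1 -> 0 <= a2 -> 0 <= e -> (forall u, s <= u <= t -> A u u = 0) ->
  (forall u v, s <= u -> u <= r -> r <= v -> v <= t ->
    `|A u v| <= `|A u r| + `|A r v| + e) ->
  (pvar2 q A s r <= a1%:E)%E -> (pvar2 q A r t <= a2%:E)%E ->
  (pvar2 q A s t <= (3 * (a1 + a2 + e))%:E)%E.
Proof.
move=> q1 sr rt a10 a20 e0 d hA h1 h2.
have st := le_trans sr rt.
have q0 : 0 < q by apply: lt_le_trans q1.
have qq : 0 <= q^-1 <= 1 by rewrite invr_ge0 ltW // invf_le1.
have d1 u : s <= u <= r -> A u u = 0.
  by move=> /andP[su ur]; apply: d; rewrite su (le_trans ur).
have d2 u : r <= u <= t -> A u u = 0.
  by move=> /andP[ru ut]; apply: d; rewrite ut (le_trans sr).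
have [w1 [cw1 b1 k1]] := pvar2_control q0 a10 d1 h1.
have [w2 [cw2 b2 k2]] := pvar2_control q0 a20 d2 h2.
pose ws := [:: (fun u v => w1 (Num.min u r) (Num.min v r));
  (fun u v => w2 (Num.max u r) (Num.max v r));
  (fun u v => if (u < r) && (r < v) then 1 else 0)].
have hw : unit_controls s t ws.
  split; [exact: control_clipl| |].
    by rewrite (min_idPl sr) (min_idPr rt).
  split; [exact: control_clipr| |].
    by rewrite (max_idPr sr) (max_idPl rt).
  by split=> //; [exact: control_straddle|case: ifP].
have C0 : 0 <= 3 * (a1 + a2 + e) by rewrite mulr_ge0 // !addr_ge0.
apply: (pvar2_le q0 C0 st (wavg_control hw) (wavg_le1 hw)) => u v su uv vt.
have j1 := ler_wpM2l a10 (@nth_wavg_powR _ s t ws 0 u v _ hw isT su uv vt qq).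
have j2 := ler_wpM2l a20 (@nth_wavg_powR _ s t ws 1 u v _ hw isT su uv vt qq).
have j3 := ler_wpM2l e0 (@nth_wavg_powR _ s t ws 2 u v _ hw isT su uv vt qq).
suff : `|A u v| <=
   a1 * w1 (Num.min u r) (Num.min v r) `^ q^-1 +
   a2 * w2 (Num.max u r) (Num.max v r) `^ q^-1 +
   e * (if (u < r) && (r < v) then 1 else 0) `^ q^-1.
  move=> h; apply: le_trans h _; rewrite /= in j1 j2 j3.
  by move: (wavg _ _ _ `^ _) j1 j2 j3 => W; lra.
have p1 : 0 <= a1 * w1 (Num.min u r) (Num.min v r) `^ q^-1.
  by rewrite mulr_ge0 ?powR_ge0.
have p2 : 0 <= a2 * w2 (Num.max u r) (Num.max v r) `^ q^-1.
  by rewrite mulr_ge0 ?powR_ge0.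
have p3 : 0 <= e * (if (u < r) && (r < v) then 1 else 0) `^ q^-1.
  by rewrite mulr_ge0 ?powR_ge0.
case: (boolP (v <= r)) => [vr|]; last (rewrite -ltNge => rv).
  have := k1 u v su uv vr; rewrite (min_idPl vr) in p1 *.
  by rewrite (min_idPl (le_trans uv vr)) in p1 *; lra.
case: (boolP (r <= u)) => [ru|]; last (rewrite -ltNge => ur).
  have := k2 u v ru uv vt; rewrite (max_idPl ru) (max_idPl (ltW rv)) in p2 *.
  by lra.
rewrite ur rv /= powR1 mulr1.
have := hA u v su (ltW ur) (ltW rv) vt.
have := k1 u r su (ltW ur) (lexx _); have := k2 r v (lexx _) (ltW rv) vt.
rewrite (min_idPl (ltW ur)) (min_idPr (ltW rv)) (max_idPr (ltW ur)) (max_idPl (ltW rv)).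
by lra.
Qed.

Lemma pvar2_norm q A s t a u v : 0 < q -> 0 <= a ->
  (forall u, s <= u <= t -> A u u = 0) ->
  (pvar2 q A s t <= a%:E)%E -> s <= u -> u <= v -> v <= t -> `|A u v| <= a.
Proof.
move=> q0 a0 d h su uv vt; have [w [cw w1 hA]] := pvar2_control q0 a0 d h.
apply: le_trans (hA u v su uv vt) _; rewrite ler_piMr //.
have w0 := control_ge0 cw su uv vt.
have w11 := le_trans (control_mono cw (lexx s) su uv vt (lexx t)) w1.
have := @ge0_ler_powR R q^-1 _ _ _ _ _ w11; rewrite powR1; apply.
- by rewrite invr_ge0 ltW.
- by rewrite nnegrE.
- by rewrite nnegrE.
Qed.

End Concatenation.

(** * The greedy partition *)

Section GreedyPartition.
Context {R : realType} (w : R -> R -> \bar R) (alpha t0 t1 : R).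
Hypothesis alpha0 : 0 < alpha.
Hypothesis t01 : t0 < t1.
Hypothesis w_ge0 : forall u v, t0 <= u -> u <= v -> v <= t1 -> (0 <= w u v)%E.
Hypothesis w_add : forall u r v, t0 <= u -> u <= r -> r <= v -> v <= t1 ->
  (w u r + w r v <= w u v)%E.
Hypothesis w_fin : (w t0 t1 < +oo)%E.
Hypothesis w_right : forall u, t0 <= u -> u < t1 ->
  exists r, [/\ u < r, r <= t1 & (w u r < alpha%:E)%E].

Local Notation tau := (greedy_time w alpha t0 t1).

Lemma w_mono u u' v' v : t0 <= u -> u <= u' -> u' <= v' -> v' <= v -> v <= t1 ->
  (w u' v' <= w u v)%E.
Proof.
move=> h1 h2 h3 h4 h5.
apply: le_trans (w_add h1 h2 (le_trans h3 h4) h5).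
apply: le_trans (leeDr _ (w_ge0 h1 h2 (le_trans (le_trans h3 h4) h5))).
apply: le_trans (w_add (le_trans h1 h2) h3 h4 h5).
by rewrite leeDl // w_ge0 // (le_trans (le_trans h1 h2)).
Qed.

(** As w need not be continuous, nothing is known of w at the time tau i.+1 itself,
    only before and after it. *)
Lemma greedy_step i : t0 <= tau i -> tau i <= t1 ->
  [/\ tau i <= tau i.+1, tau i.+1 <= t1,
      tau i < t1 -> tau i < tau i.+1,
      forall r, tau i < r -> r < tau i.+1 -> (w (tau i) r < alpha%:E)%E &
      forall r, tau i.+1 < r -> r <= t1 -> (alpha%:E <= w (tau i) r)%E].
Proof.
move=> h0 h1; rewrite /=; set x := tau i in h0 h1 *.
set S := [set r%:E | r in _]; set I := ereal_inf S.
have Ix : (x%:E <= I)%E.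
  by apply: le_ereal_inf_tmp => _ [r [_ /andP[xr _]] <-]; rewrite lee_fin ltW.
have mf : mine I t1%:E = (fine (mine I t1%:E))%:E.
  rewrite fineK // fin_numE; apply/andP; split.
    by rewrite gt_eqF // lt_min ltNyr (lt_le_trans (ltNyr x)).
  by rewrite lt_eqF // gt_min ltry orbT.
set m := fine _ in mf *.
have mI : (m%:E <= I)%E by rewrite -mf ge_min lexx.
have mt : m <= t1 by rewrite -lee_fin -mf ge_min lexx orbT.
split=> //.
- by rewrite -lee_fin -mf le_min Ix lee_fin.
- move=> xt; have [r0 [xr0 r0t hr0]] := w_right h0 xt.
  apply: (lt_le_trans xr0); rewrite -lee_fin -mf le_min lee_fin r0t andbT.
  apply: le_ereal_inf_tmp => _ [r [hr /andP[xr rt]] <-]; rewrite lee_fin leNgt.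
  apply/negP => rr0; have := le_lt_trans (le_trans hr (w_mono h0 (lexx x) (ltW xr) (ltW rr0) r0t)) hr0.
  by rewrite ltxx.
- move=> r xr rm; rewrite ltNge; apply/negP => hr.
  have : (I <= r%:E)%E.
    apply: ereal_inf_lbound; exists r => //; split => //.
    by rewrite xr (le_trans (ltW rm)).
  by move=> /(le_trans mI); rewrite lee_fin leNgt rm.
- move=> r mr rt; have : (I < r%:E)%E.
    have : (mine I t1%:E < r%:E)%E by rewrite mf lte_fin.
    by rewrite gt_min => /orP[//|]; rewrite lte_fin ltNge rt.
  move=> /ereal_inf_lt[_ [r' [hr' /andP[xr' r't]] <-]]; rewrite lte_fin => r'r.
  by apply: le_trans hr' _; apply: w_mono => //; exact: ltW.
Qed.

Lemma greedy_itv i : t0 <= tau i /\ tau i <= t1.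
Proof.
elim: i => [|i [h0 h1]]; first by split=> //=; exact: ltW.
by have [h2 h3 _ _ _] := greedy_step h0 h1; split=> //; exact: le_trans h2.
Qed.

(** Two consecutive greedy intervals have mass at least alpha; w being superadditive
    and finite, there are finitely many of them. *)
Lemma greedy_end : exists i, tau i = t1.
Proof.
apply: contrapT => no.
have lt i : tau i < t1.
  by rewrite lt_neqAle (greedy_itv i).2 andbT; apply/eqP => e; apply: no; exists i.
have two i : (alpha%:E <= w (tau i) (tau i.+2))%E.
  have [_ _ _ _] := greedy_step (greedy_itv i).1 (greedy_itv i).2.
  apply; last exact: (greedy_itv _).2.
  by have [_ _ + _ _] := greedy_step (greedy_itv i.+1).1 (greedy_itv i.+1).2; apply.
have le i : tau i <= tau i.+1.
  by have [+ _ _ _ _] := greedy_step (greedy_itv i).1 (greedy_itv i).2.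
have big k : ((k%:R * alpha)%:E <= w t0 (tau k.*2))%E.
  elim: k => [|k IH].
    by rewrite mul0r; apply: w_ge0 => //; exact: ltW.
  rewrite doubleS -natr1 mulrDl mul1r EFinD.
  have g := greedy_itv k.*2.
  apply: le_trans (w_add (lexx _) g.1 (le_trans (le _) (le _)) (greedy_itv _).2).
  exact: leeD.
have f : w t0 t1 \is a fin_num by rewrite ge0_fin_numE // w_ge0 // ltW.
pose k := Num.bound (fine (w t0 t1) / alpha).
have : k%:R * alpha <= fine (w t0 t1).
  rewrite -lee_fin fineK //; apply: le_trans (big k) _.
  by apply: w_mono => //; [exact: (greedy_itv _).1|exact: (greedy_itv _).2].
rewrite leNgt -ltr_pdivrMr //; apply/negP; rewrite negbK.
by apply: archi_boundP; rewrite divr_ge0 ?fine_ge0 ?w_ge0 // ltW.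
Qed.

(** The first greedy time equal to t1 has an index K + 1, and K is one of the indices
    over which the greedy number is a supremum. *)
Lemma greedy_cover : exists K : nat,
  [/\ tau K.+1 = t1, (K%:R%:E <= greedy_number w alpha t0 t1)%E &
   forall i, [/\ t0 <= tau i, tau i <= tau i.+1, tau i.+1 <= t1 &
     forall r, tau i < r -> r < tau i.+1 -> (w (tau i) r < alpha%:E)%E]].
Proof.
have ex : exists i, tau i == t1 by have [i /eqP] := greedy_end; exists i.
have [m /eqP hm hmin] := ex_minnP ex.
case: m hm hmin => [/= e|K hK hmin]; first by have := t01; rewrite e ltxx.
exists K; split => //.
  rewrite /greedy_number le_max; apply/orP; right; apply: ereal_sup_ubound.
  exists K => //=; rewrite lt_neqAle (greedy_itv K).2 andbT.
  by apply/negP => /hmin; rewrite ltnn.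
move=> i; have [g0 g1] := greedy_itv i; have [h1 h2 _ h3 _] := greedy_step g0 g1.
by split.
Qed.

End GreedyPartition.

(** * The control of the drivers *)

Section OneSidedLimits.
Context {R : realType}.

Lemma within_cvg (Z E : topologicalType) (A : set Z) (g : Z -> E) (x : Z)
    (F : set_system R) {FF : Filter F} (phi : R -> Z) :
  {within A, continuous g} -> A x -> phi r @[r --> F] --> x ->
  (\forall r \near F, A (phi r)) -> g (phi r) @[r --> F] --> g x.
Proof.
move=> /subspace_continuousP cg Ax cphi hA P /(cg x Ax) hP.
have /cphi hP' : \forall z \near x, A z -> P (g z) by exact: hP.
suff : \forall r \near F, P (g (phi r)) by [].
by apply: filterS2 hA hP' => r Ar; apply.
Qed.

Context {E : normedModType R} (T : R).

Lemma near_right_itv (u : R) : 0 <= u -> u < T ->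
  \forall r \near u^'+, 0 <= r <= T.
Proof.
move=> u0 uT; near=> r; apply/andP; split.
  by apply: le_trans u0 _; apply: ltW; near: r; exact: nbhs_right_gt.
by near: r; exact: nbhs_right_le.
Unshelve. all: by end_near. Qed.

Lemma near_left_itv (u : R) : 0 < u -> u <= T ->
  \forall r \near u^'-, 0 <= r <= T.
Proof.
move=> u0 uT; near=> r; apply/andP; split.
  by near: r; exact: nbhs_left_ge.
by apply: le_trans uT; apply: ltW; near: r; exact: nbhs_left_lt.
Unshelve. all: by end_near. Qed.

Lemma path_right (X : R -> E) u v : {within `[0, T], continuous X} ->
  0 <= u -> u < T -> X v - X r @[r --> u^'+] --> X v - X u.
Proof.
move=> cX u0 uT; apply: cvgB; first exact: cvg_cst.
apply: (within_cvg cX (phi := id)).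
- by rewrite /= in_itv /= u0 ltW.
- exact: cvg_at_right_filter cvg_id.
- by have := near_right_itv u0 uT; apply: filterS => r; rewrite /= in_itv.
Qed.

Lemma path_left (X : R -> E) u v : {within `[0, T], continuous X} ->
  0 < u -> u <= T -> X r - X v @[r --> u^'-] --> X u - X v.
Proof.
move=> cX u0 uT; apply: cvgB; last exact: cvg_cst.
apply: (within_cvg cX (phi := id)).
- by rewrite /= in_itv /= uT ltW.
- exact: cvg_at_left_filter cvg_id.
- by have := near_left_itv u0 uT; apply: filterS => r; rewrite /= in_itv.
Qed.

Lemma area_right (XX : R -> R -> E) u v :
  {within `[0, T] `*` `[0, T], continuous (fun z : R * R => XX z.1 z.2)} ->
  0 <= u -> u < T -> 0 <= v -> v <= T -> XX r v @[r --> u^'+] --> XX u v.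
Proof.
move=> cX u0 uT v0 vT.
apply: (within_cvg cX (x := (u, v)) (phi := fun r => (r, v))).
- by split; rewrite /= in_itv /= ?u0 ?v0 //= ltW.
- have h1 : r @[r --> u^'+] --> u by exact: cvg_at_right_filter cvg_id.
  have h2 : v @[r --> u^'+] --> v by exact: cvg_cst.
  exact: cvg_pair h1 h2.
- have := near_right_itv u0 uT; apply: filterS => r h.
  by split; rewrite /= in_itv //= v0.
Qed.

Lemma area_left (XX : R -> R -> E) u v :
  {within `[0, T] `*` `[0, T], continuous (fun z : R * R => XX z.1 z.2)} ->
  0 < u -> u <= T -> 0 <= v -> v <= T -> XX v r @[r --> u^'-] --> XX v u.
Proof.
move=> cX u0 uT v0 vT.
apply: (within_cvg cX (x := (v, u)) (phi := fun r => (v, r))).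
- by split; rewrite /= in_itv /= ?v0 ?uT ?vT ?(ltW u0).
- have h1 : r @[r --> u^'-] --> u by exact: cvg_at_left_filter cvg_id.
  have h2 : v @[r --> u^'-] --> v by exact: cvg_cst.
  exact: cvg_pair h2 h1.
- have := near_left_itv u0 uT; apply: filterS => r h.
  by split; rewrite /= in_itv //= v0.
Qed.

End OneSidedLimits.

Section DriverControl.
Context {R : realType} (d : nat) (p T : R).
Hypothesis hp : 2 <= p < 3.
Implicit Types (X : R -> 'cV[R]_d) (XX : R -> R -> 'M[R]_d).

Let p0 : 0 < p. Proof. by case/andP: hp => h _; apply: lt_le_trans h. Qed.
Let p20 : 0 < p / 2. Proof. by rewrite divr_gt0. Qed.

Definition incr X (s t : R) := X t - X s.

Lemma pvar2_qsup_eq (E : normedModType R) q (A : R -> R -> E) s t : 0 < q -> s <= t ->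
  (pvar2 q A s t `^ q = qsup q A s t)%E.
Proof.
by move=> q0 st; rewrite pvar2E -poweRrM mulVf ?gt_eqF // poweRe1 // qsup_ge0.
Qed.

Lemma qsup_lty (E : normedModType R) q (A : R -> R -> E) s t : 0 < q ->
  (pvar2 q A s t < +oo)%E -> (qsup q A s t < +oo)%E.
Proof. by move=> q0; apply: lty_poweRy; rewrite invr_eq0 gt_eqF. Qed.

Lemma w_roughE X XX s t : s <= t ->
  w_rough p X XX s t = (qsup p (incr X) s t + qsup (p / 2) XX s t)%E.
Proof. by move=> st; rewrite /w_rough !pvar2_qsup_eq. Qed.

Definition rough_control X XX u v : R :=
  fine (qsup p (incr X) u v) + fine (qsup (p / 2) XX u v).

Section OneDriver.
Variables (X : R -> 'cV[R]_d) (XX : R -> R -> 'M[R]_d).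
Hypothesis rp : rough_path p T X XX.

Lemma rough_qsup_fin :
  (qsup p (incr X) 0 T < +oo)%E /\ (qsup (p / 2) XX 0 T < +oo)%E.
Proof. by case: rp => -[_ h1] _ h2 _; split; exact: qsup_lty. Qed.

Lemma rough_control_control : control 0 T (rough_control X XX).
Proof. by have [h1 h2] := rough_qsup_fin; apply: controlD; exact: qsup_control. Qed.

Lemma rough_fin u v : 0 <= u -> u <= v -> v <= T ->
  qsup p (incr X) u v \is a fin_num /\ qsup (p / 2) XX u v \is a fin_num.
Proof.
move=> u0 uv vT; have [h1 h2] := rough_qsup_fin.
split; apply: (qsup_fin uv); first exact: le_lt_trans (qsup_mono _ _ u0 uv vT) h1.
exact: le_lt_trans (qsup_mono _ _ u0 uv vT) h2.
Qed.

Lemma w_rough_fine u v : 0 <= u -> u <= v -> v <= T ->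
  w_rough p X XX u v = (rough_control X XX u v)%:E.
Proof.
move=> u0 uv vT; rewrite w_roughE //; have [f1 f2] := rough_fin u0 uv vT.
by rewrite EFinD (fineK f1) (fineK f2).
Qed.

(** The drivers are continuous: this is what makes the greedy times advance. *)
Lemma rough_right u e : 0 <= u -> u < T -> 0 < e ->
  \forall r \near u^'+, rough_control X XX u r <= e.
Proof.
move=> u0 uT e0; have e2 : 0 < e / 2 by lra.
case: (rp) => -[cX _] cXX _ _.
have [h1 h2] := rough_qsup_fin.
have fu1 : (qsup p (incr X) u T < +oo)%E.
  by apply: le_lt_trans h1; apply: qsup_mono => //; exact: ltW.
have fu2 : (qsup (p / 2) XX u T < +oo)%E.
  by apply: le_lt_trans h2; apply: qsup_mono => //; exact: ltW.
have k1 : \forall r \near u^'+, (qsup p (incr X) u r <= (e / 2)%:E)%E.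
  apply: (qsup_right0 p0 uT fu1 _ e2) => v _; apply: path_right cX u0 uT.
have k2 : \forall r \near u^'+, (qsup (p / 2) XX u r <= (e / 2)%:E)%E.
  apply: (qsup_right0 p20 uT fu2 _ e2) => v /andP[uv vT].
  exact: area_right cXX u0 uT (ltW (le_lt_trans u0 uv)) vT.
apply: filterS (filterI (filterI (nbhs_right_gt u) (nbhs_right_le uT)) (filterI k1 k2)).
move=> r [[ur rT] [h3 h4]].
have [f1 f2] := rough_fin u0 (ltW ur) rT.
rewrite -(fineK f1) lee_fin in h3; rewrite -(fineK f2) lee_fin in h4.
by apply: le_trans (lerD h3 h4) _; rewrite -splitr.
Qed.

(** Left continuity gives the bound a ^ p at t itself. Its root of order p is a, that of
    order p / 2 is a ^ 2 <= a. *)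
Lemma rough_left s t a : 0 <= s -> s < t -> t <= T -> 0 < a -> a < 1 ->
  (forall r, s < r -> r < t -> rough_control X XX s r <= a `^ p) ->
  (pvar p X s t <= a%:E)%E /\ (pvar2 (p / 2) XX s t <= a%:E)%E.
Proof.
move=> s0 st tT a0 a1 h; case: (rp) => -[cX _] cXX _ _.
have cw := rough_control_control.
have [q1 q2] := rough_qsup_fin.
have c1 := qsup_control q1; have c2 := qsup_control q2.
have pos r : s < r -> r < t -> [/\ 0 <= fine (qsup p (incr X) s r),
    0 <= fine (qsup (p / 2) XX s r), qsup p (incr X) s r \is a fin_num &
    qsup (p / 2) XX s r \is a fin_num].
  move=> sr rt; have rT := le_trans (ltW rt) tT.
  have [f1 f2] := rough_fin s0 (ltW sr) rT.
  by split => //; [apply: (control_ge0 c1)|apply: (control_ge0 c2)] => //; exact: ltW.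
have k1 : (qsup p (incr X) s t <= (a `^ p)%:E)%E.
  apply: (qsup_left p0 st) => [u /andP[su ut]|r /andP[sr rt]].
    by apply: path_left => //; exact: le_lt_trans st.
  have [g1 g2 f1 _] := pos r sr rt; have := h r sr rt; rewrite /rough_control.
  by rewrite -(fineK f1) lee_fin; apply: le_trans; rewrite lerDl.
have k2 : (qsup (p / 2) XX s t <= (a `^ p)%:E)%E.
  apply: (qsup_left p20 st) => [u /andP[su ut]|r /andP[sr rt]].
    apply: (area_left cXX) => //; first exact: le_lt_trans st.
      exact: le_trans su.
    exact: le_trans (ltW ut) tT.
  have [g1 g2 _ f2] := pos r sr rt; have := h r sr rt; rewrite /rough_control.
  by rewrite -(fineK f2) lee_fin; apply: le_trans; rewrite lerDr.
have a0' := ltW a0.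
have root q x (y : \bar R) : 0 < q -> (0 <= y)%E -> (y <= (a `^ x)%:E)%E ->
    (y `^ q^-1 <= (a `^ (x / q))%:E)%E.
  move=> q0 y0 yx; rewrite powRrM -poweR_EFin.
  have qi : 0 <= q^-1 by rewrite invr_ge0 ltW.
  apply: gt0_ler_poweR => //; first by rewrite in_itv /= y0 leey.
  by rewrite in_itv /= lee_fin powR_ge0 leey.
split.
  have := root p p _ p0 (qsup_ge0 _ _ (ltW st)) k1.
  by rewrite divff ?gt_eqF // powRr1.
have := root (p / 2) p _ p20 (qsup_ge0 _ _ (ltW st)) k2 => /le_trans; apply.
have -> : p / (p / 2) = 2 by rewrite invf_div mulrCA divff ?mulr1 // gt_eqF.
rewrite lee_fin powR_mulrn // expr2 ler_piMl //; exact: ltW.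
Qed.

End OneDriver.
End DriverControl.

Lemma sum3_lt (R : realFieldType) (x y r u e : R) : 0 < e -> x <= e -> y <= e ->
  r <= u + e -> x + y + (r - u) < 4 * e.
Proof. lra. Qed.

Lemma sum3_ge (R : realFieldType) (x y z c : R) : 0 <= x -> 0 <= y -> 0 <= z ->
  x + y + z < c -> [/\ x <= c, y <= c & z <= c].
Proof. by move=> *; split; lra. Qed.

Section GreedyDrivers.
Context {R : realType} (d : nat) (p T : R).
Hypothesis hp : 2 <= p < 3.
Variables (X Xt : R -> 'cV[R]_d) (XX XXt : R -> R -> 'M[R]_d).
Hypothesis rp : rough_path p T X XX.
Hypothesis rpt : rough_path p T Xt XXt.

Let total u v : R := rough_control p X XX u v + rough_control p Xt XXt u v + (v - u).

Let total_control : control 0 T total.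
Proof.
apply: controlD; first by apply: controlD; exact: rough_control_control.
split=> [u v _ uv _|u r v _ _ _ _]; first by rewrite subr_ge0.
by rewrite addrC subrKA.
Qed.

Let w_total u v : 0 <= u -> u <= v -> v <= T ->
  w_control p X Xt XX XXt u v = (6 `^ p * total u v)%:E.
Proof.
move=> u0 uv vT; rewrite /w_control !(w_rough_fine hp (T := T)) // -!EFinD -EFinM.
by rewrite ger0_norm // subr_ge0.
Qed.

Let six : 1 <= 6 `^ p :> R.
Proof.
have pp : 0 <= p by case/andP: hp => h _; apply: le_trans h.
by have := @ler_powR R 6 (ler1n _ 6) 0 p pp; rewrite powRr0.
Qed.

(** The total control dominates the rough controls of both drivers and the length, since
    6 ^ p >= 1, and the level a ^ p is at most a. *)
Lemma greedy_drivers a t0 t1 : 0 < a -> a < 1 -> 0 <= t0 -> t0 < t1 -> t1 <= T ->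
  exists (K : nat) (tau : nat -> R),
  [/\ tau 0%N = t0, tau K.+1 = t1,
   (K%:R%:E <= greedy_number (w_control p X Xt XX XXt) (a `^ p) t0 t1)%E &
   forall i, [/\ t0 <= tau i, tau i <= tau i.+1, tau i.+1 <= t1 &
    tau i < tau i.+1 ->
    [/\ (pvar p X (tau i) (tau i.+1) <= a%:E)%E,
        (pvar2 (p / 2) XX (tau i) (tau i.+1) <= a%:E)%E,
        (pvar p Xt (tau i) (tau i.+1) <= a%:E)%E,
        (pvar2 (p / 2) XXt (tau i) (tau i.+1) <= a%:E)%E &
        tau i.+1 - tau i <= a]]].
Proof.
move=> a0 a1 t00 t01 t1T.
have p1 : 1 <= p by case/andP: hp => h _; apply: le_trans h; rewrite ler1n.
have ap0 : 0 < a `^ p by rewrite powR_gt0.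
have apa : a `^ p <= a by apply: ge1r_powR => //; rewrite a0 ltW.
pose w := w_control p X Xt XX XXt.
have six0 : 0 < 6 `^ p :> R by apply: lt_le_trans six.
have [w0 wD] := total_control.
have H1 u v : t0 <= u -> u <= v -> v <= t1 -> (0 <= w u v)%E.
  move=> u0 uv vt; have u0' := le_trans t00 u0; have vT := le_trans vt t1T.
  by rewrite /w w_total // lee_fin mulr_ge0 ?(ltW six0) // w0.
have H2 u r v : t0 <= u -> u <= r -> r <= v -> v <= t1 ->
    (w u r + w r v <= w u v)%E.
  move=> u0 ur rv vt; have u0' := le_trans t00 u0; have vT := le_trans vt t1T.
  rewrite /w !w_total ?(le_trans u0' ur) ?(le_trans rv vT) ?(le_trans ur rv) //.
  by rewrite -EFinD lee_fin -mulrDr ler_wpM2l ?(ltW six0) // wD.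
have H3 : (w t0 t1 < +oo)%E by rewrite /w w_total ?ltry // ltW.
have H4 u : t0 <= u -> u < t1 ->
    exists r, [/\ u < r, r <= t1 & (w u r < (a `^ p)%:E)%E].
  move=> u0 ut; have u0' := le_trans t00 u0; have uT := lt_le_trans ut t1T.
  pose e := a `^ p / (6 `^ p * 4).
  have e0 : 0 < e by rewrite divr_gt0 // mulr_gt0.
  have n1 := rough_right hp rp u0' uT e0; have n2 := rough_right hp rpt u0' uT e0.
  have n3 : \forall r \near u^'+, r <= u + e by apply: nbhs_right_le; rewrite ltrDl.
  have [r [[[[h1 h2] h3] h4] h5]] := filter_ex (filterI (filterI (filterI
    (filterI (nbhs_right_gt u) (nbhs_right_le ut)) n1) n2) n3).
  exists r; split; [exact: h1|exact: h2|].
  rewrite /w w_total ?(ltW h1) ?(le_trans h2 t1T) // lte_fin.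
  have h6 : total u r < 4 * e := sum3_lt e0 h3 h4 h5.
  have h7 : 6 `^ p * total u r < 6 `^ p * (4 * e) by rewrite ltr_pM2l.
  apply: lt_le_trans h7 _.
  by rewrite /e mulrA mulrC divfK // mulf_neq0 // gt_eqF.
have [K [tK hK hi]] := greedy_cover ap0 t01 H1 H2 H3 H4.
exists K, (greedy_time w (a `^ p) t0 t1); split => // i.
have [g1 g2 g3 g4] := hi i; split => // lt.
set s := greedy_time _ _ _ _ i in g1 g2 g4 lt *.
set t := greedy_time _ _ _ _ i.+1 in g2 g3 g4 lt *.
have s0 := le_trans t00 g1; have tT := le_trans g3 t1T.
have c1 := rough_control_control hp rp; have c2 := rough_control_control hp rpt.
have small r : s < r -> r < t -> [/\ rough_control p X XX s r <= a `^ p,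
    rough_control p Xt XXt s r <= a `^ p & r - s <= a `^ p].
  move=> sr rt; have rT := le_trans (ltW rt) tT.
  have := g4 r sr rt; rewrite /w w_total ?(ltW sr) // lte_fin => hw.
  have tot0 := w0 s r s0 (ltW sr) rT.
  have ht : total s r < a `^ p by apply: le_lt_trans hw; rewrite ler_peMl.
  apply: sum3_ge ht; [exact: control_ge0 c1 s0 (ltW sr) rT|
    exact: control_ge0 c2 s0 (ltW sr) rT|by rewrite subr_ge0 ltW].
have [v1 v2] := rough_left hp rp s0 lt tT a0 a1 (fun r h1 h2 => let: And3 h _ _ := small r h1 h2 in h).
have [v3 v4] := rough_left hp rpt s0 lt tT a0 a1 (fun r h1 h2 => let: And3 _ h _ := small r h1 h2 in h).
split => //; rewrite leNgt; apply/negP => ats.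
pose r := (s + a + t) / 2.
have [_ _] := small r ltac:(rewrite /r; lra) ltac:(rewrite /r; lra).
by rewrite /r; lra.
Qed.

End GreedyDrivers.

(** * Solutions and their drifts *)

Lemma coef_bounds_le (R : realType) (V W : normedModType R) (D : set V)
    (M N : R) (g : V -> W) (Dg : V -> {linear V -> W}) :
  M <= N -> coef_bounds D M g Dg -> coef_bounds D N g Dg.
Proof.
move=> MN [h1 h2 h3 h4 h5 h6 h7 h8 h9].
have up x y : 0 <= y -> x <= M * y -> x <= N * y.
  by move=> y0 /le_trans; apply; rewrite ler_wpM2r.
split.
- exact: le_trans MN.
- by move=> z /h2 /le_trans; apply.
- by move=> z z' Dz Dz'; apply: up => //; exact: h3.
- move=> a a' b b' Da Da' Db Db' Dc; apply: up; last exact: h4.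
  by rewrite addr_ge0 // mulr_ge0.
- by move=> z h Dz; apply: up => //; exact: h5.
- move=> z z' h Dz Dz'; have := h6 z z' h Dz Dz'; rewrite -!mulrA; apply: up.
  by rewrite mulr_ge0.
- move=> a a' b b' h Da Da' Db Db' Dc; have := h7 _ _ _ _ h Da Da' Db Db' Dc.
  by rewrite -!mulrA; apply: up; rewrite mulr_ge0 // addr_ge0 // mulr_ge0.
- by move=> a a' Da Da'; apply: up; [rewrite exprn_ge0|exact: h8].
- move=> a a' b b' Da Da' Db Db' Dc; apply: up; last exact: h9.
  by rewrite addr_ge0 // mulr_ge0 // ?exprn_ge0 // addr_ge0.
Qed.

Lemma eq_pvar2 (R : realType) (E : normedModType R) (q s t : R) (A1 A2 : R -> R -> E) :
  (forall u v, s <= u -> u < v -> v <= t -> A1 u v = A2 u v) ->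
  pvar2 q A1 s t = pvar2 q A2 s t.
Proof.
move=> h; rewrite /pvar2; congr (ereal_sup _ `^ _)%E.
apply/seteqP; split=> _ [pi hpi <-]; exists pi => //; congr EFin;
  rewrite !big_seq; apply: eq_bigr => I hI; have [h1 h2 h3] := subintervals_mem hpi hI;
  by rewrite h.
Qed.

Lemma pvar2_sub (R : realType) (E : normedModType R) (q s s' t' t : R) (A : R -> R -> E) : 0 < q ->
  s <= s' -> s' <= t' -> t' <= t ->
  (pvar2 q A s' t' <= pvar2 q A s t)%E.
Proof.
move=> q0 h1 h2 h3; rewrite !pvar2E; apply: gt0_ler_poweR.
- by rewrite invr_ge0 ltW.
- by rewrite in_itv /= qsup_ge0 //= leey.
- by rewrite in_itv /= qsup_ge0 ?leey // (le_trans h1) // (le_trans h2).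
- exact: qsup_mono.
Qed.

Section Solutions.
Context {R : realType} (n d m : nat) (p T : R).
Local Notation V := (R^o * 'cV[R]_n)%type.
Local Notation W := 'M[R]_(n, d).
Variables (sigma : R -> 'cV[R]_n -> W) (Df : V -> {linear V -> W}) (N : R).
Variables (b : R -> 'cV[R]_n -> 'cV[R]_m -> 'cV[R]_n) (U : set 'cV[R]_m).
Hypothesis hp : 2 <= p < 3.
Let f (z : V) : W := sigma z.1 z.2.
Hypothesis diffE : forall s x h, 0 <= s <= T -> 'd (sigma s) x h = Df (s, x) (0, h).
Hypothesis driftN : drift_lipschitz T U b N.

Implicit Types (X : R -> 'cV[R]_d) (XX : R -> R -> 'M[R]_d) (Y : R -> 'cV[R]_n)
  (u : R -> 'cV[R]_m).

Lemma in0T (s : R) : (s \in `[0, T]) = (0 <= s <= T).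
Proof. by rewrite in_itv. Qed.

(** The differential of sigma in the equation is applied to the columns of Y', which
    is sigma (., Y): the summands are the germs. *)
Lemma RDE_solves y u X XX Y (Y' : R -> W) : Linf T U u -> rough_path p T X XX ->
  RDE_solution p T b sigma y u X XX Y Y' ->
  solves T f Df N X XX Y (drift b Y u).
Proof.
move=> hu [_ _ _ hch] [[[cY _] _ _] hY' hI]; split.
- move=> s r t s0 sr rt tT; apply: hch; rewrite in0T.
  + by rewrite s0 (le_trans sr (le_trans rt tT)).
  + by rewrite (le_trans s0 sr) (le_trans rt tT).
  + by rewrite tT (le_trans s0 (le_trans sr rt)).
- by move=> s t s0 st tT; exact: driftN.
exists y => t t0 tT.
have tI : t \in `[0, T] by rewrite in0T t0.
have := hI t tI; rewrite /is_rough_integral => h.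
apply: cvg_trans h; apply: near_eq_cvg.
exists 1 => /=; first exact: ltr01.
move=> pi /= [hpi _]; rewrite /rough_sum /gsum !big_seq; apply: eq_bigr => I hIn.
have [I1 I2 I3] := subintervals_mem hpi hIn.
have IT : 0 <= I.1 <= T by rewrite I1 (le_trans (ltW I2)) // (le_trans I3).
rewrite /germ; congr (_ + _); apply: eq_bigr => l _; congr (_ *m _).
by rewrite diffE // /gub hY' ?in0T.
Qed.

Lemma RDE_rem y u X XX Y (Y' : R -> W) r s : RDE_solution p T b sigma y u X XX Y Y' ->
  0 <= r <= T -> remainder X Y Y' r s = path_rem f X Y r s.
Proof. by move=> [_ hY' _] hr; rewrite /remainder hY' ?in0T. Qed.

Lemma RDE_rem_fin y u X XX Y (Y' : R -> W) s t : RDE_solution p T b sigma y u X XX Y Y' ->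
  0 <= s -> s <= t -> t <= T -> (pvar2 (p / 2) (path_rem f X Y) s t < +oo)%E.
Proof.
move=> hs s0 st tT; have [[_ _ hR] _ _] := hs.
have p20 : 0 < p / 2 
  by case/andP: hp => h _; rewrite divr_gt0 // (lt_le_trans _ h).
rewrite -(@eq_pvar2 _ _ (p / 2) _ _ (remainder X Y Y')); last first.
  move=> a c sa ac ct; apply: RDE_rem hs _.
  by rewrite (le_trans s0) //= (le_trans (ltW ac)) // (le_trans ct).
exact: le_lt_trans (pvar2_sub _ p20 s0 st tT) hR.
Qed.

End Solutions.

Section DriftDifference.
Context {R : realType} (n m : nat) (p T N : R).
Variables (b : R -> 'cV[R]_n -> 'cV[R]_m -> 'cV[R]_n) (U : set 'cV[R]_m).
Hypothesis hp : 2 <= p < 3.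
Local Notation lebm := (@completed_lebesgue_measure R).

(** The time spent in J, normalised. *)
Lemma leb_control (s t : R) (J : set R) (L : R) :
  measurable (J : set (measurableTypeR R)) -> s <= t ->
  0 <= L -> fine (lebm (`]s, t] `&` J)) <= L ->
  exists w, [/\ control s t w, w s t <= 1 & forall u v, s <= u -> u <= v -> v <= t ->
    fine (lebm (`]u, v] `&` J)) = L * w u v].
Proof.
move=> mJ st L0 hL.
have mI u v : measurable (`]u, v]%classic `&` J : set (measurableTypeR R)).
  by apply: measurableI => //; exact: measurable_itv.
have mI' u v := cara_measurable (mI u v).
have fI u v : lebm (`]u, v] `&` J) \is a fin_num.
  rewrite ge0_fin_numE //; exact: (leb_itv_fin (mI u v) (@subIsetl _ _ _)).
pose l u v := fine (lebm (`]u, v] `&` J)).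
have cl : control s t l.
  split=> [u v _ _ _|u r v su ur rv vt]; first exact: fine_ge0.
  have E : `]u, v]%classic `&` J = (`]u, r]%classic `&` J) `|` (`]r, v]%classic `&` J).
    rewrite -setIUl; congr (_ `&` _); apply/seteqP; split=> x /=; rewrite !in_itv /=.
      by move=> /andP[ux xv]; case: (leP x r) => xr; [left|right]; rewrite ?ux ?xv.
    move=> [/andP[-> xr]|/andP[rx ->]]; first by rewrite (le_trans xr).
    by rewrite (le_lt_trans ur rx).
  have dj : (`]u, r]%classic `&` J) `&` (`]r, v]%classic `&` J) = set0.
    rewrite -subset0 => x [[/= + _] [/= + _]]; rewrite !in_itv /=.
    by move=> /andP[_ xr] /andP[rx _]; move: (lt_le_trans rx xr); rewrite ltxx.
  rewrite /l E (measureU lebm (mI' u r) (mI' r v) dj).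
  by rewrite (fineD (fI u r) (fI r v)).
have [L_0|Ln0] := eqVneq L 0.
  exists (fun _ _ => 0); split; [exact: control0|by []|] => u v su uv vt.
  rewrite mulr0; apply/eqP; rewrite eq_le fine_ge0 // andbT.
  apply: le_trans (control_mono cl (lexx s) su uv vt (lexx t)) _.
  by apply: le_trans hL _; rewrite L_0.
have Lp : 0 < L by rewrite lt_neqAle eq_sym Ln0.
exists (fun u v => L^-1 * l u v); split.
- by apply: controlZ => //; rewrite invr_ge0.
- by rewrite ler_pdivrMl // mulr1.
- by move=> u v _ _ _; rewrite mulrA divff // mul1r.
Qed.

Lemma RDE_drift_diff (Kb : R) : 0 <= Kb -> Kb <= N ->
  drift_stability T U b Kb ->
  forall Y Yt u ut s t (J : set R) (M L del : R),
     {within `[0, T], continuous Y} -> {within `[0, T], continuous Yt} ->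
     Linf T U u -> Linf T U ut ->
     0 <= s -> s <= t -> t <= T -> 0 <= M -> 0 <= L ->
     measurable (J : set (measurableTypeR R)) ->
     {ae leb, forall r, s <= r <= t -> ~ J r -> u r = ut r} ->
     {ae leb, forall r, s <= r <= t -> `|u r - ut r| <= M} ->
     fine (lebm (`]s, t] `&` J)) <= L -> N * (M * L) <= del ->
  drift_diff_le p N s t del Y Yt (drift b Y u) (drift b Yt ut).
Proof.
move=> Kb0 KN hb Y Yt u ut s t J M L del cY cYt hu hut s0 st tT M0 L0 mJ hJ hM hL hdel.
have [w [cw w1 hw]] := leb_control mJ st L0 hL.
exists w; split=> // D D0 hD u0 v0 su uv vt.
have sub P : {ae leb, forall r, s <= r <= t -> P r} ->
    {ae leb, forall r : R, u0 <= r <= v0 -> P r}.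
  move=> h; apply: (ae_imp (mu := lebm) h) => r hr /andP[ur rv]; apply: hr.
  by rewrite (le_trans su) // (le_trans rv).
have hD' r : u0 <= r <= v0 -> `|Y r - Yt r| <= D.
  by move=> /andP[ur rv]; apply: hD; [exact: le_trans ur|exact: le_trans vt].
have := hb Y Yt u ut u0 v0 J D M cY cYt hu hut (le_trans s0 su) uv (le_trans vt tT)
  D0 M0 mJ hD' (sub _ hJ) (sub _ hM).
move=> /le_trans; apply; rewrite (hw u0 v0 su uv vt).
have x0 := control_ge0 cw su uv vt.
have x1 := le_trans (control_mono cw (lexx s) su uv vt (lexx t)) w1.
have del0 : 0 <= del by apply: le_trans hdel; rewrite !mulr_ge0 // (le_trans Kb0).
apply: lerD.
  by rewrite ler_wpM2r ?subr_ge0 // ler_wpM2r.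
have p1 : (p / 2)^-1 <= 1.
  by rewrite invf_le1 ?ler_pdivlMr ?mul1r; case/andP: hp => h _ //; rewrite divr_gt0 // (lt_le_trans _ h).
have h1 : Kb * M * (L * w u0 v0) <= del * w u0 v0.
  rewrite mulrA ler_wpM2r //; apply: le_trans hdel.
  by rewrite -mulrA ler_wpM2r // mulr_ge0.
apply: le_trans h1 _; rewrite ler_wpM2l //.
move: x0 x1; set x := w u0 v0 => x0 x1.
move: x0; rewrite le_eqVlt => /predU1P[<-|x0]; first exact: powR_ge0.
by apply: ger1_powR => //; rewrite x0.
Qed.

End DriftDifference.

(** * From local to global estimates *)

Section Gluing.
Context {R : realType} (n d : nat) (p : R).
Local Notation V := (R^o * 'cV[R]_n)%type.
Local Notation W := 'M[R]_(n, d).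
Variables (f : V -> W) (N C del s T : R).
Hypothesis hp : 2 <= p.
Hypothesis N1 : 1 <= N.
Hypothesis C1 : 1 <= C.
Hypothesis dN : d%:R <= N.
Hypothesis del0 : 0 <= del.
Variables (X Xt : R -> 'cV[R]_d) (Y Yt : R -> 'cV[R]_n).
Hypothesis fb : forall u, s <= u -> u <= T -> `|f (pt Yt u)| <= N.

Let g u : W := f (pt Y u) - f (pt Yt u).

(** The induction hypothesis, for the interval [s, t]. *)
Definition stable_upto (t L : R) : Prop :=
  [/\ (pvar2 (p / 2) (dR f X Xt Y Yt) s t <= L%:E)%E,
      (pvar p g s t <= L%:E)%E &
      forall u, s <= u -> u <= t -> `|Y u - Yt u| <= L].

Definition glue_const : R := 3 * (1 + 2 * C + N + 2 * N ^+ 2).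

Lemma glue_const_ge1 : 1 <= glue_const.
Proof.
have := sqr_ge0 N; have := C1; have := N1; rewrite /glue_const; lra.
Qed.

Let p1 : 1 <= p. Proof. by apply: le_trans hp; rewrite ler1n. Qed.
Let p0 : 0 < p. Proof. exact: lt_le_trans p1. Qed.
Let p20 : 0 < p / 2. Proof. by rewrite divr_gt0. Qed.
Let p21 : 1 <= p / 2. Proof. by rewrite ler_pdivlMr // mul1r. Qed.

Lemma dR_diag u : dR f X Xt Y Yt u u = 0.
Proof. by rewrite /dR /path_rem !subrr !mulmx0 !subrr. Qed.

(** Remainders are additive up to the increments of their Gubinelli derivatives,
    which is what has to be paid to pass from one interval to the next. *)
Lemma dR_additive u r v :
  dR f X Xt Y Yt u v = dR f X Xt Y Yt u r + dR f X Xt Y Yt r v +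
  ((g r - g u) *m (X v - X r) +
   (f (pt Yt r) - f (pt Yt u)) *m (X v - Xt v - (X r - Xt r))).
Proof.
rewrite /dR /path_rem /g !mulmxBl !mulmxBr; zmod.
Qed.

Lemma stable_start : stable_upto s (`|Y s - Yt s| + del).
Proof.
have L0 : 0 <= `|Y s - Yt s| + del by rewrite addr_ge0.
have w0 : (fun _ _ : R => 0 : R) s s <= 1 by rewrite ler01.
split.
- apply: (pvar2_le p20 L0 (lexx s) (control0 s s) w0) => u v su uv vs.
  have us : u = v by apply/le_anti; rewrite uv (le_trans vs).
  by rewrite us dR_diag normr0 mulr_ge0 // powR_ge0.
- apply: (pvar2_le p0 L0 (lexx s) (control0 s s) w0) => u v su uv vs.
  have us : u = v by apply/le_anti; rewrite uv (le_trans vs).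
  by rewrite us subrr normr0 mulr_ge0 // powR_ge0.
- by move=> u su us; have -> : u = s; [apply/le_anti; rewrite su us|rewrite lerDl].
Qed.

(** The straddling error in the concatenation of remainders involves the variation of
    g up to r, which L bounds, and the difference of the drivers. *)
Lemma stable_step r t L : s <= r -> r <= t -> t <= T -> del <= L ->
  (pvar p X r t <= 1%:E)%E -> (pvar p (fun u => X u - Xt u)%R r t <= del%:E)%E ->
  let M := C * (`|Y r - Yt r| + del) in
  (pvar2 (p / 2) (dR f X Xt Y Yt) r t <= M%:E)%E -> (pvar p g r t <= M%:E)%E ->
  (forall u, r <= u -> u <= t -> `|Y u - Yt u| <= M) ->
  stable_upto r L -> stable_upto t (glue_const * L).
Proof.
move=> sr rt tT dL hX hdX M hM1 hM2 hM3 [hL1 hL2 hL3].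
have L0 : 0 <= L by apply: le_trans dL.
have N0 : 0 <= N by apply: le_trans N1.
have C0 : 0 <= C by apply: le_trans C1.
have CL : 0 <= C * L by rewrite mulr_ge0.
have NL : 0 <= N * L by rewrite mulr_ge0.
have NNL : 0 <= N ^+ 2 * L by rewrite mulr_ge0 // exprn_ge0.
have ML : M <= 2 * (C * L).
  rewrite /M mulrCA ler_wpM2l //; have := hL3 r sr (lexx r); lra.
have M0 : 0 <= M by rewrite /M mulr_ge0 // addr_ge0.
have GE : glue_const * L = 3 * (L + 2 * (C * L) + N * L + 2 * (N ^+ 2 * L)).
  by rewrite /glue_const; ring.
have e0 : 0 <= N * L + 2 * (N ^+ 2 * del).
  by rewrite addr_ge0 // mulr_ge0 // mulr_ge0 // exprn_ge0.
have eL : N ^+ 2 * del <= N ^+ 2 * L by rewrite ler_wpM2l // exprn_ge0.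
split.
- have hA u v : s <= u -> u <= r -> r <= v -> v <= t ->
      `|dR f X Xt Y Yt u v| <= `|dR f X Xt Y Yt u r| + `|dR f X Xt Y Yt r v| +
        (N * L + 2 * (N ^+ 2 * del)).
    move=> su ur rv vt; rewrite (dR_additive u r v).
    apply: le_trans (ler_normD _ _) _; apply: lerD; first exact: ler_normD.
    apply: le_trans (ler_normD _ _) _; apply: lerD.
      apply: le_trans (mulmx_norm _ _) _.
      have k1 : `|g r - g u| <= L.
        exact: (pvar2_norm p0 L0 (fun u _ => subrr (g u)) hL2 su ur (lexx r)).
      have k2 : `|X v - X r| <= 1.
        exact: (pvar2_norm p0 ler01 (fun u _ => subrr (X u)) hX (lexx r) rv vt).
      have k3 : `|g r - g u| * `|X v - X r| <= L.
        by rewrite -[leRHS]mulr1; apply: ler_pM.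
      by apply: ler_pM => //; rewrite mulr_ge0.
    apply: le_trans (mulmx_norm _ _) _.
    have k1 : `|f (pt Yt r) - f (pt Yt u)| <= 2 * N.
      apply: le_trans (ler_normB _ _) _.
      have h1 := fb sr (le_trans rt tT).
      have h2 := fb su (le_trans ur (le_trans rt tT)).
      lra.
    have k2 : `|X v - Xt v - (X r - Xt r)| <= del.
      exact: (pvar2_norm p0 del0 (fun u _ => subrr (X u - Xt u)) hdX (lexx r) rv vt).
    have k3 : `|f (pt Yt r) - f (pt Yt u)| * `|X v - Xt v - (X r - Xt r)| <=
      2 * N * del by apply: ler_pM.
    have -> : 2 * (N ^+ 2 * del) = N * (2 * N * del) by ring.
    by apply: ler_pM => //; rewrite mulr_ge0.
  apply: le_trans (pvar2_concat p21 sr rt L0 M0 e0 (fun u _ => dR_diag u) hA hL1 hM1) _.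
  rewrite lee_fin GE; lra.
- have hA u v : s <= u -> u <= r -> r <= v -> v <= t ->
      `|g v - g u| <= `|g r - g u| + `|g v - g r| + 0.
    move=> _ _ _ _; rewrite addr0.
    have -> : g v - g u = (g r - g u) + (g v - g r) by zmod.
    exact: ler_normD.
  apply: le_trans (pvar2_concat p1 sr rt L0 M0 (lexx 0) (fun u _ => subrr (g u)) hA
    hL2 hM2) _.
  rewrite lee_fin GE; lra.
- move=> u su ut; rewrite GE; case: (leP u r) => ur.
    have := hL3 u su ur; lra.
  have := hM3 u (ltW ur) ut; lra.
Qed.

(** Times may repeat: the greedy times are constant once they have reached the end. *)
Lemma stable_iter (tau : nat -> R) (K : nat) : tau 0%N = s ->
  (forall i, [/\ s <= tau i, tau i <= tau i.+1, tau i.+1 <= T & tau i < tau i.+1 ->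
   let r := tau i in let t := tau i.+1 in let M := C * (`|Y r - Yt r| + del) in
   [/\ (pvar p X r t <= 1%:E)%E, (pvar p (fun u => X u - Xt u)%R r t <= del%:E)%E,
      (pvar2 (p / 2) (dR f X Xt Y Yt) r t <= M%:E)%E, (pvar p g r t <= M%:E)%E &
      forall u, r <= u -> u <= t -> `|Y u - Yt u| <= M]]) ->
  stable_upto (tau K) (glue_const ^+ K * (`|Y s - Yt s| + del)).
Proof.
move=> tau0 h; set L := `|Y s - Yt s| + del.
have L0 : 0 <= L by rewrite addr_ge0.
elim: K => [|K IH]; first by rewrite tau0 expr0 mul1r; exact: stable_start.
have gK : 1 <= glue_const ^+ K by rewrite exprn_ege1 // glue_const_ge1.
have Lg : L <= glue_const ^+ K * L by rewrite ler_peMl.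
have [sr rt tT hr] := h K; rewrite exprS -mulrA.
move: rt; rewrite le_eqVlt => /predU1P[e|rt].
  have up : glue_const ^+ K * L <= glue_const * (glue_const ^+ K * L).
    by rewrite ler_peMl ?glue_const_ge1 //; exact: le_trans Lg.
  move: IH; rewrite e => -[h1 h2 h3]; split.
  - by apply: le_trans h1 _; rewrite lee_fin.
  - by apply: le_trans h2 _; rewrite lee_fin.
  - by move=> u su ut; apply: le_trans up; exact: h3.
have [m1 m2 m3 m4 m5] := hr rt.
apply: (@stable_step (tau K) (tau K.+1) _ sr (ltW rt) tT _ m1 m2 m3 m4 m5 IH).
by apply: le_trans Lg; rewrite lerDr.
Qed.

End Gluing.

(** * Essential bounds of the controls *)

Section EssentialBound.
Context {R : realType} (m : nat).
Local Notation lebm := (@completed_lebesgue_measure R).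
Implicit Types (I : set R) (u : R -> 'cV[R]_m).

Lemma ae_Linf_norm I u :
  {ae lebm, forall t, I t -> (`|u t|%:E <= Linf_norm I u)%E}.
Proof.
rewrite /Linf_norm Lnorm.unlock /=; case: ifPn => [_|h].
  have := ess_sup_ge lebm (abse \o ((fun t : R => `|u t|%:E) \_ I)).
  move=> h; apply: filterS h => t + It.
  by rewrite /= patchE mem_set // abse_EFin normr_id.
have z : lebm setT = 0%E.
  by apply/eqP; move: h; rewrite -leNgt measure_le0.
by exists setT; split.
Qed.

Lemma Linf_norm_le I u (M : R) : 0 <= M ->
  {ae lebm, forall t, I t -> `|u t| <= M} -> (Linf_norm I u <= M%:E)%E.
Proof.
move=> M0 h; rewrite /Linf_norm Lnorm.unlock /=; case: ifPn => [_|_]; last first.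
  by rewrite lee_fin.
apply/ess_supP; apply: (ae_imp (mu := lebm) h) => t ht /=; rewrite patchE.
case: ifPn => [/set_mem It|_]; last by rewrite abse0 lee_fin.
by rewrite abse_EFin normr_id lee_fin; exact: ht.
Qed.

Lemma Linf_norm_ge0 I u : (0 <= Linf_norm I u)%E.
Proof. exact: Lnorm_ge0. Qed.

Lemma Linf_norm_diff (T : R) U u ut (t0 t1 : R) : 0 <= t0 -> t1 <= T ->
  Linf T U u -> Linf T U ut ->
  exists2 M, 0 <= M & Linf_norm `[t0, t1] (fun t => u t - ut t)%R = M%:E.
Proof.
move=> t00 t1T [_ _ hu] [_ _ hut].
have fin (v : R -> 'cV[R]_m) : (Linf_norm `[0%R, T] v < +oo)%E ->
    exists2 M, 0 <= M & Linf_norm `[0%R, T] v = M%:E.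
  move=> h; have v0 := Linf_norm_ge0 `[0, T] v.
  exists (fine (Linf_norm `[0%R, T] v)); first exact: fine_ge0.
  by rewrite fineK // ge0_fin_numE.
have [M1 M10 e1] := fin _ hu; have [M2 M20 e2] := fin _ hut.
have a1 := ae_Linf_norm `[0%R, T] u; have a2 := ae_Linf_norm `[0%R, T] ut.
rewrite e1 in a1; rewrite e2 in a2.
have M0 : 0 <= M1 + M2 by rewrite addr_ge0.
have le : (Linf_norm `[t0, t1] (fun t => u t - ut t)%R <= (M1 + M2)%:E)%E.
  apply: Linf_norm_le M0 _; apply: (ae_imp3 (mu := lebm) a1 a2 a2) => t h1 h2 _ /=.
  rewrite in_itv /= => /andP[tt0 tt1].
  have I : `[0, T]%classic t.
    by rewrite /= in_itv /= (le_trans t00 tt0) (le_trans tt1 t1T).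
  have := h1 I; have := h2 I; rewrite !lee_fin => k2 k1.
  by apply: le_trans (ler_normB _ _) _; apply: lerD.
have ge0 := Linf_norm_ge0 `[t0, t1] (fun t => u t - ut t)%R.
exists (fine (Linf_norm `[t0, t1] (fun t => u t - ut t)%R)); first exact: fine_ge0.
by rewrite fineK // ge0_fin_numE //; apply: le_lt_trans le (ltry _).
Qed.

End EssentialBound.

(** * The global estimate *)

Section Stability.
Context {R : realType} (n m d : nat) (p T : R).
Local Notation V := (R^o * 'cV[R]_n)%type.
Local Notation W := 'M[R]_(n, d).
Variables (U : set 'cV[R]_m) (b : R -> 'cV[R]_n -> 'cV[R]_m -> 'cV[R]_n)
  (sigma : R -> 'cV[R]_n -> W).
Hypothesis hp : 2 <= p < 3.
Local Notation lebm := (@completed_lebesgue_measure R).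

Let p0 : 0 < p. Proof. by case/andP: hp => h _; apply: lt_le_trans h. Qed.
Let p1 : 1 <= p. Proof. by case/andP: hp => h _; apply: le_trans h; rewrite ler1n. Qed.
Let p20 : 0 < p / 2. Proof. by rewrite divr_gt0. Qed.
Let p21 : 1 <= p / 2. Proof. by rewrite ler_pdivlMr // mul1r; case/andP: hp. Qed.

Lemma pvar2_diff_fin (E : normedModType R) q (A1 A2 : R -> R -> E) t0 t1 :
  1 <= q -> 0 <= t0 -> t0 <= t1 -> t1 <= T ->
  (forall u, t0 <= u <= t1 -> A1 u u = 0) -> (forall u, t0 <= u <= t1 -> A2 u u = 0) ->
  (pvar2 q A1 0 T < +oo)%E -> (pvar2 q A2 0 T < +oo)%E ->
  exists2 Q, 0 <= Q & pvar2 q (fun u v => A1 u v - A2 u v)%R t0 t1 = Q%:E.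
Proof.
move=> q1 t00 t01 t1T d1 d2 h1 h2; have q0 : 0 < q by apply: lt_le_trans q1.
have fin (A : R -> R -> E) : (pvar2 q A 0 T < +oo)%E -> exists2 Q, 0 <= Q & (pvar2 q A t0 t1 <= Q%:E)%E.
  move=> h; have := le_lt_trans (pvar2_sub (E := E) A q0 t00 t01 t1T) h.
  by move=> /pvar2_fin[Q Q0 ->]; exists Q.
have [Q1 Q10 k1] := fin _ h1; have [Q2 Q20 k2] := fin _ h2.
apply: pvar2_fin; apply: le_lt_trans (ltry (2 * (Q1 + Q2))).
exact: (pvar2_diff q1 t01 Q10 Q20 d1 d2 k1 k2).
Qed.

Section OnePair.
Variables (Df : V -> {linear V -> W}) (N Kb a C : R).
Let f (z : V) : W := sigma z.1 z.2.
Hypothesis hf : coef_bounds (slab T) N f Df.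
Hypothesis diffE : forall s x h, 0 <= s <= T -> 'd (sigma s) x h = Df (s, x) (0, h).
Hypothesis dN : d%:R <= N.
Hypothesis Kb0 : 0 <= Kb.
Hypothesis KN : Kb <= N.
Hypothesis a0 : 0 < a.
Hypothesis a1 : a < 1.
Hypothesis C1 : 1 <= C.
Hypothesis driftK : drift_lipschitz T U b Kb.
Hypothesis driftD : drift_stability T U b Kb.
Hypothesis localE : local_stability p T f Df N a C.

Variables (y yt : 'cV[R]_n) (u ut : R -> 'cV[R]_m) (X Xt : R -> 'cV[R]_d)
  (XX XXt : R -> R -> 'M[R]_d) (Y Yt : R -> 'cV[R]_n) (Y' Yt' : R -> W).
Hypothesis hu : Linf T U u.
Hypothesis hut : Linf T U ut.
Hypothesis rp : rough_path p T X XX.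
Hypothesis rpt : rough_path p T Xt XXt.
Hypothesis hY : RDE_solution p T b sigma y u X XX Y Y'.
Hypothesis hYt : RDE_solution p T b sigma yt ut Xt XXt Yt Yt'.

Let N1 : 1 <= N. Proof. exact: coef_M hf. Qed.
Let N0 : 0 <= N. Proof. exact: le_trans N1. Qed.
Let driftN : drift_lipschitz T U b N.
Proof.
move=> Y0 u0 s t cY hu0 s0 st tT.
have h := driftK cY hu0 s0 st tT; apply: le_trans h _.
by rewrite ler_wpM2r // subr_ge0.
Qed.

(** Here the greedy partition, the local estimate and the gluing meet: del gathers the
    distance of the drivers and the error due to the controls on the whole of
    [t0, t1]. *)
Lemma glued_estimate t0 t1 (J : set R) (M L del : R) :
  0 <= t0 -> t0 <= t1 -> t1 <= T -> 0 <= M -> 0 <= L ->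
  measurable (J : set (measurableTypeR R)) ->
  {ae leb, forall r, t0 <= r <= t1 -> ~ J r -> u r = ut r} ->
  {ae leb, forall r, t0 <= r <= t1 -> `|u r - ut r| <= M} ->
  (lebm J <= L%:E)%E -> N * (M * L) <= del ->
  (pvar p (fun r => X r - Xt r)%R t0 t1 <= del%:E)%E ->
  (pvar2 (p / 2) (fun r s => XX r s - XXt r s)%R t0 t1 <= del%:E)%E ->
  exists K : nat,
    (K%:R%:E <= greedy_number (w_control p X Xt XX XXt) (a `^ p) t0 t1)%E /\
    stable_upto p f t0 X Xt Y Yt t1 (glue_const N C ^+ K.+1 * (`|Y t0 - Yt t0| + del)).
Proof.
move=> t00 t01 t1T M0 L0 mJ hJ hM hL hdel hX hXX.
have p2 : 2 <= p by case/andP: hp.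
have del0 : 0 <= del by apply: le_trans hdel; rewrite mulr_ge0 // mulr_ge0.
have g1 : 1 <= glue_const N C by exact: glue_const_ge1.
move: (t01); rewrite le_eqVlt => /predU1P[e|lt01].
  exists 0%N; split; first by rewrite le_max lexx.
  have Dd : 0 <= `|Y t0 - Yt t0| + del by rewrite addr_ge0.
  have up : `|Y t0 - Yt t0| + del <= glue_const N C ^+ 1 * (`|Y t0 - Yt t0| + del).
    by rewrite expr1 ler_peMl.
  have -> : stable_upto p f t0 X Xt Y Yt t1 = stable_upto p f t0 X Xt Y Yt t0 by rewrite e.
  have [k1 k2 k3] := @stable_start R n d p f del t0 p2 del0 X Xt Y Yt.
  split.
  - by apply: le_trans k1 _; rewrite lee_fin.
  - by apply: le_trans k2 _; rewrite lee_fin.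
  - by move=> v sv vt; apply: le_trans up; exact: k3.
have [K [tau [tau0 tauK hK htau]]] := greedy_drivers hp rp rpt a0 a1 t00 lt01 t1T.
exists K; split; first exact: hK.
rewrite -tauK.
have hfb v : t0 <= v -> v <= t1 -> `|f (pt Yt v)| <= N.
  move=> tv vt; apply: (coef_b hf); split => //.
  by rewrite /= in_itv /= (le_trans t00 tv) (le_trans vt t1T).
apply: (@stable_iter R n d p f N C del t0 t1 p2 N1 C1 dN del0 X Xt Y Yt hfb tau K.+1 tau0).
move=> i; have [g2 g3 g4 g5] := htau i; split; [exact: g2|exact: g3|exact: g4|] => lt.
have [v1 v2 v3 v4 v5] := g5 lt.
have s0 := le_trans t00 g2; have tT := le_trans g4 t1T.
have hX' := le_trans (pvar2_sub _ p0 g2 g3 g4) hX.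
have hXX' := le_trans (pvar2_sub _ p20 g2 g3 g4) hXX.
have sub P : {ae lebm, forall r, t0 <= r <= t1 -> P r} ->
    {ae lebm, forall r : R, tau i <= r <= tau i.+1 -> P r}.
  move=> h; apply: (ae_imp (mu := lebm) h) => r hr /andP[ur rv]; apply: hr.
  by rewrite (le_trans g2 ur) (le_trans rv g4).
have [[[cY _] _ _] _ _] := hY; have [[[cYt _] _ _] _ _] := hYt.
have hL' : fine (lebm (`]tau i, tau i.+1] `&` J)) <= L.
  have le1 : (lebm (`]tau i, tau i.+1] `&` J) <= L%:E)%E.
    apply: le_trans hL; apply: le_measure; last exact: subIsetr.
      rewrite inE; apply: cara_measurable; apply: measurableI; last exact: mJ.
      exact: measurable_itv.
    by rewrite inE; exact: cara_measurable.
  have ge1 : (0 <= lebm (`]tau i, tau i.+1] `&` J))%E by exact: measure_ge0.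
  rewrite -lee_fin fineK // ge0_fin_numE //; exact: le_lt_trans le1 (ltry _).
have hD : drift_diff_le p N (tau i) (tau i.+1) del Y Yt (drift b Y u) (drift b Yt ut).
  exact: (RDE_drift_diff hp Kb0 KN driftD cY cYt hu hut s0 g3 tT M0 L0 mJ (sub _ hJ)
    (sub _ hM) hL' hdel).
have [l1 l2 l3] := localE (RDE_solves diffE driftN hu rp hY)
  (RDE_solves diffE driftN hut rpt hYt) s0 g3 tT del0 v1 v2 v5 v3 v4
  (RDE_rem_fin hp hY s0 g3 tT) (RDE_rem_fin hp hYt s0 g3 tT) hX' hXX' hD.
have a1' : (a%:E <= 1%:E)%E by rewrite lee_fin ltW.
by split; [exact: le_trans v1 a1'|exact: hX'|exact: l1|exact: l2|exact: l3].
Qed.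

End OnePair.
End Stability.

Section MainEstimate.
Context {R : realType}.
Local Notation lebm := (@completed_lebesgue_measure R).

(** The choice of the constant in the exponential: expR c >= 1 + c >= g. *)
Lemma expR_ge_pow (c g : R) (K : nat) : 1 <= g -> g <= c ->
  g ^+ K <= expR (c * K%:R).
Proof.
move=> g1 gc; have g0 : 0 <= g by apply: le_trans g1.
rewrite mulrC expRM_natl; apply: lerXn2r; rewrite ?nnegrE ?expR_ge0 //.
apply: le_trans gc _; apply: le_trans (expR_ge1Dx c); first by rewrite lerDr.
Qed.

(** One of the K + 1 factors g, the weight N of the controls and the number 2 of summands
    go into the constant in front, the other K factors g into the exponential. *)
Lemma stability_rhs_ge n m d (p alpha g N : R) (X Xt : R -> 'cV[R]_d) XX XXt
    (Y Yt : R -> 'cV[R]_n) (u ut : R -> 'cV[R]_m) t0 t1 (dX dXX l M : R) K :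
  1 <= N -> 1 <= g -> 0 <= dX -> 0 <= dXX -> 0 <= l -> 0 <= M ->
  pvar p (fun r => X r - Xt r)%R t0 t1 = dX%:E ->
  pvar2 (p / 2) (fun r s => XX r s - XXt r s)%R t0 t1 = dXX%:E ->
  Linf_norm `[t0, t1] (fun t => u t - ut t)%R = M%:E ->
  (K%:R%:E <= greedy_number (w_control p X Xt XX XXt) alpha t0 t1)%E ->
  ((2 * (g ^+ K.+1 * (`|Y t0 - Yt t0| + (dX + dXX + N * (M * l)))))%:E <=
   stability_rhs p (2 * g * N) alpha X Xt XX XXt Y Yt u ut t0 t1 l%:E)%E.
Proof.
move=> N1 g1 dX0 dXX0 l0 M0 eX eXX eM hK.
have N0 : 0 <= N by apply: le_trans N1.
have g0 : 0 <= g by apply: le_trans g1.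
set C := 2 * g * N.
have gC : g <= C by rewrite /C mulrAC ler_peMl // mulr_ege1 // ler1n.
have C0 : 0 <= C by exact: le_trans gC.
rewrite /stability_rhs eX eXX eM -EFinM -!EFinD.
set br := `|Y t0 - Yt t0| + (dX + dXX) + l * M.
have br0 : 0 <= br by rewrite addr_ge0 ?mulr_ge0 // addr_ge0 // addr_ge0.
have hE : ((expR (C * K%:R))%:E <=
    expeR (C%:E * greedy_number (w_control p X Xt XX XXt) alpha t0 t1))%E.
  have -> : (expR (C * K%:R))%:E = expeR (C%:E * K%:R%:E) by [].
  by rewrite lee_expeR; apply: lee_wpmul2l hK; rewrite lee_fin.
apply: (@le_trans _ _ ((C * expR (C * K%:R))%:E * br%:E)%E); last first.
  apply: lee_wpmul2r; first by rewrite lee_fin.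
  by rewrite EFinM; apply: lee_wpmul2l hE; rewrite lee_fin.
rewrite -EFinM lee_fin exprS.
have le_br : `|Y t0 - Yt t0| + (dX + dXX + N * (M * l)) <= N * br.
  rewrite /br [l * M]mulrC !mulrDr.
  have h1 : `|Y t0 - Yt t0| <= N * `|Y t0 - Yt t0| by rewrite ler_peMl.
  have h2 : dX <= N * dX by rewrite ler_peMl.
  have h3 : dXX <= N * dXX by rewrite ler_peMl.
  lra.
have gK : 0 <= g ^+ K by rewrite exprn_ge0.
have e1 : 2 * (g * g ^+ K * (N * br)) = C * (g ^+ K * br) by rewrite /C; ring.
apply: (@le_trans _ _ (C * (g ^+ K * br))).
  by rewrite -e1 ler_wpM2l // ler_wpM2l // mulr_ge0.
by rewrite -[leRHS]mulrA ler_wpM2l // ler_wpM2r // expR_ge_pow.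
Qed.

(** For two solutions with controls that agree off J; the case J = [t0, t1] is that of
    arbitrary controls. *)
Lemma stability_estimate (n m d : nat) (p T : R) (hp : 2 <= p < 3)
    (U : set 'cV[R]_m) (b : R -> 'cV[R]_n -> 'cV[R]_m -> 'cV[R]_n)
    (sigma : R -> 'cV[R]_n -> 'M[R]_(n, d)) :
  drift_assumption T U b ->
  Cb 3 (`[0, T] `*` setT) (fun z : (R^o * 'cV[R]_n)%type => sigma z.1 z.2) ->
  exists C alpha : R, [/\ 1 <= C, 0 < alpha < 1 &
    forall (y yt : 'cV[R]_n) (u ut : R -> 'cV[R]_m)
      (X Xt : R -> 'cV[R]_d) (XX XXt : R -> R -> 'M[R]_d)
      (Y Yt : R -> 'cV[R]_n) (Y' Yt' : R -> 'M[R]_(n, d)),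
    Linf T U u -> Linf T U ut ->
    rough_path p T X XX -> rough_path p T Xt XXt ->
    RDE_solution p T b sigma y u X XX Y Y' ->
    RDE_solution p T b sigma yt ut Xt XXt Yt Yt' ->
    forall t0 t1 : R, 0 <= t0 -> t0 <= t1 -> t1 <= T ->
    forall J : interval R, [set` J] `<=` `[t0, t1] ->
    {ae leb, forall t, t \in `[t0, t1] -> t \notin J -> u t = ut t} ->
    let rhs :=
      stability_rhs p C alpha X Xt XX XXt Y Yt u ut t0 t1 (leb [set` J]) in
    (pvar p (fun t => Y' t - Yt' t)%R t0 t1
     + pvar2 (p / 2)%R
         (fun s t => remainder X Y Y' s t - remainder Xt Yt Yt' s t)%R t0 t1
     <= rhs)%E /\
    (sup_norm (fun t => Y t - Yt t)%R t0 t1 <= rhs)%E].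
Proof.
move=> hb hs.
have [Kb Kb1 [driftK driftD]] := drift_bounds hb.
have [M [Df [hf0 diffE]]] := coef_time_space hs.
have M1 : 1 <= M := coef_M hf0.
have p0 : 0 < p by case/andP: hp => h _; apply: lt_le_trans h.
have p1 : 1 <= p by case/andP: hp => h _; apply: le_trans h; rewrite ler1n.
have p21 : 1 <= p / 2 by rewrite ler_pdivlMr // mul1r; case/andP: hp.
have d0 : 0 <= d%:R :> R by [].
have Kb0 : 0 <= Kb by apply: le_trans Kb1.
pose N := Kb + M + d%:R.
have dN : d%:R <= N by rewrite /N; lra.
have KN : Kb <= N by rewrite /N; lra.
have MN : M <= N by rewrite /N; lra.
have N1 : 1 <= N by exact: le_trans MN.
have hf := coef_bounds_le MN hf0.
have [a [C [a0 a1 C1 localE]]] := local_estimate hp hf dN.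
pose g := glue_const N C.
have g1 : 1 <= g by exact: glue_const_ge1.
exists (2 * g * N), (a `^ p); split.
- by rewrite mulr_ege1 // mulr_ege1 // ler1n.
- rewrite powR_gt0 //=; have := @gt0_ltr_powR _ p p0 a 1.
  by rewrite powR1; apply => //; rewrite nnegrE ?ltW.
move=> y yt u ut X Xt XX XXt Y Yt Y' Yt' hu hut rp rpt hY hYt t0 t1 t00 t01 t1T
  J Jsub hJ.
have inE01 r : (r \in `[t0, t1]) = (t0 <= r <= t1) by rewrite in_itv.
have [L [L0 eM]] : exists L, 0 <= L /\
    Linf_norm `[t0, t1] (fun t => u t - ut t)%R = L%:E.
  by have [L L0 eM] := Linf_norm_diff t00 t1T hu hut; exists L.
have mJ : measurable ([set` J] : set (measurableTypeR R)) by exact: measurable_itv.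
have Jfin : (lebm [set` J] < +oo)%E.
  apply: (@leb_itv_fin _ (t0 - 1) t1 _ mJ) => x /Jsub /=; rewrite !in_itv /=.
  by move=> /andP[h ->]; rewrite andbT; apply: lt_le_trans h; rewrite gtrBl ltr01.
have Jge0 : (0 <= lebm [set` J])%E by exact: measure_ge0.
pose l := fine (lebm [set` J]).
have eJ : lebm [set` J] = l%:E by rewrite /l fineK // ge0_fin_numE.
have l0 : 0 <= l by exact: fine_ge0.
have hJ' : {ae lebm, forall r, t0 <= r <= t1 -> ~ [set` J] r -> u r = ut r}.
  apply: (ae_imp (mu := lebm) hJ) => r h h1 h2; apply: h; first by rewrite inE01.
  exact/negP.
have hM : {ae lebm, forall r, t0 <= r <= t1 -> `|u r - ut r| <= L}.
  have := ae_Linf_norm `[t0, t1] (fun t => u t - ut t)%R; rewrite eM => h.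
  apply: (ae_imp (mu := lebm) h) => r h1 h2.
  by have := h1; rewrite /= inE01 lee_fin; apply.
have [[_ fX] _ fXX chX] := rp; have [[_ fXt] _ fXXt chXt] := rpt.
have [dX dX0 eX] : exists2 Q, 0 <= Q & pvar p (fun r => X r - Xt r)%R t0 t1 = Q%:E.
  have [Q Q0 eQ] := pvar2_diff_fin p1 t00 t01 t1T (fun u _ => subrr (X u))
    (fun u _ => subrr (Xt u)) fX fXt.
  exists Q; first exact: Q0.
  rewrite -eQ; apply: eq_pvar2 => v w _ _ _; zmod.
have diag (X0 : R -> 'cV[R]_d) (XX0 : R -> R -> 'M[R]_d) : rough_path p T X0 XX0 ->
    forall v, t0 <= v <= t1 -> XX0 v v = 0.
  move=> [_ _ _ ch] v /andP[tv vt].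
  have vT : v \in `[0, T] by rewrite in_itv /= (le_trans t00 tv) (le_trans vt t1T).
  have := ch v v v vT vT vT; rewrite subrr mul0mx addr0 => e.
  by apply: (addrI (XX0 v v)); rewrite -e addr0.
have [dXX dXX0 eXX] := pvar2_diff_fin p21 t00 t01 t1T (diag _ _ rp) (diag _ _ rpt)
  fXX fXXt.
have NL0 : 0 <= N * (L * l) by rewrite !mulr_ge0 // (le_trans _ N1).
pose del := dX + dXX + N * (L * l).
have h1 : (lebm [set` J] <= l%:E)%E by rewrite eJ.
have h2 : N * (L * l) <= del by rewrite /del lerDr addr_ge0.
have h3 : (pvar p (fun r => X r - Xt r)%R t0 t1 <= del%:E)%E.
  by rewrite eX lee_fin /del -addrA lerDl addr_ge0.
have h4 : (pvar2 (p / 2) (fun r s => XX r s - XXt r s)%R t0 t1 <= del%:E)%E.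
  by rewrite eXX lee_fin /del addrAC lerDr addr_ge0.
have [K [hK [k1 k2 k3]]] := glued_estimate hp hf diffE dN Kb0 KN a0 a1 C1 driftK driftD
  localE hu hut rp rpt hY hYt t00 t01 t1T L0 l0 mJ hJ' hM h1 h2 h3 h4.
have rhs := stability_rhs_ge Y Yt N1 g1 dX0 dXX0 l0 L0 eX eXX eM hK.
rewrite -/del in rhs; rewrite -/g in k1 k2 k3.
set B := g ^+ K.+1 * _ in rhs k1 k2 k3.
move=> rhs0; rewrite /rhs0 eJ.
have B0 : 0 <= B.
  by apply: le_trans (k3 t0 (lexx t0) t01).
have [_ hY' _] := hY; have [_ hYt' _] := hYt.
have in0 v : t0 <= v -> v <= t1 -> v \in `[0, T].
  by move=> tv vt; rewrite in_itv /= (le_trans t00 tv) (le_trans vt t1T).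
split.
- apply: le_trans rhs; rewrite mulr_natl mulr2n EFinD; apply: leeD.
    apply: le_trans k2; rewrite le_eqVlt; apply/orP; left; apply/eqP.
    apply: eq_pvar2 => v w tv vw wt.
    by rewrite !hY' ?hYt' ?in0 // ?(le_trans tv (ltW vw)) // (le_trans (ltW vw) wt).
  apply: le_trans k1; rewrite le_eqVlt; apply/orP; left; apply/eqP.
  apply: eq_pvar2 => v w tv vw wt; rewrite /dR.
  have vT : 0 <= v <= T.
    by have := in0 v tv (le_trans (ltW vw) wt); rewrite in_itv.
  by rewrite (RDE_rem w hY vT) (RDE_rem w hYt vT).
- apply: le_trans rhs; apply: ge_ereal_sup => _ [r + <-].
  rewrite /= in_itv /= => /andP[tr rt]; rewrite lee_fin.
  by apply: le_trans (k3 r tr rt) _; rewrite ler_peMl // ler1n.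
Qed.

End MainEstimate.

Theorem proposition3p16 (R : realType) (n m d : nat) (p T : R)
    (hp : 2 <= p < 3) (hT : 0 < T) (U : set 'cV[R]_m)
    (b : R -> 'cV[R]_n -> 'cV[R]_m -> 'cV[R]_n)
    (sigma : R -> 'cV[R]_n -> 'M[R]_(n, d))
    (hb : drift_assumption T U b)
    (hsigma : Cb 3 (`[0, T] `*` setT)
                (fun z : (R^o * 'cV[R]_n)%type => sigma z.1 z.2)) :
  (exists C alpha : R, [/\ 1 <= C, 0 < alpha < 1 &
    forall (y yt : 'cV[R]_n) (u ut : R -> 'cV[R]_m)
      (X Xt : R -> 'cV[R]_d) (XX XXt : R -> R -> 'M[R]_d)
      (Y Yt : R -> 'cV[R]_n) (Y' Yt' : R -> 'M[R]_(n, d)),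
    Linf T U u -> Linf T U ut ->
    rough_path p T X XX -> rough_path p T Xt XXt ->
    RDE_solution p T b sigma y u X XX Y Y' ->
    RDE_solution p T b sigma yt ut Xt XXt Yt Yt' ->
    forall t0 t1 : R, 0 <= t0 -> t0 <= t1 -> t1 <= T ->
    let rhs :=
      stability_rhs p C alpha X Xt XX XXt Y Yt u ut t0 t1 (leb `[t0, t1]) in
    (pvar p (fun t => Y' t - Yt' t)%R t0 t1
     + pvar2 (p / 2)%R
         (fun s t => remainder X Y Y' s t - remainder Xt Yt Yt' s t)%R t0 t1
     <= rhs)%E /\
    (sup_norm (fun t => Y t - Yt t)%R t0 t1 <= rhs)%E]) /\
  (exists C alpha : R, [/\ 1 <= C, 0 < alpha < 1 &
    forall (y yt : 'cV[R]_n) (u ut : R -> 'cV[R]_m)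
      (X Xt : R -> 'cV[R]_d) (XX XXt : R -> R -> 'M[R]_d)
      (Y Yt : R -> 'cV[R]_n) (Y' Yt' : R -> 'M[R]_(n, d)),
    Linf T U u -> Linf T U ut ->
    rough_path p T X XX -> rough_path p T Xt XXt ->
    RDE_solution p T b sigma y u X XX Y Y' ->
    RDE_solution p T b sigma yt ut Xt XXt Yt Yt' ->
    forall t0 t1 : R, 0 <= t0 -> t0 <= t1 -> t1 <= T ->
    forall J : interval R, [set` J] `<=` `[t0, t1] ->
    {ae leb, forall t, t \in `[t0, t1] -> t \notin J -> u t = ut t} ->
    let rhs :=
      stability_rhs p C alpha X Xt XX XXt Y Yt u ut t0 t1 (leb [set` J]) in
    (pvar p (fun t => Y' t - Yt' t)%R t0 t1
     + pvar2 (p / 2)%R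
         (fun s t => remainder X Y Y' s t - remainder Xt Yt Yt' s t)%R t0 t1
     <= rhs)%E /\
    (sup_norm (fun t => Y t - Yt t)%R t0 t1 <= rhs)%E]).

Proof.
have [C [alpha [C1 alpha01 h]]] := stability_estimate hp hb hsigma.
split; exists C, alpha; split; [exact: C1|exact: alpha01| |exact: C1|exact: alpha01|exact: h].
move=> y yt u ut X Xt XX XXt Y Yt Y' Yt' hu hut rp rpt hY hYt t0 t1 t00 t01 t1T.
apply: (h y yt u ut X Xt XX XXt Y Yt Y' Yt' hu hut rp rpt hY hYt t0 t1 t00 t01 t1T
  `[t0, t1] (@subset_refl _ _)).
by apply: aeW => t ->.
Qed.
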